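(* Let $u\in\mathrm{Reg}^{(r)}(\mathcal F,h)$ and $m_1=m_1(\mathcal F,u,h)$. Let $V^*=(A^*,\pi^* )\in S^{(m_1,r)}_{\mathbb R}(\mathcal F,u,h)$ be a critical point of $f_d$ on $S^{(m_1,r)}_{\mathbb R}(\mathcal F,u,h)$ with Lagrange multipliers $\mu^*\in\mathbb R^n$, such that the Lagrangian Hessian at $(A^*,\pi^* )$ is positive definite on the tangent space $T_{(A^*,\pi^* )}S^{(m_1,r)}_{\mathbb R}(\mathcal F,u,h)$. Suppose in addition that $$\min_{i,j\in[m_1],\,k\in[r]}c_{ij;k}>\Gamma .$$ Then there exists $c_0>0$ such that $D^2\mathcal L(V^* )[\eta^\perp,\eta^\perp]\ge c_0\|\eta^\perp\|_2^2$ for every off-step perturbation $\eta^\perp$ of $V^*$, where $\|\eta^\perp\|_2^2=\sum_k\int_{[0,1]^2}(\eta_k^\perp)^2$.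
   Context: Fix $r\ge1$; $[m]=\{1,\dots,m\}$. A multi-relational graph $F=(V(F),E_1(F),\dots,E_r(F))$ is a finite vertex set with $r$ sets of undirected edges, each edge listed once as a pair $(a,b)$; $E(F)=\{(a,b;k):(a,b)\in E_k(F)\}$. For $r$-tuples $W=(W_1,\dots,W_r)$ of symmetric measurable functions $[0,1]^2\to\mathbb R$ and $g=(g_1,\dots,g_r)$ real analytic functions $\mathbb R\to\mathbb R$, $$t(F,W,g)=\int_{[0,1]^{|V(F)|}}\prod_{k=1}^r\prod_{(a,b)\in E_k(F)}g_k(W_k(x_a,x_b))\prod_{v\in V(F)}dx_v .$$ A quantum graph is a finite real linear combination of multi-relational graphs; $t$ is extended linearly. $\mathcal F=(\mathcal F_1,\dots,\mathcal F_n)$ is an ordered set of quantum graphs, $h=(h_{i'k})$ an $n\times r$ matrix of real analytic functions with rows $h_{i'}$, $t(\mathcal F,W,h)=(t(\mathcal F_{i'},W,h_{i'}))_{i'=1}^n$. $f_0:\mathbb R\to\mathbb R$ is analytic and $f_d(W)=\sum_{k=1}^r\int_{[0,1]^2}f_0(W_k(x,y))\,dx\,dy$. Step functions. For $m\ge1$, an $r$-tuple $A=(A_{ij;k})$ of real symmetric $m\times m$ matrices and $\pi\in[0,1]^m$ with $\sum_i\pi_i=1$, let $S_1,\dots,S_m$ be consecutive intervals of lengths $\pi_i$ partitioning $[0,1]$; the step function $(A,\pi)$ equals $A_{ij;k}$ on $S_i\times S_j$ in coordinate $k$. $\mathcal W^{(m,r)}_{\mathbb R}$ is the space of all such $(A,\pi)$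 (Euclidean topology), $\mathcal W^{(m,r)}$ the subset with all $A_{ij;k}\in[0,1]$, $S^{(m,r)}_{\mathbb R}(\mathcal F,u,h)=\{(A,\pi)\in\mathcal W^{(m,r)}_{\mathbb R}:t(\mathcal F,(A,\pi),h)=u\}$, $T^{(m,r)}(\mathcal F,h)=t(\mathcal F,\mathcal W^{(m,r)},h)$. Derivatives on $\mathcal W^{(m,r)}_{\mathbb R}$ are along directions $(\delta A,\delta\pi)$ with $\sum_i\delta\pi_i=0$. $\mathrm{Reg}^{(r)}(\mathcal F,h)$ is the set of $u\in\bigcup_{m>0}T^{(m,r)}(\mathcal F,h)$ that for no $m$ are critical values of $t(\mathcal F,\cdot,h):\mathcal W^{(m,r)}_{\mathbb R}\to\mathbb R^n$. $m_1(\mathcal F,u,h)=\min\{m: r\frac{m(m+1)}2>n+1,\ u\in\operatorname{int}T^{(m,r)}(\mathcal F,h)\}$. Lagrangian. $\mathcal L(W)=f_d(W)-\sum_{i'}\mu^*_{i'}(t(\mathcal F_{i'},W,h_{i'})-u_{i'})$. Critical point with multipliers $\mu^*$: the derivative of $(A,\pi)\mapsto\mathcal L((A,\pi))$ vanishes at $(A^*,\pi^* )$. The Lagrangian Hessian is the second derivative of this function at $(A^*,\pi^* )$ in the coordinates $(A,\pi)$; the tangent space is the kernel of the differential of $t(\mathcal F,\cdot,h)$ at $(A^*,\pi^* )$. Here $|S_i|=\pi^*_i>0$. Off-step perturbation: $\eta^\perp=(\eta^\perp_1,\dots,\eta^\perp_r)$, $\eta_k^\perp\in L^2([0,1]^2)$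 symmetric with $\int_{S_i\times S_j}\eta^\perp_k=0$ for all $i,j,k$, where $S_1,\dots,S_{m_1}$ is the partition of $V^*$. For bounded symmetric $\eta$, $D^2\mathcal L(V^* )[\eta,\eta]=\frac{d^2}{d\varepsilon^2}|_{\varepsilon=0}\mathcal L(V^*+\varepsilon\eta)$, extended by $L^2$-continuity to all symmetric $L^2$ tuples. The quantities $c_{ij;k}$ and $\Gamma$. For a set $D$ of edges of a multi-relational graph $F$, a set $L$ of vertices containing the endpoints of $D$, and a fixed assignment of indices $x_v$ to $v\in L$, put $\tau=\sum_{(x_v)_{v\notin L}\in[m_1]^{V(F)\setminus L}}\prod_{(s,t;w)\in E(F)\setminus D}g_w(A^*_{x_sx_t;w})\prod_{v\notin L}\pi^*_{x_v}$. Write $\tau^{(ab;k)}_{ij}(F,g)$ for $D=\{(a,b;k)\}$, $L=\{a,b\}$, $x_a=i,x_b=j$; $\tau^{(ab;k),(bd;k')}_{ijl}(F,g)$ for $D=\{(a,b;k),(b,d;k')\}$, $L=\{a,b,d\}$, $x_a=i,x_b=j,x_d=l$; $\tau^{(ab);k,k'}_{ij}(F,g)$ for $D=\{(a,b;k),(a,b;k')\}$, $L=\{a,b\}$, $x_a=i,x_b=j$. Then $$c_{ij;k}=f_0''(A^*_{ij;k})-\sum_{i'=1}^n\mu^*_{i'}h_{i'k}''(A^*_{ij;k})\sum_{(a,b)\in E_k(\mathcal F_{i'})}\tau^{(ab;k)}_{ij}(\mathcal F_{i'},h_{i'}),$$ $\Gamma=\Gamma_{\rm sv}+\Gamma_{\rm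 sp}$ with $$\Gamma_{\rm sv}=\max_{j\in[m_1],k\in[r]}\sum_{i'}|\mu^*_{i'}|\sum_{k'\in[r]}\sum_{(a,b,d)}\sum_{i,l}\bigl|h_{i'k}'(A^*_{ij;k})h_{i'k'}'(A^*_{lj;k'})\tau^{(ab;k),(bd;k')}_{ijl}(\mathcal F_{i'},h_{i'})\bigr|\sqrt{\pi^*_i\pi^*_l},$$ where $(a,b,d)$ runs over triples of distinct vertices with $ab$ an edge in $E_k(\mathcal F_{i'})$ and $bd$ an edge in $E_{k'}(\mathcal F_{i'})$, and $$\Gamma_{\rm sp}=\sum_{i'}|\mu^*_{i'}|\sum_{k<k'}\ \sum_{(a,b)\in E_k(\mathcal F_{i'})\cap E_{k'}(\mathcal F_{i'})}\sum_{i,j}\bigl|h_{i'k}'(A^*_{ij;k})h_{i'k'}'(A^*_{ij;k'})\tau^{(ab);k,k'}_{ij}(\mathcal F_{i'},h_{i'})\bigr|.$$ For a quantum graph $\mathcal F_{i'}=\sum_c\alpha_cF_c$ the edge sums run over the constituents $F_c$, weighted by $\alpha_c$ in $c_{ij;k}$ and by $|\alpha_c|$ in $\Gamma$. *)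

(* Defs.v *)
From HB Require Import structures.
From mathcomp Require Import all_boot all_order all_algebra.
From mathcomp Require Import all_classical all_reals all_analysis.

Set Implicit Arguments.
Unset Strict Implicit.
Unset Printing Implicit Defensive.

Import Order.TTheory GRing.Theory Num.Theory.
Import numFieldNormedType.Exports.

Local Open Scope classical_set_scope.
Local Open Scope ring_scope.

Definition real_analytic (R : realType) (f : R -> R) : Prop :=
  forall x0 : R, exists (a : R^nat) (rho : R), 0 < rho /\
    forall x : R, `|x - x0| < rho -> pseries a (x - x0) @ \oo --> f x.

(** * Multi-relational graphs and quantum graphs *)

(* An undirected edge is stored as one of its two orientations.
   [edges_once] with [a = b] also excludes loops. *)
Record mgraph (r : nat) := MGraph {
  vtx : finType;
  edges : 'I_r -> {set vtx * vtx};
  edges_once : forall k a b, (a, b) \in edges k -> (b, a) \notin edges k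
}.

Definition adj (r : nat) (F : mgraph r) (k : 'I_r) (a b : vtx F) : bool :=
  ((a, b) \in edges F k) || ((b, a) \in edges F k).

(* The list [:: (alpha_1, F_1); ...; (alpha_s, F_s)] stands for the formal sum
   alpha_1 F_1 + ... + alpha_s F_s. *)
Definition qgraph (R : realType) (r : nat) := seq (R * mgraph r).

(** * Homomorphism densities *)

(* r-tuples of functions on the unit square; only the values on [0,1]^2 matter. *)
Definition kernels (R : realType) (r : nat) := 'I_r -> R -> R -> R.

Fixpoint iter_integral (R : realType) (V : eqType) (s : seq V)
    (f : (V -> R) -> R) (x : V -> R) : R :=
  if s is v :: s' then
    \int[@lebesgue_measure R]_(y in `[0, 1])
      iter_integral s' f (fun w => if w == v then y else x w)
  else f x.

(* The integral over [0,1]^V, as an iterated integral; every integrand below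
   is bounded and measurable, so the order is irrelevant by Fubini. *)
Definition cube_integral (R : realType) (V : finType) (f : (V -> R) -> R) : R :=
  iter_integral (enum V) f (fun=> 0).

Definition density (R : realType) (r : nat) (F : mgraph r) (W : kernels R r)
    (g : 'I_r -> R -> R) : R :=
  cube_integral (fun x : vtx F -> R =>
    \prod_(k < r) \prod_(e in edges F k) g k (W k (x e.1) (x e.2))).

Definition qdensity (R : realType) (r : nat) (Q : qgraph R r) (W : kernels R r)
    (g : 'I_r -> R -> R) : R :=
  \sum_(c <- Q) c.1 * density c.2 W g.

Definition densities (R : realType) (r n : nat) (F : 'I_n -> qgraph R r)
    (W : kernels R r) (h : 'I_n -> 'I_r -> R -> R) : 'rV[R]_n :=
  \row_i qdensity (F i) W (h i).

Definition unit_square (R : realType) : set (R * R) := `[0, 1] `*` `[0, 1].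

Definition lebesgue2 (R : realType) :=
  (@lebesgue_measure R \x @lebesgue_measure R)%E.

Definition disc_functional (R : realType) (r : nat) (f0 : R -> R)
    (W : kernels R r) : R :=
  \sum_(k < r)
    \int[@lebesgue2 R]_(z in @unit_square R) f0 (W k z.1 z.2).

Definition lagrangian (R : realType) (r n : nat) (f0 : R -> R)
    (F : 'I_n -> qgraph R r) (h : 'I_n -> 'I_r -> R -> R) (mu u : 'rV[R]_n)
    (W : kernels R r) : R :=
  disc_functional f0 W
  - \sum_(i < n) mu 0 i * (qdensity (F i) W (h i) - u 0 i).

(** * Step functions *)

Definition step_param (R : realType) (r m : nat) : Type :=
  (('I_r -> 'M[R]_m) * 'rV[R]_m)%type.

Definition step_space (R : realType) (r m : nat) : set (step_param R r m) :=
  [set p : step_param R r m | (forall k, (p.1 k)^T = p.1 k) /\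
           (forall i, 0 <= p.2 0 i <= 1) /\ \sum_i p.2 0 i = 1].

Definition step_space01 (R : realType) (r m : nat) : set (step_param R r m) :=
  [set p : step_param R r m | step_space p /\ forall k i j, 0 <= p.1 k i j <= 1].

(* [0, b_0], ]b_0, b_1], ]b_1, b_2], ... with b_i = pi_0 + ... + pi_i. *)
Definition block (R : realType) (m : nat) (pi : 'rV[R]_m) (i : 'I_m) : set R :=
  let a := \sum_(j < m | (j < i)%N) pi 0 j in
  let b := \sum_(j < m | (j <= i)%N) pi 0 j in
  if (i : nat) == 0%N then `[0, b]%classic else `]a, b]%classic.

Definition step_fun (R : realType) (r m : nat) (p : step_param R r m) :
    kernels R r :=
  fun k x y => \sum_(i < m) \sum_(j < m)
    p.1 k i j * \1_(block p.2 i) x * \1_(block p.2 j) y.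

Definition step_densities (R : realType) (r n m : nat) (F : 'I_n -> qgraph R r)
    (h : 'I_n -> 'I_r -> R -> R) (p : step_param R r m) : 'rV[R]_n :=
  densities F (step_fun p) h.

Definition level_set (R : realType) (r n m : nat) (F : 'I_n -> qgraph R r)
    (u : 'rV[R]_n) (h : 'I_n -> 'I_r -> R -> R) : set (step_param R r m) :=
  [set p : step_param R r m | step_space p /\ step_densities F h p = u].

Definition T_set (R : realType) (r n m : nat) (F : 'I_n -> qgraph R r)
    (h : 'I_n -> 'I_r -> R -> R) : set 'rV[R]_n :=
  step_densities F h @` @step_space01 R r m.

(** * Derivatives on the space of step functions *)

Definition direction (R : realType) (r m : nat) : set (step_param R r m) :=
  [set d : step_param R r m | (forall k, (d.1 k)^T = d.1 k) /\ \sum_i d.2 0 i = 0].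

Definition step_norm (R : realType) (r m : nat) (d : step_param R r m) : R :=
  \sum_(k < r) \sum_i \sum_j `|d.1 k i j| + \sum_i `|d.2 0 i|.

(* [D], restricted to the directions, is the derivative of [phi] at [p].
   The increments stay in [step_space], so that points where some pi_i vanishes
   are covered; [step_space] being convex with relative interior open in the
   affine space of direction [direction], [D] is determined on [direction]. *)
Definition is_step_diff (R : realType) (r m : nat) (Y : normedModType R)
    (phi : step_param R r m -> Y) (p : step_param R r m)
    (D : {linear step_param R r m -> Y}) : Prop :=
  forall e : R, 0 < e -> exists2 d : R, 0 < d &
    forall q, step_space q -> step_norm (q - p) < d ->
      `|phi q - phi p - D (q - p)| <= e * step_norm (q - p).

Definition critical_value (R : realType) (r n m : nat) (F : 'I_n -> qgraph R r)
    (h : 'I_n -> 'I_r -> R -> R) (u : 'rV[R]_n) : Prop :=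
  exists (p : step_param R r m) (D : {linear step_param R r m -> 'rV[R]_n}),
    [/\ step_space p, step_densities F h p = u,
        is_step_diff (step_densities F h) p D
      & ~ (forall y, exists2 d, direction d & D d = y)].

Definition Reg (R : realType) (r n : nat) (F : 'I_n -> qgraph R r)
    (h : 'I_n -> 'I_r -> R -> R) : set 'rV[R]_n :=
  [set u | (exists2 m : nat, (0 < m)%N & @T_set R r n m F h u) /\
           forall m : nat, (0 < m)%N -> ~ @critical_value R r n m F h u].

Definition m1_cond (R : realType) (r n : nat) (F : 'I_n -> qgraph R r)
    (u : 'rV[R]_n) (h : 'I_n -> 'I_r -> R -> R) (m : nat) : Prop :=
  (n.+1 < r * (m * m.+1 %/ 2))%N /\ (@T_set R r n m F h)° u.

Definition is_m1 (R : realType) (r n : nat) (F : 'I_n -> qgraph R r)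
    (u : 'rV[R]_n) (h : 'I_n -> 'I_r -> R -> R) (m1 : nat) : Prop :=
  m1_cond F u h m1 /\ forall m, m1_cond F u h m -> (m1 <= m)%N.

Definition step_lagrangian (R : realType) (r n m : nat) (f0 : R -> R)
    (F : 'I_n -> qgraph R r) (h : 'I_n -> 'I_r -> R -> R) (mu u : 'rV[R]_n)
    (p : step_param R r m) : R :=
  lagrangian f0 F h mu u (step_fun p).

Definition critical_point (R : realType) (r n m : nat) (f0 : R -> R)
    (F : 'I_n -> qgraph R r) (h : 'I_n -> 'I_r -> R -> R) (mu u : 'rV[R]_n)
    (p : step_param R r m) : Prop :=
  exists2 D : {linear step_param R r m -> R},
    is_step_diff (step_lagrangian f0 F h mu u) p D &
    forall d, direction d -> D d = 0.

Definition tangent_space (R : realType) (r n m : nat) (F : 'I_n -> qgraph R r)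
    (h : 'I_n -> 'I_r -> R -> R) (p : step_param R r m) :
    set (step_param R r m) :=
  [set d : step_param R r m | direction d /\
     exists2 D : {linear step_param R r m -> 'rV[R]_n},
       is_step_diff (step_densities F h) p D & D d = 0].

(* Used only where all pi_i > 0, so that p + e d is a step function for small e. *)
Definition lagrangian_hessian (R : realType) (r n m : nat) (f0 : R -> R)
    (F : 'I_n -> qgraph R r) (h : 'I_n -> 'I_r -> R -> R) (mu u : 'rV[R]_n)
    (p d : step_param R r m) : R :=
  derive1n 2 (fun e : R => step_lagrangian f0 F h mu u (p + e *: d)) 0.

(** * Perturbations and the second variation *)

Definition sym_kernels (R : realType) (r : nat) (eta : kernels R r) : Prop :=
  forall k, {in `[0, 1] &, forall x y, eta k x y = eta k y x}.

Definition measurable_kernels (R : realType) (r : nat) (eta : kernels R r) :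
    Prop :=
  forall k, measurable_fun (@unit_square R) (fun z : R * R => eta k z.1 z.2).

Definition bounded_kernels (R : realType) (r : nat) (eta : kernels R r) : Prop :=
  exists M : R, forall k, {in `[0, 1] &, forall x y, `|eta k x y| <= M}.

Definition L2_kernels (R : realType) (r : nat) (eta : kernels R r) : Prop :=
  measurable_kernels eta /\
  forall k, (@lebesgue2 R).-integrable (@unit_square R)
    (fun z => ((eta k z.1 z.2) ^+ 2)%:E).

Definition L2_normsq (R : realType) (r : nat) (eta : kernels R r) : R :=
  \sum_(k < r)
    \int[@lebesgue2 R]_(z in @unit_square R) (eta k z.1 z.2) ^+ 2.

Definition off_step (R : realType) (r m : nat) (pi : 'rV[R]_m)
    (eta : kernels R r) : Prop :=
  [/\ L2_kernels eta, sym_kernels eta &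
      forall k i j,
        \int[@lebesgue2 R]_(z in block pi i `*` block pi j)
          eta k z.1 z.2 = 0].

Definition D2_bounded (R : realType) (r n : nat) (f0 : R -> R)
    (F : 'I_n -> qgraph R r) (h : 'I_n -> 'I_r -> R -> R) (mu u : 'rV[R]_n)
    (W eta : kernels R r) : R :=
  derive1n 2 (fun e : R =>
    lagrangian f0 F h mu u (fun k x y => W k x y + e * eta k x y)) 0.

(* Bounded symmetric measurable tuples tending to [eta] in L^2. *)
Definition L2_bounded_nbhs (R : realType) (r : nat) (eta : kernels R r) :
    set_system (kernels R r) :=
  filter_from [set e : R | 0 < e] (fun e =>
    [set zeta : kernels R r |
      [/\ measurable_kernels zeta, sym_kernels zeta, bounded_kernels zeta &
          Num.sqrt (L2_normsq (fun k x y => zeta k x y - eta k x y)) < e]]).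

(* The extension of [D2_bounded] to symmetric L^2 tuples by L^2-continuity. *)
Definition D2_lagrangian (R : realType) (r n : nat) (f0 : R -> R)
    (F : 'I_n -> qgraph R r) (h : 'I_n -> 'I_r -> R -> R) (mu u : 'rV[R]_n)
    (W eta : kernels R r) : R :=
  lim (D2_bounded f0 F h mu u W @ L2_bounded_nbhs eta).

(** * The quantities c and Gamma *)

(* The edges of [D] are unordered pairs, given in either orientation; only the
   values of the assignment [x] on [L] matter. *)
Definition tau (R : realType) (r m : nat) (p : step_param R r m) (F : mgraph r)
    (g : 'I_r -> R -> R) (D : {set vtx F * vtx F * 'I_r}) (L : {set vtx F})
    (x : vtx F -> 'I_m) : R :=
  \sum_(y : {ffun vtx F -> 'I_m} | [forall v in L, y v == x v])
    (\prod_(w < r)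
       \prod_(e in edges F w | ((e, w) \notin D) && ((e.2, e.1, w) \notin D))
         g w (p.1 w (y e.1) (y e.2)))
    * \prod_(v in ~: L) p.2 0 (y v).

Definition tau_edge (R : realType) (r m : nat) (p : step_param R r m)
    (F : mgraph r) (g : 'I_r -> R -> R) (a b : vtx F) (k : 'I_r) (i j : 'I_m) :
    R :=
  tau p g [set (a, b, k)] [set a; b] (fun v => if v == a then i else j).

Definition tau_path (R : realType) (r m : nat) (p : step_param R r m)
    (F : mgraph r) (g : 'I_r -> R -> R) (a b d : vtx F) (k k' : 'I_r)
    (i j l : 'I_m) : R :=
  tau p g [set (a, b, k); (b, d, k')] [set a; b; d]
    (fun v => if v == a then i else if v == b then j else l).

Definition tau_pair (R : realType) (r m : nat) (p : step_param R r m)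
    (F : mgraph r) (g : 'I_r -> R -> R) (a b : vtx F) (k k' : 'I_r)
    (i j : 'I_m) : R :=
  tau p g [set (a, b, k); (a, b, k')] [set a; b]
    (fun v => if v == a then i else j).

Definition c_coef (R : realType) (r n m : nat) (f0 : R -> R)
    (F : 'I_n -> qgraph R r) (h : 'I_n -> 'I_r -> R -> R) (mu : 'rV[R]_n)
    (p : step_param R r m) (i j : 'I_m) (k : 'I_r) : R :=
  derive1n 2 f0 (p.1 k i j)
  - \sum_(s < n) mu 0 s * derive1n 2 (h s k) (p.1 k i j) *
      \sum_(c <- F s) c.1 *
        \sum_(e in edges c.2 k) tau_edge p (h s) e.1 e.2 k i j.

Definition Gamma_sv (R : realType) (r n m : nat) (F : 'I_n -> qgraph R r)
    (h : 'I_n -> 'I_r -> R -> R) (mu : 'rV[R]_n) (p : step_param R r m) : R :=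
  \big[Num.max/0]_(j < m) \big[Num.max/0]_(k < r)
    \sum_(s < n) `|mu 0 s| * \sum_(k' < r) \sum_(c <- F s) `|c.1| *
      \sum_(a : vtx c.2) \sum_(b : vtx c.2)
      \sum_(d : vtx c.2 | [&& a != b, b != d, a != d,
                              adj k a b & adj k' b d])
      \sum_(i < m) \sum_(l < m)
        `| derive1 (h s k) (p.1 k i j) * derive1 (h s k') (p.1 k' l j)
           * tau_path p (h s) a b d k k' i j l |
        * Num.sqrt (p.2 0 i * p.2 0 l).

(* An edge common to E_k and E_k' may be listed with opposite orientations. *)
Definition Gamma_sp (R : realType) (r n m : nat) (F : 'I_n -> qgraph R r)
    (h : 'I_n -> 'I_r -> R -> R) (mu : 'rV[R]_n) (p : step_param R r m) : R :=
  \sum_(s < n) `|mu 0 s| *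
    \sum_(k < r) \sum_(k' < r | (k < k')%N) \sum_(c <- F s) `|c.1| *
      \sum_(e in edges c.2 k | adj k' e.1 e.2)
      \sum_(i < m) \sum_(j < m)
        `| derive1 (h s k) (p.1 k i j) * derive1 (h s k') (p.1 k' i j)
           * tau_pair p (h s) e.1 e.2 k k' i j |.

Definition Gamma (R : realType) (r n m : nat) (F : 'I_n -> qgraph R r)
    (h : 'I_n -> 'I_r -> R -> R) (mu : 'rV[R]_n) (p : step_param R r m) : R :=
  Gamma_sv F h mu p + Gamma_sp F h mu p.

(* Main.v *)
Require Import Defs.
From HB Require Import structures.
From mathcomp Require Import all_boot all_order all_algebra.
From mathcomp Require Import all_classical all_reals all_analysis.
From mathcomp Require Import measurable_realfun.
From mathcomp Require Import ring lra.

(** The perturbed Lagrangian is an integral of products of analytic functions of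
    the kernel values on the edges.  For a bounded kernel [zeta] it can be
    differentiated twice under the integral sign, because the Taylor remainder
    of each factor is quadratic uniformly on the cube ([D2at_iter]).  The product
    rule turns the second derivative into a sum over ordered pairs of edges, and
    since the unperturbed kernel is constant on blocks, each pair contributes a
    sum over assignments of blocks to vertices, of a constant times the integral
    over the box of [zeta] on the first edge times [zeta] on the second
    ([D2at_density], [D2_boundedE]).

    Four kinds of pairs occur.  An edge paired with itself, together with the
    discrepancy functional, gives the sum of [c_coef] times the integrals of
    [zeta ^+ 2] over the blocks.  Two edges with the same endpoints are bounded by
    the arithmetic-geometric mean inequality, and add up to [Gamma_sp] times the
    squared norm.  Two edges sharing one endpoint form a path; a weighted
    arithmetic-geometric mean gives the factor sqrt(pi_i pi_l) ([path_int_le]), and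
    a Schur test, which uses that the coefficients are symmetric under reversal of
    the path ([sum_path_mass_sym]), gives [Gamma_sv] times the squared norm.  Two
    disjoint edges give a product of two block integrals of [zeta], which would
    vanish for an off-step kernel.  Hence, with [c0] a positive lower bound of the
    gaps between [c_coef] and [Gamma], the second variation is at least [c0] times the squared
    norm of [zeta], minus a constant times the square of the largest block
    integral ([second_variation_lower]).

    An off-step perturbation [eta] is in L^2 but need not be bounded, and the second
    variation at [eta] is a limit along bounded kernels tending to [eta].  These
    exist by truncation ([L2_bounded_nbhs_proper]); the limit exists because the
    quadratic form is continuous for the L^2 norm ([second_variation_lip],
    [D2_bounded_cvg]).  The bounded approximations need not be off-step, but their
    block integrals are at most their distance to [eta] ([block_int_near]), so the
    lower bound passes to the limit without its error term
    ([D2_lagrangian_ge]). *)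

Set Implicit Arguments.
Unset Strict Implicit.
Unset Printing Implicit Defensive.

Import Order.TTheory GRing.Theory Num.Theory.
Import numFieldNormedType.Exports.

Local Open Scope classical_set_scope.
Local Open Scope ring_scope.

(** * Analytic functions on the line *)

Lemma natSM_expr_le (R : realFieldType) (t : R) n : 0 <= t < 1 ->
  n.+1%:R * t ^+ n * (1 - t) <= 1 - t ^+ n.+1.
Proof.
move=> /andP[t0 t1]; elim: n => [|n IH]; first by rewrite expr0 expr1; lra.
have := ler_wpM2l t0 IH; rewrite -(natr1 n.+1) !exprS.
have : 0 <= (1 - t) * (1 - t * t ^+ n).
  by rewrite mulr_ge0 ?subr_ge0 ?(ltW t1)// -exprS exprn_ile1// ltW.
lra.
Qed.

(** Termwise differentiation keeps the disc of convergence: the factor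
    [n.+1] is absorbed by splitting [(|z| / |K|) ^+ n] as [t ^+ n * t ^+ n],
    because [n.+1 * t ^+ n] stays below [1 / (1 - t)]. *)
Lemma is_cvg_pseries_diffs (R : realType) (c : R^nat) (K z : R) :
  cvgn (pseries c K) -> `|z| < `|K| -> cvgn (pseries (pseries_diffs c) z).
Proof.
move=> cK zK; have [M [_ Mc]] := cvg_series_bounded cK.
have K0 : 0 < `|K| := le_lt_trans (normr_ge0 _) zK.
pose t := Num.sqrt (`|z| / `|K|).
have t0 : 0 <= t by exact: sqrtr_ge0.
have t1 : t < 1.
  by rewrite -(@sqrtr1 R) ltr_sqrt// ltr_pdivrMr// mul1r.
have tE : t ^+ 2 = `|z| / `|K| by rewrite sqr_sqrtr// divr_ge0.
apply: normed_cvg.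
have C0 : 0 <= `|M + 1| / `|K| / (1 - t).
  by rewrite !divr_ge0// subr_ge0 ltW.
apply: (@series_le_cvg _ _ (geometric (`|M + 1| / `|K| / (1 - t)) t)).
- by move=> n /=; exact: normr_ge0.
- by move=> n /=; rewrite mulr_ge0// exprn_ge0.
- move=> n /=; rewrite /pseries_diffs !normrM normr_nat normrX.
  have Mn : `|c n.+1| * `|K| ^+ n.+1 <= `|M + 1|.
    rewrite -normrX -normrM; apply: (Mc _ _ n.+1) => //.
    by rewrite (lt_le_trans _ (ler_norm _))// ltrDl.
  have -> : `|z| ^+ n = `|K| ^+ n * (t ^+ n * t ^+ n).
    by rewrite -exprMn -expr2 tE -exprMn mulrCA divff ?mulr1// gt_eqF.
  have nt : n.+1%:R * t ^+ n <= 1 / (1 - t).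
    rewrite ler_pdivlMr ?subr_gt0//.
    rewrite (le_trans (natSM_expr_le _ _)) ?t0 ?t1//.
    by rewrite lerBlDr lerDl exprn_ge0.
  have -> : n.+1%:R * `|c n.+1| * (`|K| ^+ n * (t ^+ n * t ^+ n)) =
    (`|c n.+1| * `|K| ^+ n.+1) / `|K| * (n.+1%:R * t ^+ n) * t ^+ n.
    by rewrite exprS; field; rewrite gt_eqF.
  rewrite ler_wpM2r ?exprn_ge0// -[(1 - t)^-1]div1r.
  apply: ler_pM => //.
  + by rewrite mulr_ge0// exprn_ge0.
  + by rewrite ler_wpM2r// invr_ge0.
- by apply: is_cvg_geometric_series; rewrite ger0_norm.
Qed.

Lemma is_derive_pseries (R : realType) (c : R^nat) (rho x : R) :
  (forall y, `|y| < rho -> cvgn (pseries c y)) -> `|x| < rho ->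
  is_derive x (1 : R) (fun y => limn (pseries c y))
    (limn (pseries (pseries_diffs c) x)).
Proof.
move=> cvc xrho; have n0 := normr_ge0 x.
have [e e0 rhoE] : exists2 e, 0 < e & rho = `|x| + 4 * e.
  by exists ((rho - `|x|) / 4); lra.
have nE t : 0 <= t -> `| `|x| + t * e| = `|x| + t * e.
  by move=> t0; rewrite ger0_norm// addr_ge0// mulr_ge0// ltW.
have cv1 : cvgn (pseries (pseries_diffs c) (`|x| + 2 * e)).
  apply: (@is_cvg_pseries_diffs _ _ (`|x| + 3 * e)).
    by apply: cvc; rewrite nE//; lra.
  by rewrite !nE//; lra.
apply: (@pseries_snd_diffs _ _ (`|x| + 1 * e)).
- by apply: cvc; rewrite nE//; lra.
- by apply: (is_cvg_pseries_inside cv1); rewrite !nE//; lra.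
- by apply: (is_cvg_pseries_diffs cv1); rewrite !nE//; lra.
- by rewrite nE//; lra.
Qed.

Lemma is_derive_pseries_center (R : realType) (g : R -> R) (a : R^nat)
    (x0 rho x : R) :
  (forall y, `|y - x0| < rho -> pseries a (y - x0) @ \oo --> g y) ->
  `|x - x0| < rho ->
  is_derive x (1 : R) g (limn (pseries (pseries_diffs a) (x - x0))).
Proof.
move=> ga xr.
have cva y : `|y| < rho -> cvgn (pseries a y).
  move=> yr; have := ga (y + x0); rewrite addrK => /(_ yr) h.
  by apply/cvg_ex; eexists; exact: h.
have d1 := is_derive_pseries cva xr.
have d2 : is_derive x (1 : R) (fun y : R => y - x0) 1.
  by apply: is_derive_eq; rewrite subr0.
have d3 := @is_derive1_comp R (fun y => limn (pseries a y))
  (fun y => y - x0) x _ _ d1 d2.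
rewrite mulr1 in d3.
apply: near_eq_is_derive d3.
near=> y; rewrite /=; apply: cvg_lim => //; apply: ga.
have : `|x - y| < rho - `|x - x0|.
  near: y; apply: (@cvgr_dist_lt _ _ _ (nbhs x) _ id) => //.
  by rewrite subr_gt0.
have := ler_distD x y x0; rewrite (distrC y x); lra.
Unshelve. all: by end_near. Qed.

(** The recentred power series agrees with [g] near each point of the disc, so
    [g] inherits its derivative, and [g^`()] is again given by a power series. *)
Lemma real_analytic_is_derive (R : realType) (g : R -> R) (x : R) :
  real_analytic g -> is_derive x 1 g (derive1 g x).
Proof.
move=> /(_ x)[a [rho [rho0 ga]]].
have xr : `|x - x| < rho by rewrite subrr normr0.
have d := is_derive_pseries_center ga xr.
by apply: DeriveDef; [exact: ex_derive|rewrite derive1E].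
Qed.

Lemma real_analytic_derive1 (R : realType) (g : R -> R) :
  real_analytic g -> real_analytic (derive1 g).
Proof.
move=> ga x0; have [a [rho [rho0 gx]]] := ga x0.
exists (pseries_diffs a), rho; split => // x xr.
have d := is_derive_pseries_center gx xr.
rewrite derive1E derive_val; apply: (@is_cvg_pseries_diffs _ _ ((`|x - x0| + rho) / 2)).
  have := gx ((`|x - x0| + rho) / 2 + x0); rewrite addrK => h.
  apply/cvg_ex; eexists; apply: h.
  by rewrite ger0_norm; have := normr_ge0 (x - x0); lra.
by rewrite [ltRHS]ger0_norm; have := normr_ge0 (x - x0); lra.
Qed.

Lemma real_analytic_continuous (R : realType) (g : R -> R) :
  real_analytic g -> continuous g.
Proof.
move=> ga x; have d := real_analytic_is_derive x ga.
by apply: differentiable_continuous; apply/derivable1_diffP; exact: ex_derive.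
Qed.

Lemma continuous_bounded_itv (R : realType) (g : R -> R) (K : R) :
  continuous g -> exists M : R, 0 <= M /\ forall x, `|x| <= K -> `|g x| <= M.
Proof.
move=> cg; have [K0|K0] := ltP K 0.
  by exists 0; split => // x xK; have := normr_ge0 x; lra.
have cng : continuous (fun x => `|g x|).
  by move=> x; apply: (continuous_comp (cg x)); exact: norm_continuous.
have KK : - K <= K by lra.
have [c _ cM] := EVT_max KK (continuous_subspaceT cng).
exists `|g c|; split => // x; rewrite ler_norml => /andP[x1 x2].
by apply: cM; rewrite in_itv /= x1 x2.
Qed.

(** The first-order Taylor remainder of an analytic function is quadratic,
    uniformly on compact sets; this is what allows differentiation under the
    integral sign without dominated convergence. *)
Lemma real_analytic_taylor1 (R : realType) (g : R -> R) (K : R) :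
  real_analytic g -> exists C : R, 0 <= C /\ forall x y, `|x| <= K -> `|y| <= K ->
    `|g y - g x - (y - x) * derive1 g x| <= C * (y - x) ^+ 2.
Proof.
move=> ga; have g'a := real_analytic_derive1 ga.
have g''c := real_analytic_continuous (real_analytic_derive1 g'a).
have [M [M0 gM]] := continuous_bounded_itv K g''c.
exists M; split => // x y xK yK.
have incr (f : R -> R) (fa : real_analytic f) a b : a <= b ->
    exists2 c, a <= c <= b & f b - f a = derive1 f c * (b - a).
  move=> ab; have [|//||c cab ->] := @MVT_segment R f (derive1 f) a b.
  - exact: ab.
  - by move=> z _; exact: real_analytic_is_derive.
  - by apply: continuous_subspaceT; exact: real_analytic_continuous.
  - by exists c => //; move: cab; rewrite in_itv.
have incr2 (f : R -> R) (fa : real_analytic f) a b :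
    exists2 c, (`|c| <= Num.max `|a| `|b|) && (`|c - a| <= `|b - a|) &
      f b - f a = derive1 f c * (b - a).
  have [ab|ba] := leP a b.
    have [c /andP[ac cb] E] := incr f fa a b ab; exists c => //.
    apply/andP; split; last by rewrite !ger0_norm; lra.
    rewrite le_max; have [c0|c0] := leP 0 c.
      by apply/orP; right; rewrite !ger0_norm; lra.
    by apply/orP; left; rewrite !ltr0_norm; lra.
  have [c /andP[ac cb] E] := incr f fa b a (ltW ba); exists c.
    apply/andP; split; last by rewrite !ler0_norm; lra.
    rewrite le_max; have [c0|c0] := leP 0 c.
      by apply/orP; left; rewrite !ger0_norm; lra.
    by apply/orP; right; rewrite !ltr0_norm; lra.
  by lra.
have [c /andP[cm cx] ->] := incr2 g ga x y.
have [d /andP[dm dx] dE] := incr2 _ g'a x c.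
have -> : derive1 g c * (y - x) - (y - x) * derive1 g x =
  (derive1 g c - derive1 g x) * (y - x) by ring.
rewrite dE -mulrA !normrM -[X in _ <= _ * X]ger0_norm ?sqr_ge0//.
rewrite expr2 normrM; apply: ler_pM => //.
  apply: gM; rewrite (le_trans dm)// ge_max xK (le_trans cm)//.
  by rewrite ge_max xK yK.
by rewrite ler_wpM2r.
Qed.

(** * Integration over the cube *)

Local Notation I1 f := (\int[@lebesgue_measure _]_(y in `[0, 1]) f y).

Definition bnd (T : Type) (R : realType) (f : T -> R) : Prop :=
  exists M : R, forall x, `|f x| <= M.

Definition upd (V : eqType) (T : Type) (x : V -> T) (v : V) (y : T) : V -> T :=
  fun w => if w == v then y else x w.

(** Joint measurability of a function of the family [x : V -> R], phrased by
    composition with measurable families of parameters.  It needs no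
    sigma-algebra on [V -> R], and it is stable under integration of one
    coordinate because the parameter space may be enlarged by a factor [R]. *)
Definition coord_meas (V : eqType) (R : realType) (f : (V -> R) -> R) : Prop :=
  forall d (T : measurableType d) (phi : T -> V -> R),
    (forall v, measurable_fun setT (fun t => phi t v)) ->
    measurable_fun setT (fun t => f (phi t)).

(** The class of integrands for which iterated integration over [0, 1]^V is a
    linear, monotone functional that does not depend on the order. *)
Definition nice (V : eqType) (R : realType) (f : (V -> R) -> R) : Prop :=
  coord_meas f /\ bnd f.

Section bounded.
Variables (T : Type) (R : realType).
Implicit Types f g : T -> R.

Lemma bnd_cst c : bnd (fun=> c : R) (T := T).
Proof. by exists `|c|. Qed.

Lemma bndD f g : bnd f -> bnd g -> bnd (fun x => f x + g x).
Proof.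
move=> [M fM] [N gN]; exists (M + N) => x.
by rewrite (le_trans (ler_normD _ _))// lerD.
Qed.

Lemma bndM f g : bnd f -> bnd g -> bnd (fun x => f x * g x).
Proof.
by move=> [M fM] [N gN]; exists (M * N) => x; rewrite normrM ler_pM.
Qed.

Lemma bnd_ge0 f : bnd f -> exists M : R, 0 <= M /\ forall x, `|f x| <= M.
Proof.
move=> [M fM]; exists `|M|; split => // x.
by rewrite (le_trans (fM x))// ler_norm.
Qed.

End bounded.

Lemma EFin_patch (T : Type) (R : realType) (D : set T) (f : T -> R) z :
  ((fun z => (f z)%:E) \_ D) z = (f z * \1_D z)%:E.
Proof. by rewrite patchE indicE; case: ifP => _; rewrite ?mulr1 ?mulr0. Qed.

Section I1_theory.
Variable R : realType.
Implicit Types f g : R -> R.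

Lemma lebesgue01 : @lebesgue_measure R `[0, 1]%classic = 1%E.
Proof. by rewrite lebesgue_measure_itv/= lte_fin ltr01 oppr0 adde0. Qed.

Lemma bnd_integrable f : measurable_fun setT f -> bnd f ->
  (@lebesgue_measure R).-integrable `[0, 1] (EFin \o f).
Proof.
move=> mf [M fM]; apply: measurable_bounded_integrable => //.
- by have := lebesgue01 => /= ->; rewrite ltry.
- exact: measurable_funTS.
- by exists M; split; [exact: num_real|move=> t Mt x _ /=; exact: le_trans (fM x) (ltW Mt)].
Qed.

Lemma I1D f g : measurable_fun setT f -> bnd f -> measurable_fun setT g ->
  bnd g -> I1 (fun y => f y + g y) = I1 f + I1 g.
Proof. by move=> mf bf mg bg; rewrite RintegralD//; exact: bnd_integrable. Qed.

Lemma I1Zl c f : measurable_fun setT f -> bnd f ->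
  I1 (fun y => c * f y) = c * I1 f.
Proof. by move=> mf bf; rewrite RintegralZl//; exact: bnd_integrable. Qed.

Lemma I1_cst (c : R) : I1 (fun=> c) = c.
Proof.
by rewrite Rintegral_cst//= lebesgue01 mulr1.
Qed.

Lemma ler_I1 f g : measurable_fun setT f -> bnd f -> measurable_fun setT g ->
  bnd g -> (forall y, 0 <= y <= 1 -> f y <= g y) -> I1 f <= I1 g.
Proof.
move=> mf bf mg bg fg; apply: le_Rintegral => //; first exact: bnd_integrable.
exact: bnd_integrable.
Qed.

Lemma I1_bnd f M : measurable_fun setT f -> (forall y, `|f y| <= M) ->
  `|I1 f| <= M.
Proof.
move=> mf fM; have bf : bnd f by exists M.
rewrite ler_norml -{1}[M]I1_cst -[X in _ && (_ <= X)]I1_cst.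
rewrite -[X in X <= _]mulN1r -I1Zl; [|exact: measurable_cst|exact: bnd_cst].
by apply/andP; split; apply: ler_I1 => //; try exact: bnd_cst;
  move=> y _; have := fM y; rewrite ler_norml; lra.
Qed.

End I1_theory.

Section fubini.
Variable R : realType.
Local Notation RR := (measurableTypeR R).
Implicit Types F : RR * RR -> R.

Lemma measurable_unit_square : @measurable _ (RR * RR)%type (@unit_square R).
Proof. by apply: measurableX. Qed.

Lemma lebesgue2_unit_square : @lebesgue2 R (@unit_square R) = 1%E.
Proof.
rewrite /lebesgue2 /unit_square product_measure1E//.
by have := lebesgue01 => /= ->; rewrite mule1.
Qed.

Lemma bnd_integrable2 F : measurable_fun (@unit_square R) F -> bnd F ->
  (@lebesgue2 R).-integrable (@unit_square R) (EFin \o F).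
Proof.
move=> mf [M fM]; apply: measurable_bounded_integrable => //.
- exact: measurable_unit_square.
- by rewrite [X in (X < _)%E]lebesgue2_unit_square ltry.
- by exists M; split; [exact: num_real|move=> t Mt x _ /=; exact: le_trans (fM x) (ltW Mt)].
Qed.

Lemma measurable_I1 d (T : measurableType d) (F : T * RR -> R) :
  measurable_fun setT F -> bnd F ->
  measurable_fun setT (fun t => I1 (fun y => F (t, y))).
Proof.
move=> mF bF; have [M [M0 FM]] := bnd_ge0 bF.
have mFt t : measurable_fun [set: R] (fun y : R => F (t, y)).
  by have := measurableT_comp mF (pair1_measurable t); apply.
(* Adding the bound M makes the integrand nonnegative, so that Tonelli's
   measurability of partial integrals applies. *)
have -> : (fun t => I1 (fun y => F (t, y))) =
    (fun t => I1 (fun y => F (t, y) + M) - M).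
  apply/funext => t; rewrite I1D//.
  - by rewrite I1_cst addrK.
  - by exists M => y; exact: FM.
  - exact: bnd_cst.
apply: measurable_funB => //.
rewrite [X in measurable_fun _ X](_ : _ = fun t => fine
    (\int[@lebesgue_measure R]_y
      ((F (t, y) + M) * \1_(`[0, 1] : set R) y)%:E)%E); last first.
  apply/funext => t; rewrite Rintegral_mkcond /Rintegral; congr fine.
  by apply: eq_integral => y _; rewrite patch_indic.
apply: measurableT_comp => //.

apply: (@measurable_fun_fubini_tonelli_F _ _ T (measurableTypeR R) R (@lebesgue_measure R)
  (fun z => ((F z + M) * \1_(`[0, 1] : set R) z.2)%:E)).
- apply/measurable_EFinP; apply: measurable_funM.
    exact: measurable_funD.
  by apply: measurableT_comp => //; exact: measurable_indic.
- move=> z; rewrite lee_fin mulr_ge0//.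
  by have := FM z; rewrite ler_norml; lra.
Qed.

Lemma Rintegral2E F : measurable_fun setT F -> bnd F ->
  \int[@lebesgue2 R]_(z in @unit_square R) F z
    = I1 (fun x => I1 (fun y => F (x, y))) /\
  \int[@lebesgue2 R]_(z in @unit_square R) F z
    = I1 (fun y => I1 (fun x => F (x, y))).
Proof.
move=> mF bF; have [M [M0 FM]] := bnd_ge0 bF.
have iF : (@lebesgue2 R).-integrable setT
    (fun z => ((F z) * \1_(@unit_square R) z)%:E).
  have := iffLR (integrable_mkcond (EFin \o F) measurable_unit_square)
    (bnd_integrable2 (measurable_funTS mF) bF).
  by apply: eq_integrable => // z _; rewrite EFin_patch.
have m1 x : measurable_fun [set: R] (fun y : R => F (x, y)).
  by have := measurableT_comp mF (pair1_measurable x); apply.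
have m2 y : measurable_fun [set: R] (fun x : R => F (x, y)).
  by have := measurableT_comp mF (pair2_measurable y); apply.
have b1 x : bnd (fun y => F (x, y)) by exists M => y; exact: FM.
have b2 y : bnd (fun x => F (x, y)) by exists M => x; exact: FM.
have E1 (f : R -> R) : measurable_fun setT f -> bnd f ->
    (\int[@lebesgue_measure R]_x (f x * \1_(`[0,1] : set R) x)%:E = (I1 f)%:E)%E.
  move=> mf bf; rewrite /Rintegral fineK; last first.
    by apply: integrable_fin_num => //; exact: bnd_integrable.
  rewrite [RHS]integral_mkcond; apply: eq_integral => z _.
  by rewrite EFin_patch.
have E : \int[@lebesgue2 R]_(z in @unit_square R) F z =
   fine (\int[@lebesgue2 R]_z ((F z) * \1_(@unit_square R) z)%:E).
  rewrite Rintegral_mkcond /Rintegral; congr fine.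
  by apply: eq_integral => z _; rewrite patch_indic.
have sqE x y : \1_(@unit_square R) (x, y) =
    \1_(`[0,1] : set R) x * \1_(`[0,1] : set R) y :> R.
  by rewrite !indicE /unit_square in_setX/= -natrM mulnb.
have mc c : bnd (fun=> c : R) (T := R) by exact: bnd_cst.
split; rewrite E.
- rewrite -integral12_prod_meas1// /fubini_F.
  have bI : bnd (fun x => I1 (fun y => F (x, y))).
    by exists M => x; apply: I1_bnd.
  have mI : measurable_fun [set: R] (fun x => I1 (fun y => F (x, y))).
    exact: measurable_I1.
  rewrite -[RHS]/(fine (_%:E)) -E1//; congr fine.
  apply: eq_integral => x _; rewrite [in RHS]mulrC -I1Zl// -E1.
  + by apply: eq_integral => y _; rewrite sqE; congr EFin; ring.
  + by apply: measurable_funM.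
  + exact: bndM.
- rewrite -integral21_prod_meas1// /fubini_G.
  pose F' (z : RR * RR) := F (z.2, z.1).
  have mF' : measurable_fun setT F'.
    apply: (measurableT_comp mF); apply: measurable_fun_pair.
    + exact: measurable_snd.
    + exact: measurable_fst.
  have bI : bnd (fun y => I1 (fun x => F' (y, x))).
    by exists M => x; apply: I1_bnd => [|y]; [exact: m2|exact: FM].
  have mI : measurable_fun [set: R] (fun y => I1 (fun x => F' (y, x))).
    by apply: measurable_I1 => //; exists M => x; exact: FM.
  rewrite -[RHS]/(fine (_%:E)) -E1//; congr fine.
  apply: eq_integral => y _; rewrite [in RHS]mulrC -I1Zl//= -E1.
  + by apply: eq_integral => x _; rewrite sqE; congr EFin; ring.
  + by apply: measurable_funM => //; exact: m2.
  + by apply: bndM => //; exact: b2.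
Qed.

Lemma I1_swap F : measurable_fun setT F -> bnd F ->
  I1 (fun x => I1 (fun y => F (x, y))) = I1 (fun y => I1 (fun x => F (x, y))).
Proof. by move=> mF bF; have [<- <-] := Rintegral2E mF bF. Qed.

End fubini.

Section nice_theory.
Variables (V : eqType) (R : realType).
Implicit Types (f g : (V -> R) -> R) (x : V -> R).

Lemma nice_cst (c : R) : nice (fun=> c : R) (V := V).
Proof. by split; [move=> *; exact: measurable_cst|exact: bnd_cst]. Qed.

Lemma niceD f g : nice f -> nice g -> nice (fun x => f x + g x).
Proof.
move=> [mf bf] [mg bg]; split; last exact: bndD.
by move=> d T phi mphi; apply: measurable_funD; [exact: mf|exact: mg].
Qed.

Lemma niceM f g : nice f -> nice g -> nice (fun x => f x * g x).
Proof.
move=> [mf bf] [mg bg]; split; last exact: bndM.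
by move=> d T phi mphi; apply: measurable_funM; [exact: mf|exact: mg].
Qed.

Lemma niceZ (c : R) f : nice f -> nice (fun x => c * f x).
Proof. by move=> nf; apply: niceM => //; exact: nice_cst. Qed.

Lemma niceN f : nice f -> nice (fun x => - f x).
Proof.
move=> nf; have -> : (fun x => - f x) = (fun x => -1 * f x).
  by apply/funext => x; rewrite mulN1r.
exact: niceZ.
Qed.

Lemma nice_sum (I : Type) (s : seq I) (P : pred I) (f : I -> (V -> R) -> R) :
  (forall i, P i -> nice (f i)) -> nice (fun x => \sum_(i <- s | P i) f i x).
Proof.
move=> nf; elim: s => [|i s IH].
  have -> : (fun x => \sum_(i <- [::] | P i) f i x) = fun=> 0.
    by apply/funext => x; rewrite big_nil.
  exact: nice_cst.
have -> : (fun x => \sum_(j <- i :: s | P j) f j x) = fun x =>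
    if P i then f i x + \sum_(j <- s | P j) f j x else \sum_(j <- s | P j) f j x.
  by apply/funext => x; rewrite big_cons.
case: (boolP (P i)) => // /nf ?; exact: niceD.
Qed.

Lemma nice_prod (I : Type) (s : seq I) (P : pred I) (f : I -> (V -> R) -> R) :
  (forall i, P i -> nice (f i)) -> nice (fun x => \prod_(i <- s | P i) f i x).
Proof.
move=> nf; elim: s => [|i s IH].
  have -> : (fun x => \prod_(i <- [::] | P i) f i x) = fun=> 1.
    by apply/funext => x; rewrite big_nil.
  exact: nice_cst.
have -> : (fun x => \prod_(j <- i :: s | P j) f j x) = fun x =>
    if P i then f i x * \prod_(j <- s | P j) f j x else \prod_(j <- s | P j) f j x.
  by apply/funext => x; rewrite big_cons.
case: (boolP (P i)) => // /nf ?; exact: niceM.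
Qed.

Lemma nice_comp (h : R -> R) f : continuous h -> nice f -> nice (fun x => h (f x)).
Proof.
move=> ch [mf [M bM]]; split.
  move=> d T phi mphi; apply: measurableT_comp; last exact: mf.
  exact: continuous_measurable_fun.
have [N [_ hN]] := continuous_bounded_itv M ch.
by exists N => x; exact: hN.
Qed.

Lemma nice_coord1 (phi : R -> R) v : measurable_fun setT phi -> bnd phi ->
  nice (fun x : V -> R => phi (x v)).
Proof.
move=> mphi [M phiM]; split; last by exists M => x.
by move=> d T psi mpsi; apply: measurableT_comp; last exact: mpsi.
Qed.

Lemma nice_coord2 (phi : R * R -> R) v w : measurable_fun setT phi -> bnd phi ->
  nice (fun x : V -> R => phi (x v, x w)).
Proof.
move=> mphi [M phiM]; split; last by exists M => x.
move=> d T psi mpsi; apply: (measurableT_comp mphi).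
by apply: measurable_fun_pair.
Qed.

Lemma measurable_nice_upd f x v : nice f ->
  measurable_fun [set: R] (fun y => f (upd x v y)).
Proof.
move=> [mf _]; apply: (mf _ R (upd x v)) => w.
rewrite /upd; case: (w == v); first exact: measurable_id.
exact: measurable_cst.
Qed.

Lemma bnd_nice_upd f x v : nice f -> bnd (fun y => f (upd x v y)).
Proof. by move=> [_ [M fM]]; exists M => y. Qed.

(** The integrated coordinate becomes the second factor of a product parameter
    space, on which partial integrals are measurable. *)
Lemma nice_I1 f v : nice f -> nice (fun x => I1 (fun y => f (upd x v y))).
Proof.
move=> nf; have [mf [M fM]] := nf; split; last first.
  exists M => x; apply: I1_bnd => //; exact: measurable_nice_upd.
move=> d T phi mphi.
apply: (@measurable_I1 R d T (fun z => f (upd (phi z.1) v z.2))); last by exists M.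
apply: mf => w; rewrite /upd; case: (w == v); first exact: measurable_snd.
by apply: (measurableT_comp (mphi w)); exact: measurable_fst.
Qed.

End nice_theory.

Definition in_cube (V : eqType) (R : realType) (x : V -> R) : Prop :=
  forall v, 0 <= x v <= 1.

Definition depends_on (V : eqType) (R : realType) (l : seq V)
    (f : (V -> R) -> R) : Prop :=
  forall x y, {in l, x =1 y} -> f x = f y.

Section iter_integral.
Variables (V : eqType) (R : realType).
Implicit Types (f g : (V -> R) -> R) (x : V -> R) (s : seq V).

Lemma iter_integral_cons v s f x :
  iter_integral (v :: s) f x = I1 (fun y => iter_integral s f (upd x v y)).
Proof. by []. Qed.

Lemma nice_iter_integral s f : nice f -> nice (iter_integral s f).
Proof. by move=> nf; elim: s => [//|v s IH]; exact: nice_I1. Qed.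

Let mu_iter s f x v (nf : nice f) :
  measurable_fun [set: R] (fun y => iter_integral s f (upd x v y)).
Proof. by apply: measurable_nice_upd; exact: nice_iter_integral. Qed.

Let bu_iter s f x v (nf : nice f) :
  bnd (fun y => iter_integral s f (upd x v y)).
Proof. by apply: bnd_nice_upd; exact: nice_iter_integral. Qed.

Lemma iter_integralD s f g x : nice f -> nice g ->
  iter_integral s (fun x => f x + g x) x
  = iter_integral s f x + iter_integral s g x.
Proof.
move=> nf ng; elim: s x => [//|v s IH] x; rewrite !iter_integral_cons -I1D//.
- by apply: eq_Rintegral => y _; rewrite IH.
- exact: mu_iter.
- exact: bu_iter.
- exact: mu_iter.
- exact: bu_iter.
Qed.

Lemma iter_integralZ s c f x : nice f ->
  iter_integral s (fun x => c * f x) x = c * iter_integral s f x.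
Proof.
move=> nf; elim: s x => [//|v s IH] x; rewrite !iter_integral_cons -I1Zl//.
- by apply: eq_Rintegral => y _; rewrite IH.
- exact: mu_iter.
- exact: bu_iter.
Qed.

Lemma iter_integral_cst s c x : iter_integral s (fun=> c) x = c :> R.
Proof.
elim: s x => [//|v s IH] x; rewrite iter_integral_cons -[RHS]I1_cst.
by apply: eq_Rintegral => y _.
Qed.

Lemma iter_integralB s f g x : nice f -> nice g ->
  iter_integral s (fun x => f x - g x) x
  = iter_integral s f x - iter_integral s g x.
Proof.
move=> nf ng; rewrite iter_integralD//; last exact: niceN.
congr (_ + _); rewrite -mulN1r -iter_integralZ//; congr (iter_integral _ _ _).
by apply/funext => z; rewrite mulN1r.
Qed.

Lemma iter_integral_sum (I : Type) (r : seq I) (P : pred I) (f : I -> (V -> R) -> R) s x :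
  (forall i, P i -> nice (f i)) ->
  iter_integral s (fun x => \sum_(i <- r | P i) f i x) x
  = \sum_(i <- r | P i) iter_integral s (f i) x.
Proof.
move=> nf; elim: r => [|i r IH].
  rewrite big_nil -[RHS](iter_integral_cst s _ x); congr (iter_integral _ _ _).
  by apply/funext => z; rewrite big_nil.
rewrite big_cons -IH; case: (boolP (P i)) => Pi.
  rewrite -iter_integralD; [|exact: nf|exact: nice_sum].
  congr (iter_integral _ _ _); apply/funext => z.
  by rewrite big_cons Pi.
congr (iter_integral _ _ _); apply/funext => z.
by rewrite big_cons (negbTE Pi).
Qed.

Lemma in_cube_upd x v y : in_cube x -> 0 <= y <= 1 -> in_cube (upd x v y).
Proof. by move=> cx y01 w; rewrite /upd; case: eqP. Qed.

Lemma ler_iter_integral s f g x : nice f -> nice g -> in_cube x ->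
  (forall z, in_cube z -> f z <= g z) ->
  iter_integral s f x <= iter_integral s g x.
Proof.
move=> nf ng cx fg; elim: s x cx => [|v s IH] x cx; first exact: fg.
rewrite !iter_integral_cons; apply: ler_I1.
- exact: mu_iter.
- exact: bu_iter.
- exact: mu_iter.
- exact: bu_iter.
- by move=> y y01; apply: IH; exact: in_cube_upd.
Qed.

Lemma eq_iter_integral s f g x : in_cube x ->
  (forall z, in_cube z -> f z = g z) ->
  iter_integral s f x = iter_integral s g x.
Proof.
move=> cx fg; elim: s x cx => [|v s IH] x cx; first exact: fg.
rewrite !iter_integral_cons; apply: eq_Rintegral => y.
rewrite inE/= in_itv/= => y01; apply: IH; exact: in_cube_upd.
Qed.

Lemma ler_norm_iter_integral s f g x : nice f -> nice g -> in_cube x ->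
  (forall z, in_cube z -> `|f z| <= g z) ->
  `|iter_integral s f x| <= iter_integral s g x.
Proof.
move=> nf ng cx fg; rewrite ler_norml; apply/andP; split; last first.
  by apply: ler_iter_integral => // z /fg; rewrite ler_norml => /andP[].
rewrite -mulN1r -iter_integralZ//; apply: ler_iter_integral => //; first exact: niceZ.
by move=> z /fg; rewrite mulN1r ler_norml => /andP[].
Qed.

Lemma iter_integral_ge0 s f x : nice f -> in_cube x ->
  (forall z, in_cube z -> 0 <= f z) -> 0 <= iter_integral s f x.
Proof.
move=> nf cx f0; rewrite -(iter_integral_cst s 0 x).
by apply: ler_iter_integral => //; exact: nice_cst.
Qed.

Lemma iter_integral_cat s1 s2 f x :
  iter_integral (s1 ++ s2) f x = iter_integral s1 (iter_integral s2 f) x.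
Proof.
elim: s1 x => [//|v s IH] x; rewrite cat_cons !iter_integral_cons.
by apply: eq_Rintegral => y _; rewrite IH.
Qed.

Lemma iter_integral_swap v w s f x : v != w -> nice f ->
  iter_integral (v :: w :: s) f x = iter_integral (w :: v :: s) f x.
Proof.
move=> vw nf; rewrite !iter_integral_cons.
have ng := nice_iter_integral s nf; set g := iter_integral s f in ng *.
have [mg [M gM]] := ng.
have uE (y z : R) : upd (upd x w z) v y = upd (upd x v y) w z.
  by apply/funext => t; rewrite /upd; case: eqP => // ->; rewrite (negbTE vw).
pose F (p : R * R) := g (upd (upd x v p.1) w p.2).
have mF : measurable_fun setT F.
  apply: mg => t; rewrite /upd; case: (t == w); first exact: measurable_snd.
  by case: (t == v); [exact: measurable_fst|exact: measurable_cst].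
have bF : bnd F by exists M => p; exact: gM.
transitivity (I1 (fun y => I1 (fun z => F (y, z)))); first by [].
rewrite (I1_swap mF bF); apply: eq_Rintegral => y _.
by rewrite iter_integral_cons; apply: eq_Rintegral => z _; rewrite /F/= -uE.
Qed.

(** Fubini: adjacent coordinates may be swapped, hence any permutation. *)
Lemma iter_integral_perm s s' f x : nice f -> uniq s -> perm_eq s s' ->
  iter_integral s f x = iter_integral s' f x.
Proof.
move=> nf; elim: s s' x => [|v s IH] s' x /=.
  by move=> _; rewrite perm_sym => /perm_nilP ->.
move=> /andP[vs us] ps.
have vs' : v \in s' by rewrite -(perm_mem ps) mem_head.
case/splitPr: vs' ps => l1 l2 ps.
have ps2 : perm_eq s (l1 ++ l2).
  by rewrite -(perm_cons v) (perm_trans ps)// -cat1s perm_catCA.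
have vl1 : v \notin l1.
  by apply: contra vs => vl1; rewrite (perm_mem ps2) mem_cat vl1.
transitivity (iter_integral (v :: l1 ++ l2) f x).
  by rewrite iter_integral_cons; apply: eq_Rintegral => y _; exact: IH.
elim: l1 vl1 x {ps ps2} => [//|w l1 IH1]; rewrite inE negb_or => /andP[vw vl1] x.
rewrite cat_cons iter_integral_swap// cat_cons iter_integral_cons [in RHS]iter_integral_cons.
by apply: eq_Rintegral => y _; exact: IH1.
Qed.

Lemma iter_integral_factor r (phi : V -> R -> R) (G : (V -> R) -> R) x : uniq r ->
  (forall v, measurable_fun setT (phi v)) -> (forall v, bnd (phi v)) ->
  (forall y z, (forall v, v \notin r -> y v = z v) -> G y = G z) ->
  iter_integral r (fun x => G x * \prod_(v <- r) phi v (x v)) x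
  = G x * \prod_(v <- r) I1 (phi v).
Proof.
move=> + mphi bphi; elim: r G x => [|v r IH] G x /=.
  by move=> _ _; rewrite !big_nil.
move=> /andP[vr ur] Gr.
rewrite big_cons.
transitivity (I1 (fun y => (G x * \prod_(w <- r) I1 (phi w)) * phi v y)).
  apply: eq_Rintegral => y _.
  pose G' z := G z * phi v (z v).
  transitivity (iter_integral r (fun x => G' x * \prod_(w <- r) phi w (x w))
    (upd x v y)).
    by congr (iter_integral _ _ _); apply/funext => z; rewrite big_cons /G' mulrA.
  rewrite IH//.
    rewrite /G' {2}/upd eqxx (Gr (upd x v y) x); first by rewrite mulrAC.
    by move=> w; rewrite inE negb_or /upd => /andP[/negbTE -> _].
  move=> z z' zz'; rewrite /G' (zz' v vr); congr (_ * _); apply: Gr => w.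
  by rewrite inE negb_or => /andP[_]; exact: zz'.
by rewrite I1Zl// mulrAC -mulrA.
Qed.

(** Coordinates entering only through the product weight integrate out, each
    contributing the mass of its factor. *)
Lemma iter_integral_split s l (phi : V -> R -> R) (H : (V -> R) -> R) x :
  uniq s -> uniq l -> {subset l <= s} ->
  (forall v, measurable_fun setT (phi v)) -> (forall v, bnd (phi v)) ->
  nice H -> depends_on l H ->
  iter_integral s (fun x => (\prod_(v <- s) phi v (x v)) * H x) x
  = (\prod_(v <- s | v \notin l) I1 (phi v))
    * iter_integral l (fun x => (\prod_(v <- l) phi v (x v)) * H x) x.
Proof.
move=> us ul ls mphi bphi nH Hl.
pose r := [seq v <- s | v \notin l].
have plr : perm_eq s (l ++ r).
  rewrite -(perm_filterC (mem l) s) perm_cat2r.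
  apply: uniq_perm => //; first exact: filter_uniq.
  by move=> v; rewrite mem_filter andb_idr//; exact: ls.
have nphi t : nice (fun x : V -> R => \prod_(v <- t) phi v (x v)).
  by apply: nice_prod => v _; exact: nice_coord1.
rewrite (@iter_integral_perm s (l ++ r))//; last exact: niceM.
rewrite iter_integral_cat -big_filter -/r -iter_integralZ; last exact: niceM.
congr (iter_integral _ _ _); apply/funext => z.
pose G z := (\prod_(v <- l) phi v (z v)) * H z.
transitivity (iter_integral r (fun x => G x * \prod_(v <- r) phi v (x v)) z).
  congr (iter_integral _ _ _); apply/funext => t.
  by rewrite (perm_big _ plr)/= big_cat/= /G mulrAC.
rewrite iter_integral_factor//; first by rewrite mulrC.
  exact: filter_uniq.
have inl v : v \in l -> v \notin r by rewrite mem_filter => ->.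
move=> y t yt; rewrite /G; congr (_ * _).
  by apply: eq_big_seq => v vl; rewrite yt ?inl.
by apply: Hl => v vl; rewrite yt ?inl.
Qed.

End iter_integral.

(** * Differentiation under the integral sign *)

(** [f' e] is the derivative of [f e] in [e], with a quadratic remainder that is
    uniform in the point: such a remainder survives integration unchanged, so
    derivatives pass through the integral by linearity and monotonicity. *)
Definition udiff (X : Type) (R : realType) (f f' : R -> X -> R) : Prop :=
  exists M : R, 0 <= M /\ forall e e0 x, `|e| <= 1 -> `|e0| <= 1 ->
    [/\ `|f e x| <= M, `|f' e x| <= M
      & `|f e x - f e0 x - (e - e0) * f' e0 x| <= M * (e - e0) ^+ 2].

Section udiff.
Variables (X : Type) (R : realType).
Implicit Types f g : R -> X -> R.

Lemma udiff_cst (c : X -> R) : bnd c -> udiff (fun=> c) (fun _ _ => 0).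
Proof.
move=> /bnd_ge0[M [M0 cM]]; exists M; split => // e e0 x _ _; split => //.
- by rewrite normr0.
- by rewrite mulr0 subr0 subrr normr0 mulr_ge0// sqr_ge0.
Qed.

Lemma udiffD f f' g g' : udiff f f' -> udiff g g' ->
  udiff (fun e x => f e x + g e x) (fun e x => f' e x + g' e x).
Proof.
move=> [M [M0 fM]] [N [N0 gN]]; exists (M + N); split; first exact: addr_ge0.
move=> e e0 x e1 e01; have [f1 f2 f3] := fM e e0 x e1 e01.
have [g1 g2 g3] := gN e e0 x e1 e01; split.
- by rewrite (le_trans (ler_normD _ _))// lerD.
- by rewrite (le_trans (ler_normD _ _))// lerD.
- have -> : f e x + g e x - (f e0 x + g e0 x) - (e - e0) * (f' e0 x + g' e0 x)
    = (f e x - f e0 x - (e - e0) * f' e0 x)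
      + (g e x - g e0 x - (e - e0) * g' e0 x) by ring.
  by rewrite [leRHS]mulrDl (le_trans (ler_normD _ _))// lerD.
Qed.

Lemma udiffM f f' g g' : udiff f f' -> udiff g g' ->
  udiff (fun e x => f e x * g e x)
        (fun e x => f' e x * g e x + f e x * g' e x).
Proof.
move=> [M [M0 fM]] [N [N0 gN]].
have MN0 : 0 <= M * N by exact: mulr_ge0.
exists (5 * (M * N)); split; first exact: mulr_ge0.
move=> e e0 x e1 e01; have [f1 f2 f3] := fM e e0 x e1 e01.
have [f1' f2' _] := fM e0 e x e01 e1.
have [g1 g2 g3] := gN e e0 x e1 e01.
have [g1' g2' _] := gN e0 e x e01 e1.
split.
- by rewrite normrM (le_trans (ler_pM _ _ f1 g1))//; lra.
- rewrite (le_trans (ler_normD _ _))// !normrM.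
  have := ler_pM _ _ f2 g1; have := ler_pM _ _ f1 g2.
  by rewrite !normr_ge0 => /(_ isT isT) ? /(_ isT isT) ?; lra.
- have -> : f e x * g e x - f e0 x * g e0 x
      - (e - e0) * (f' e0 x * g e0 x + f e0 x * g' e0 x) =
    (f e x - f e0 x - (e - e0) * f' e0 x) * g e x
    + (f e0 x * (g e x - g e0 x - (e - e0) * g' e0 x)
       + (e - e0) * f' e0 x * (g e x - g e0 x)) by ring.
  have d2 : `|e - e0| <= 2 by have := ler_normB e e0; lra.
  have gg : `|g e x - g e0 x| <= 3 * N * `|e - e0|.
    have -> : g e x - g e0 x =
      (g e x - g e0 x - (e - e0) * g' e0 x) + (e - e0) * g' e0 x by ring.
    rewrite (le_trans (ler_normD _ _))// normrM.
    have : N * (e - e0) ^+ 2 <= 2 * N * `|e - e0|.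
      rewrite -real_normK ?num_real// expr2 mulrA ler_wpM2r//.
      by rewrite mulrC ler_wpM2r.
    have : `|e - e0| * `|g' e0 x| <= `|e - e0| * N by rewrite ler_wpM2l.
    by lra.
  have s0 : (e - e0) ^+ 2 = `|e - e0| * `|e - e0|.
    by rewrite -expr2 real_normK// num_real.
  rewrite (le_trans (ler_normD _ _))//.
  have p1 : `|(f e x - f e0 x - (e - e0) * f' e0 x) * g e x|
      <= M * (e - e0) ^+ 2 * N by rewrite normrM ler_pM.
  have p2 : `|f e0 x * (g e x - g e0 x - (e - e0) * g' e0 x)|
      <= M * (N * (e - e0) ^+ 2) by rewrite normrM ler_pM.
  have p3 : `|(e - e0) * f' e0 x * (g e x - g e0 x)|
      <= (`|e - e0| * M) * (3 * N * `|e - e0|).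
    by rewrite !normrM ler_pM// ?mulr_ge0// ler_wpM2l.
  have := ler_normD (f e0 x * (g e x - g e0 x - (e - e0) * g' e0 x))
    ((e - e0) * f' e0 x * (g e x - g e0 x)).
  rewrite s0 in p1 p2 *; lra.
Qed.

Lemma udiff_sum (I : Type) (r : seq I) (P : pred I) (f f' : I -> R -> X -> R) :
  (forall i, P i -> udiff (f i) (f' i)) ->
  udiff (fun e x => \sum_(i <- r | P i) f i e x)
        (fun e x => \sum_(i <- r | P i) f' i e x).
Proof.
move=> uf; elim: r => [|i r [M [M0 IH]]].
  exists 0; split => // e e0 x _ _; rewrite !big_nil.
  by rewrite normr0 mulr0 !subr0 normr0 mul0r.
case: (boolP (P i)) => Pi.
  have [N [N0 gN]] := udiffD (uf i Pi) (ex_intro _ M (conj M0 IH)).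
  by exists N; split => // e e0 x e1 e01; rewrite !big_cons Pi; exact: gN.
exists M; split => // e e0 x e1 e01.
by rewrite !big_cons (negbTE Pi); exact: IH.
Qed.

Lemma udiff_prod_seq (I : eqType) (r : seq I) (f f' : I -> R -> X -> R) :
  uniq r -> (forall i, udiff (f i) (f' i)) ->
  udiff (fun e x => \prod_(i <- r) f i e x)
        (fun e x => \sum_(i <- r) f' i e x * \prod_(j <- r | j != i) f j e x).
Proof.
move=> + uf; elim: r => [_|i r IH /= /andP[ir ur]].
  have [M [M0 cM]] := udiff_cst (@bnd_cst X R 1).
  by exists M; split => // e e0 x e1 e01; rewrite !big_nil; exact: cM.
have [M [M0 fM]] := udiffM (uf i) (IH ur).
exists M; split => // e e0 x e1 e01.
have E t : \sum_(k <- i :: r) f' k t x * \prod_(j <- i :: r | j != k) f j t x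
    = f' i t x * \prod_(k <- r) f k t x
      + f i t x * \sum_(k <- r) f' k t x * \prod_(j <- r | j != k) f j t x.
  rewrite big_cons big_cons eqxx /=; congr (_ * _ + _).
    rewrite -big_filter; congr bigop; apply/all_filterP/allP => j jr.
    by apply: contraNneq ir => <-.
  rewrite big_distrr; apply: eq_big_seq => k kr /=.
  rewrite big_cons ifT; first by rewrite mulrCA.
  by apply: contraNneq ir => ->.
by rewrite !E !big_cons; exact: fM.
Qed.

Lemma udiff_prod (I : finType) (P : pred I) (f f' : I -> R -> X -> R) :
  (forall i, udiff (f i) (f' i)) ->
  udiff (fun e x => \prod_(i | P i) f i e x)
        (fun e x => \sum_(i | P i) f' i e x * \prod_(j | P j && (j != i)) f j e x).
Proof.
move=> uf; have [M [M0 fM]] := udiff_prod_seq (enum_uniq P) uf.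
exists M; split => // e e0 x e1 e01; have := fM e e0 x e1 e01.
rewrite !big_enum.
have E t : \sum_(i in P) f' i t x * \prod_(j <- enum P | j != i) f j t x
  = \sum_(i | P i) f' i t x * \prod_(j | P j && (j != i)) f j t x.
  by apply: eq_bigr => i _; rewrite big_enum_cond.
by rewrite !E.
Qed.

Lemma udiff_comp (g : R -> R) (W Y : X -> R) : real_analytic g ->
  bnd W -> bnd Y ->
  udiff (fun e x => g (W x + e * Y x))
        (fun e x => derive1 g (W x + e * Y x) * Y x).
Proof.
move=> ga /bnd_ge0[K [K0 WK]] /bnd_ge0[L [L0 YL]].
have [C [C0 gC]] := real_analytic_taylor1 (K + L) ga.
have [M1 [M10 gM1]] := continuous_bounded_itv (K + L) (real_analytic_continuous ga).
have [M2 [M20 gM2]] := continuous_bounded_itv (K + L)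
  (real_analytic_continuous (real_analytic_derive1 ga)).
have WYb e x : `|e| <= 1 -> `|W x + e * Y x| <= K + L.
  move=> e1; rewrite (le_trans (ler_normD _ _))// lerD// normrM.
  by rewrite -[L]mul1r ler_pM.
have CL0 : 0 <= C * L ^+ 2 by rewrite mulr_ge0// sqr_ge0.
have ML0 : 0 <= M2 * L by rewrite mulr_ge0.
exists (M1 + M2 * L + C * L ^+ 2); split; first by rewrite !addr_ge0.
move=> e e0 x e1 e01; split.
- by rewrite (le_trans (gM1 _ (WYb e x e1)))//; lra.
- rewrite normrM.
  have := ler_pM (normr_ge0 _) (normr_ge0 _) (gM2 _ (WYb e x e1)) (YL x).
  lra.
- have := gC _ _ (WYb e0 x e01) (WYb e x e1).
  have -> : W x + e * Y x - (W x + e0 * Y x) = (e - e0) * Y x by ring.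
  rewrite -!mulrA [Y x * _]mulrC => h; apply: (le_trans h).
  rewrite exprMn [_ * Y x ^+ 2]mulrC mulrA ler_wpM2r ?sqr_ge0//.
  have : Y x ^+ 2 <= L ^+ 2.
    by rewrite -[Y x ^+ 2]real_normK ?num_real// lerXn2r ?nnegrE.
  by move=> /(ler_wpM2l C0); lra.
Qed.

Lemma udiffMr f f' (c : X -> R) : udiff f f' -> bnd c ->
  udiff (fun e x => f e x * c x) (fun e x => f' e x * c x).
Proof.
move=> uf bc; have [M [M0 h]] := udiffM uf (udiff_cst bc).
exists M; split => // e e0 x e1 e01; have := h e e0 x e1 e01.
by rewrite !mulr0 !addr0.
Qed.

Lemma udiff_comp_snd (g : R -> R) (W Y : X -> R) : real_analytic g ->
  bnd W -> bnd Y ->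
  udiff (fun e x => derive1 g (W x + e * Y x) * Y x)
        (fun e x => derive1 (derive1 g) (W x + e * Y x) * Y x * Y x).
Proof.
move=> ga bW bY; apply: udiffMr => //.
exact: udiff_comp (real_analytic_derive1 ga) bW bY.
Qed.

End udiff.

(** Twice differentiable at 0 with second derivative [l].  Since [derive1n 2] is
    an iterated limit, the first derivative must exist around 0. *)
Definition D2at (R : realType) (Phi : R -> R) (l : R) : Prop :=
  exists Phi1 : R -> R,
    (forall e : R, `|e| < 1 -> is_derive e (1 : R) Phi (Phi1 e)) /\
    is_derive (0 : R) (1 : R) Phi1 l.

Section D2at.
Variable R : realType.
Implicit Types Phi Psi : R -> R.

Lemma is_derive_quad Phi (e0 l C : R) : `|e0| < 1 ->
  (forall e, `|e| <= 1 -> `|Phi e - Phi e0 - (e - e0) * l| <= C * (e - e0) ^+ 2) ->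
  is_derive e0 (1 : R) Phi l.
Proof.
move=> e01 PhiC.
have cv : h^-1 *: (Phi (h *: (1 : R) + e0) - Phi e0) @[h --> 0^'] --> l.
  apply/cvgrPdist_le => /= d d0.
  have C0 : 0 < `|C| + 1 by rewrite ltr_pwDr.
  near=> h.
  have h0 : h != 0 by near: h; exact: nbhs_dnbhs_neq.
  have hd : `|h| <= d / (`|C| + 1).
    near: h; apply: (@dnbhs0_le _ R^o) => //; exact: divr_gt0.
  have h1 : `|h| <= 1 - `|e0|.
    by near: h; apply: (@dnbhs0_le _ R^o) => //; rewrite subr_gt0.
  have := PhiC (h + e0); rewrite addrK => /(_ _).
  have he : `|h + e0| <= 1 by have := ler_normD h e0; lra.
  move=> /(_ he) b.
  have -> : l - h^-1 *: (Phi (h *: 1 + e0) - Phi e0) =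
    - (h^-1 * (Phi (h + e0) - Phi e0 - h * l)).
    by rewrite /GRing.scale/= mulr1; field.
  rewrite normrN normrM normfV ler_pdivrMl ?normr_gt0//.
  apply: (le_trans b); rewrite -real_normK ?num_real// expr2 mulrCA.
  rewrite ler_wpM2l//; apply: (@le_trans _ _ ((`|C| + 1) * `|h|)).
    by rewrite ler_wpM2r// (le_trans (ler_norm C))// lerDl.
  by rewrite mulrC -ler_pdivlMr.
by apply: DeriveDef; [apply/cvg_ex; exists l|exact: cvg_lim].
Unshelve. all: by end_near. Qed.

Lemma D2atE Phi l : D2at Phi l -> derive1n 2 Phi 0 = l.
Proof.
move=> [Phi1 [d1 d2]]; rewrite /= derive1E.
suff d3 : is_derive (0 : R) (1 : R) (derive1 Phi) l by rewrite derive_val.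
apply: near_eq_is_derive d2; near=> e; rewrite derive1E.
have e1 : `|e| < 1 by near: e; exact: (@nbhs0_lt _ R^o).
by have := d1 e e1 => d; rewrite derive_val.
Unshelve. all: by end_near. Qed.

Lemma D2at_cst (c : R) : D2at (fun=> c) 0.
Proof. by exists (fun=> 0); split => [e _|]; exact: is_derive_cst. Qed.

Lemma D2atD Phi Psi a b : D2at Phi a -> D2at Psi b ->
  D2at (fun e => Phi e + Psi e) (a + b).
Proof.
move=> [P1 [p1 p2]] [Q1 [q1 q2]]; exists (fun e => P1 e + Q1 e); split.
  by move=> e e1; have := p1 e e1; have := q1 e e1 => ? ?; exact: is_deriveD.
exact: is_deriveD.
Qed.

Lemma D2atZ c Phi a : D2at Phi a -> D2at (fun e => c * Phi e) (c * a).
Proof.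
move=> [P1 [p1 p2]]; exists (fun e => c * P1 e); split.
  by move=> e e1; have := p1 e e1 => ?; exact: is_deriveZ.
exact: is_deriveZ.
Qed.

Lemma D2at_sum (I : Type) (r : seq I) (P : pred I) (Phi : I -> R -> R) (a : I -> R) :
  (forall i, P i -> D2at (Phi i) (a i)) ->
  D2at (fun e => \sum_(i <- r | P i) Phi i e) (\sum_(i <- r | P i) a i).
Proof.
move=> h; elim: r => [|i r IH].
  rewrite big_nil (_ : (fun e => _) = fun=> 0); first exact: D2at_cst.
  by apply/funext => e; rewrite big_nil.
rewrite big_cons (_ : (fun e => _) = fun e => if P i
    then Phi i e + \sum_(j <- r | P j) Phi j e else \sum_(j <- r | P j) Phi j e).
  by case: (boolP (P i)) => // Pi; apply: D2atD => //; exact: h.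
by apply/funext => e; rewrite big_cons.
Qed.

Lemma D2at_iter (V : eqType) (s : seq V) (x : V -> R)
    (f f1 f2 : R -> (V -> R) -> R) :
  in_cube x -> (forall e, nice (f e)) -> (forall e, nice (f1 e)) ->
  (forall e, nice (f2 e)) -> udiff f f1 -> udiff f1 f2 ->
  D2at (fun e => iter_integral s (f e) x) (iter_integral s (f2 0) x).
Proof.
move=> cx nf nf1 nf2 uf uf1.
have K g g' : (forall e, nice (g e)) -> (forall e, nice (g' e)) -> udiff g g' ->
    forall e : R, `|e| < 1 -> is_derive e (1 : R)
      (fun e => iter_integral s (g e) x) (iter_integral s (g' e) x).
  move=> ng ng' [M [M0 gM]] e0 e01; apply: (@is_derive_quad _ _ _ M) => // e e1.
  have nB : nice (fun z => g e z - g e0 z) by apply: niceD => //; exact: niceN.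
  have nZ : nice (fun z => (e - e0) * g' e0 z) by exact: niceZ.
  rewrite -iter_integralB// -iter_integralZ// -iter_integralB//.
  rewrite -[leRHS](iter_integral_cst s _ x); apply: ler_norm_iter_integral => //.
  - by apply: niceD => //; exact: niceN.
  - exact: nice_cst.
  - by move=> z _; have [] := gM e e0 z e1 (ltW e01).
exists (fun e => iter_integral s (f1 e) x); split; first exact: K.
by apply: K => //; rewrite normr0.
Qed.

End D2at.

(** * Blocks of a step function *)

Section blocks.
Variables (R : realType) (m : nat) (pi : 'rV[R]_m).
Hypothesis pi_ge0 : forall i, 0 <= pi 0 i.
Hypothesis pi_sum : \sum_i pi 0 i = 1.

Definition left_end (k : nat) : R := \sum_(j < m | (j < k)%N) pi 0 j.

Lemma le_left_end k l : (k <= l)%N -> left_end k <= left_end l.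
Proof.
move=> kl; rewrite /left_end [leRHS](bigID (fun j : 'I_m => (j < k)%N))/=.
rewrite [X in X + _](eq_bigl (fun j : 'I_m => (j < k)%N)).
  by rewrite lerDl sumr_ge0.
by move=> j; rewrite andb_idl// => /leq_trans; apply.
Qed.

Lemma left_endS (i : 'I_m) : left_end i.+1 = left_end i + pi 0 i.
Proof.
rewrite /left_end (bigD1 i)//= addrC; congr (_ + _); apply: eq_bigl => j.
by rewrite ltnS ltn_neqAle andbC.
Qed.

Lemma left_end0 : left_end 0 = 0.
Proof. by rewrite /left_end big1// => j. Qed.

Lemma left_endm : left_end m = 1.
Proof. by rewrite -pi_sum; apply: eq_bigl => j; rewrite ltn_ord. Qed.

Lemma mem_block (i : 'I_m) x : block pi i x <->
  (if (i : nat) == 0%N then 0 <= x else left_end i < x) /\ x <= left_end i.+1.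
Proof.
by rewrite /block; case: ifP => _ /=; rewrite in_itv/=; split => [/andP|[-> ->]].
Qed.

Lemma block_sub01 (i : 'I_m) x : block pi i x -> 0 <= x <= 1.
Proof.
move=> /mem_block[h1 h2]; apply/andP; split.
  move: h1; case: ifP => // _ /ltW; apply: le_trans.
  by rewrite -left_end0; exact: le_left_end.
by rewrite (le_trans h2)// -left_endm le_left_end.
Qed.

Lemma block_inj (i j : 'I_m) x : block pi i x -> block pi j x -> i = j.
Proof.
have lt (a b : 'I_m) : (a < b)%N -> block pi a x -> ~ block pi b x.
  move=> ab /mem_block[_ h1] /mem_block[]; rewrite gtn_eqF ?(leq_ltn_trans _ ab)//.
  by move=> h2 _; have := le_left_end ab; lra.
move=> bi bj; apply/val_inj; case: (ltngtP i j) => // ij.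
  by have := lt _ _ ij bi.
by have := lt _ _ ij bj.
Qed.

Lemma block_cover x : 0 <= x <= 1 -> exists i : 'I_m, block pi i x.
Proof.
move=> /andP[x0 x1].
have ex : exists k : nat, x <= left_end k by exists m; rewrite left_endm.
case: (ex_minnP ex) => -[|k] xk kmin.
  have x00 : x = 0 by apply/eqP; rewrite eq_le x0 -left_end0 xk.
  have m0 : (0 < m)%N.
    rewrite lt0n; apply/eqP => m0; have := left_endm; rewrite m0 left_end0.
    by move=> /esym/eqP; rewrite oner_eq0.
  exists (Ordinal m0); apply/mem_block; rewrite eqxx; split => //.
  by rewrite x00 -left_end0 le_left_end.
have km : (k < m)%N by apply: (kmin m); rewrite left_endm.
exists (Ordinal km); apply/mem_block; split => //=; case: ifP => // _.
by rewrite ltNge; apply/negP => /kmin; rewrite ltnn.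
Qed.

Lemma measurable_block (i : 'I_m) : measurable (block pi i).
Proof. by rewrite /block; case: ifP => _; exact: measurable_itv. Qed.

Lemma measurable_indic_block (i : 'I_m) :
  measurable_fun [set: R] (\1_(block pi i) : R -> R).
Proof. by apply: measurable_indic; exact: measurable_block. Qed.

Lemma bnd_indic (T : Type) (A : set T) : bnd (\1_A : T -> R).
Proof.
by exists 1 => x; rewrite indicE; case: (_ \in _); rewrite ?normr1 ?normr0.
Qed.

Lemma indic_blockT (i : 'I_m) x : block pi i x -> \1_(block pi i) x = 1 :> R.
Proof. by move=> bx; rewrite indicE mem_set. Qed.

Lemma indic_blockF (i : 'I_m) x : ~ block pi i x -> \1_(block pi i) x = 0 :> R.
Proof. by move=> bx; rewrite indicE memNset. Qed.

Lemma sum_indic_block x : 0 <= x <= 1 -> \sum_i \1_(block pi i) x = 1 :> R.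
Proof.
move=> /block_cover[i bi]; rewrite (bigD1 i)//= indic_blockT// big1 ?addr0//.
move=> j ji; apply: indic_blockF => bj.
by move: ji; rewrite (block_inj bj bi) eqxx.
Qed.

Lemma I1_block (i : 'I_m) : I1 (\1_(block pi i) : R -> R) = pi 0 i.
Proof.
rewrite /Rintegral integral_indic//; last exact: measurable_block.
rewrite setIidl; last by move=> x /block_sub01/=; rewrite in_itv.
have le1 : left_end i <= left_end i.+1 by exact: le_left_end.
have -> : pi 0 i = left_end i.+1 - left_end i by rewrite left_endS addrAC subrr add0r.
have itvE b (c d : R) : c <= d ->
    @lebesgue_measure R [set` Interval (BSide b c) (BRight d)] = (d - c)%:E.
  move=> cd; rewrite lebesgue_measure_itv/= lte_fin.
  by case: ltP => // dc; rewrite (@le_anti _ _ c d) ?cd ?dc// subrr.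
rewrite -[RHS]/(fine (_%:E)); congr fine.
change (@lebesgue_measure R (block pi i) = (left_end i.+1 - left_end i)%:E).
rewrite /block -/(left_end i.+1) -/(left_end i).
case: ifP => [/eqP i0|_]; last exact: itvE.
by move: le1; rewrite i0 left_end0; exact: itvE.
Qed.

End blocks.

Lemma step_fun_block (R : realType) (r m : nat) (p : step_param R r m)
    (k : 'I_r) (i j : 'I_m) x y :
  (forall i, 0 <= p.2 0 i) -> block p.2 i x -> block p.2 j y ->
  step_fun p k x y = p.1 k i j.
Proof.
move=> p0 bi bj; rewrite /step_fun (bigD1 i)//= (bigD1 j)//=.
rewrite !indic_blockT// !mulr1 !big1 ?addr0//.
  move=> i' i'i; apply: big1 => j' _; rewrite [X in _ * X * _]indic_blockF.
    by rewrite mulr0 mul0r.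
  by move=> bi'; move: i'i; rewrite (block_inj p0 bi' bi) eqxx.
move=> j' j'j; rewrite [X in _ * X]indic_blockF ?mulr0//.
by move=> bj'; move: j'j; rewrite (block_inj p0 bj' bj) eqxx.
Qed.

Section kernels.
Variables (R : realType) (r : nat).

(** Kernels on which every integral below makes sense without restricting to
    the unit square. *)
Definition good_kernels (zeta : kernels R r) : Prop :=
  (forall k, measurable_fun [set: R * R] (fun z => zeta k z.1 z.2)) /\
  (exists M : R, forall k x y, `|zeta k x y| <= M).

Lemma good_step_fun m (p : step_param R r m) : good_kernels (step_fun p).
Proof.
have mi (i : 'I_m) : measurable_fun [set: R * R] (fun z => \1_(block p.2 i) z.1 : R).
  by apply: measurableT_comp; [exact: measurable_indic_block|exact: measurable_fst].
have mj (i : 'I_m) : measurable_fun [set: R * R] (fun z => \1_(block p.2 i) z.2 : R).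
  by apply: measurableT_comp; [exact: measurable_indic_block|exact: measurable_snd].
split.
  move=> k; apply: measurable_sum => i; apply: measurable_sum => j.
  apply: measurable_funM; last exact: mj.
  by apply: measurable_funM; [exact: measurable_cst|exact: mi].
exists (\sum_(k < r) \sum_(i < m) \sum_(j < m) `|p.1 k i j|) => k x y.
have h k' : 0 <= \sum_(i < m) \sum_(j < m) `|p.1 k' i j|.
  by apply: sumr_ge0 => i _; apply: sumr_ge0.
rewrite (bigD1 k)//= (@le_trans _ _ (\sum_(i < m) \sum_(j < m) `|p.1 k i j|))//.
  rewrite /step_fun (le_trans (ler_norm_sum _ _ _))//; apply: ler_sum => i _.
  rewrite (le_trans (ler_norm_sum _ _ _))//; apply: ler_sum => j _.
  rewrite !normrM -mulrA ler_piMr// !indicE.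
  by case: (_ \in _); case: (_ \in _); rewrite ?normr1 ?normr0 ?mulr1 ?mulr0.
by rewrite lerDl sumr_ge0.
Qed.

Lemma nice_kernel zeta k (V : eqType) (a b : V) : good_kernels zeta ->
  nice (fun x : V -> R => zeta k (x a) (x b)).
Proof.
move=> [mz [M zM]].
by apply: (@nice_coord2 V R (fun z => zeta k z.1 z.2)); last by exists M.
Qed.

End kernels.

(** * The second variation of a homomorphism density at a step function *)

Section density_variation.
Variables (R : realType) (r m : nat) (p : step_param R r m).
Hypothesis p_ge0 : forall i, 0 <= p.2 0 i.
Hypothesis p_sum : \sum_i p.2 0 i = 1.
Variables (F : mgraph r) (g : 'I_r -> R -> R).
Hypothesis g_analytic : forall k, real_analytic (g k).

Local Notation vt := (vtx F).
Local Notation edge := ('I_r * (vt * vt))%type.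

Definition listed_edge : pred edge := fun q => q.2 \in edges F q.1.

Definition on_edge (zeta : kernels R r) (q : edge) (x : vt -> R) : R :=
  zeta q.1 (x q.2.1) (x q.2.2).

Definition edge_val (y : {ffun vt -> 'I_m}) (q : edge) : R :=
  p.1 q.1 (y q.2.1) (y q.2.2).

Definition block_ind (y : {ffun vt -> 'I_m}) (x : vt -> R) : R :=
  \prod_(v <- enum vt) \1_(block p.2 (y v)) (x v).

(** Second partial derivatives of the edge product with respect to the values
    on the edges [q] and [q'], on the box of blocks [y]. *)
Definition edge_hess (y : {ffun vt -> 'I_m}) (q q' : edge) : R :=
  if q == q' then
    derive1n 2 (g q.1) (edge_val y q)
    * \prod_(s | listed_edge s && (s != q)) g s.1 (edge_val y s)
  else
    derive1 (g q.1) (edge_val y q) * derive1 (g q'.1) (edge_val y q')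
    * \prod_(s | (listed_edge s && (s != q)) && (s != q')) g s.1 (edge_val y s).

Definition box_integral (zeta : kernels R r) (y : {ffun vt -> 'I_m})
    (q q' : edge) : R :=
  iter_integral (enum vt)
    (fun x => block_ind y x * (on_edge zeta q x * on_edge zeta q' x)) (fun=> 0).

Lemma in_cube0 (T : eqType) : in_cube (fun=> 0 : R) (V := T).
Proof. by move=> v; rewrite lexx ler01. Qed.

Lemma nice_block_ind y : nice (block_ind y).
Proof.
apply: nice_prod => v _; apply: nice_coord1; last exact: bnd_indic.
exact: measurable_indic_block.
Qed.

Lemma nice_on_edge zeta q : good_kernels zeta -> nice (on_edge zeta q).
Proof. exact: nice_kernel. Qed.

Lemma block_of_point x : in_cube x ->
  exists y : {ffun vt -> 'I_m}, forall v, block p.2 (y v) (x v).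
Proof.
move=> cx; have h v : exists i : 'I_m, block p.2 i (x v) by exact: block_cover.
exists [ffun v => projT1 (cid (h v))] => v; rewrite ffunE.
exact: projT2 (cid (h v)).
Qed.

Lemma block_ind_eq (y y' : {ffun vt -> 'I_m}) x :
  (forall v, block p.2 (y v) (x v)) -> block_ind y' x = (y' == y)%:R.
Proof.
move=> yx; case: eqP => [->|/eqP ne].
  by rewrite /block_ind big1// => v _; rewrite indic_blockT.
have [v vne] : exists v, y' v != y v.
  apply/existsP; rewrite -negb_forall; apply: contra ne => /forallP h.
  by apply/eqP/ffunP => v; apply/eqP; exact: h.
rewrite /block_ind (bigD1_seq v)/= ?mem_enum ?enum_uniq// indic_blockF ?mul0r//.
by move=> y'v; move: vne; rewrite (block_inj p_ge0 y'v (yx v)) eqxx.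
Qed.

(** Each point of the cube lies in one box only, so a sum over boxes weighted by
    the indicators reads off the value there. *)
Lemma sum_block_ind q q' (t : R) x (y : {ffun vt -> 'I_m}) :
  (forall v, block p.2 (y v) (x v)) ->
  \sum_z edge_hess z q q' * (block_ind z x * t) = edge_hess y q q' * t.
Proof.
move=> yx; rewrite (bigD1 y)//= (block_ind_eq _ yx) eqxx mul1r big1 ?addr0//.
by move=> z zy; rewrite (block_ind_eq _ yx) (negbTE zy) mul0r mulr0.
Qed.

Let W := step_fun p.
Let fq (zeta : kernels R r) (q : edge) (e : R) (x : vt -> R) :=
  g q.1 (on_edge W q x + e * on_edge zeta q x).
Let d1 (zeta : kernels R r) (q : edge) (e : R) (x : vt -> R) :=
  derive1 (g q.1) (on_edge W q x + e * on_edge zeta q x) * on_edge zeta q x.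
Let d2 (zeta : kernels R r) (q : edge) (e : R) (x : vt -> R) :=
  derive1 (derive1 (g q.1)) (on_edge W q x + e * on_edge zeta q x)
    * on_edge zeta q x * on_edge zeta q x.

Lemma densityE (U : kernels R r) :
  density F U g = iter_integral (enum vt)
    (fun x => \prod_(q | listed_edge q) g q.1 (on_edge U q x)) (fun=> 0).
Proof.
rewrite /density /cube_integral; congr (iter_integral _ _ _).
by apply/funext => x; rewrite pair_big_dep.
Qed.

(** The product rule gives one term for each ordered pair of edges, the diagonal
    pairs carrying the second derivative of a single factor.  On a box of blocks
    the unperturbed factors are constant and leave the integral. *)
Lemma D2at_density zeta : good_kernels zeta ->
  D2at (fun e => density F (fun k x y => W k x y + e * zeta k x y) g)
    (\sum_(q | listed_edge q) \sum_(q' | listed_edge q') \sum_y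
      edge_hess y q q' * box_integral zeta y q q').
Proof.
move=> gz; have gW : good_kernels W by exact: good_step_fun.
have g1 k := real_analytic_derive1 (g_analytic k).
have g2 k := real_analytic_derive1 (g1 k).
have nW q : nice (on_edge W q) by exact: nice_on_edge.
have nz q : nice (on_edge zeta q) by exact: nice_on_edge.
have narg q e : nice (fun x => on_edge W q x + e * on_edge zeta q x).
  by apply: niceD => //; exact: niceZ.
have nf q e : nice (fq zeta q e).
  by apply: nice_comp => //; exact: real_analytic_continuous.
have nd1 q e : nice (d1 zeta q e).
  by apply: niceM => //; apply: nice_comp => //; exact: real_analytic_continuous.
have nd2 q e : nice (d2 zeta q e).
  apply: niceM => //; apply: niceM => //; apply: nice_comp => //.
  exact: real_analytic_continuous.
have bz q : bnd (on_edge zeta q) by case: (nz q).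
have bW q : bnd (on_edge W q) by case: (nW q).
have uf q : udiff (fq zeta q) (d1 zeta q) by exact: udiff_comp.
have ud1 q : udiff (d1 zeta q) (d2 zeta q) by exact: udiff_comp_snd.
pose f e x := \prod_(q | listed_edge q) fq zeta q e x.
pose f1 e x := \sum_(q | listed_edge q)
  d1 zeta q e x * \prod_(s | listed_edge s && (s != q)) fq zeta s e x.
pose f2 e x := \sum_(q | listed_edge q)
  (d2 zeta q e x * \prod_(s | listed_edge s && (s != q)) fq zeta s e x
   + d1 zeta q e x * \sum_(q' | listed_edge q' && (q' != q))
      d1 zeta q' e x *
        \prod_(s | (listed_edge s && (s != q)) && (s != q')) fq zeta s e x).
have uff1 : udiff f f1 by exact: udiff_prod.
have uf1f2 : udiff f1 f2.
  by apply: udiff_sum => q _; apply: udiffM => //; exact: udiff_prod.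
have nff e : nice (f e) by apply: nice_prod.
have nf1 e : nice (f1 e).
  by apply: nice_sum => q _; apply: niceM => //; exact: nice_prod.
have nf2 e : nice (f2 e).
  apply: nice_sum => q _; apply: niceD.
    by apply: niceM => //; exact: nice_prod.
  apply: niceM => //; apply: nice_sum => q' _; apply: niceM => //.
  exact: nice_prod.
have := D2at_iter (enum vt) (@in_cube0 _) nff nf1 nf2 uff1 uf1f2.
have -> : (fun e => iter_integral (enum vt) (f e) (fun=> 0)) =
    (fun e => density F (fun k x y => W k x y + e * zeta k x y) g).
  by apply/funext => e; rewrite densityE.
congr D2at.
have nb y q q' : nice (fun x =>
    block_ind y x * (on_edge zeta q x * on_edge zeta q' x)).
  by apply: niceM; [exact: nice_block_ind|exact: niceM].
transitivity (iter_integral (enum vt) (fun x =>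
  \sum_(q | listed_edge q) \sum_(q' | listed_edge q') \sum_y edge_hess y q q' *
    (block_ind y x * (on_edge zeta q x * on_edge zeta q' x))) (fun=> 0)).
  apply: eq_iter_integral; first exact: in_cube0.
  move=> x /block_of_point[y yx]; apply: eq_bigr => q Eq.
  have vq s : on_edge W s x + 0 * on_edge zeta s x = edge_val y s.
    by rewrite mul0r addr0; exact: step_fun_block.
  rewrite [RHS](bigD1 q)//= (sum_block_ind _ _ _ yx) /edge_hess eqxx; congr (_ + _).
    rewrite /d2 vq (eq_bigr (fun s => g s.1 (edge_val y s))).
      by rewrite /=; ring.
    by move=> s _; rewrite /fq vq.
  rewrite big_distrr; apply: eq_bigr => q' /andP[_ q'q] /=.
  rewrite (sum_block_ind _ _ _ yx) /edge_hess eq_sym (negbTE q'q) /d1 !vq.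
  rewrite (eq_bigr (fun s => g s.1 (edge_val y s))); last first.
    by move=> s _; rewrite /fq vq.
  by ring.
rewrite iter_integral_sum; last first.
  move=> q _; apply: nice_sum => q' _; apply: nice_sum => y _; exact: niceZ.
apply: eq_bigr => q _; rewrite iter_integral_sum; last first.
  by move=> q' _; apply: nice_sum => y _; exact: niceZ.
apply: eq_bigr => q' _; rewrite iter_integral_sum; last by move=> y _; exact: niceZ.
by apply: eq_bigr => y _; rewrite iter_integralZ.
Qed.

End density_variation.

(** * Integrals over boxes of blocks *)

Lemma iter_integral2E (R : realType) (V : eqType) (a b : V) (x : V -> R)
    (phi : R -> R -> R) : a != b ->
  iter_integral [:: a; b] (fun z => phi (z a) (z b)) x
  = I1 (fun s => I1 (fun t => phi s t)).
Proof.
move=> ab; rewrite !iter_integral_cons; apply: eq_Rintegral => s _.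
rewrite iter_integral_cons; apply: eq_Rintegral => t _ /=.
by rewrite /upd !eqxx (negbTE ab).
Qed.

(* Unification would otherwise unfold the iterated integrals. *)
#[local] Opaque iter_integral.

Section box_integrals.
Variables (R : realType) (m : nat) (pi : 'rV[R]_m).
Hypothesis pi_ge0 : forall i, 0 <= pi 0 i.
Hypothesis pi_sum : \sum_i pi 0 i = 1.

Definition block_int (i j : 'I_m) (phi : R -> R -> R) : R :=
  I1 (fun s => I1 (fun t => \1_(block pi i) s * \1_(block pi j) t * phi s t)).

Definition kernel_ok (phi : R -> R -> R) : Prop :=
  measurable_fun [set: R * R] (fun z => phi z.1 z.2) /\
  exists M : R, forall x y, `|phi x y| <= M.

Lemma kernel_okM phi psi : kernel_ok phi -> kernel_ok psi ->
  kernel_ok (fun x y => phi x y * psi x y).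
Proof.
move=> [mp [M pM]] [mq [N qN]]; split; first exact: measurable_funM.
by exists (M * N) => x y; rewrite normrM ler_pM.
Qed.

Lemma nice_kernel_ok (V : eqType) (a b : V) phi : kernel_ok phi ->
  nice (fun x : V -> R => phi (x a) (x b)).
Proof.
move=> [mp [M pM]].
by apply: (@nice_coord2 V R (fun z => phi z.1 z.2)); last by exists M.
Qed.

Lemma nice_indic_block (V : eqType) (v : V) (i : 'I_m) :
  nice (fun x : V -> R => \1_(block pi i) (x v)).
Proof.
by apply: nice_coord1; [exact: measurable_indic_block|exact: bnd_indic].
Qed.

Lemma indic01 (T : Type) (A : set T) (x : T) : 0 <= (\1_A x : R) <= 1.
Proof. by rewrite indicE; case: (_ \in _); rewrite lexx ler01. Qed.

Section one_set.
Variable V : eqType.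
Implicit Types (a b c d : V) (x : V -> R) (y : V -> 'I_m).

Lemma iter_block2 a b x0 i j phi : a != b ->
  iter_integral [:: a; b] (fun x =>
    \1_(block pi i) (x a) * \1_(block pi j) (x b) * phi (x a) (x b)) x0
  = block_int i j phi.
Proof.
exact: (@iter_integral2E R V a b x0
  (fun s t => \1_(block pi i) s * \1_(block pi j) t * phi s t)).
Qed.

#[local] Opaque block_int.

Lemma nice_block2 a b i j phi : kernel_ok phi ->
  nice (fun x : V -> R => \1_(block pi i) (x a) * \1_(block pi j) (x b)
     * phi (x a) (x b)).
Proof.
move=> kp; apply: niceM; last exact: nice_kernel_ok.
by apply: niceM; exact: nice_indic_block.
Qed.

(** Coordinates on which the integrand does not depend contribute the lengths
    of their blocks. *)
Lemma iter_box s l y (H : (V -> R) -> R) x0 :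
  uniq s -> uniq l -> {subset l <= s} -> nice H -> depends_on l H ->
  iter_integral s (fun x => (\prod_(v <- s) \1_(block pi (y v)) (x v)) * H x) x0
  = (\prod_(v <- s | v \notin l) pi 0 (y v)) * iter_integral l
      (fun x => (\prod_(v <- l) \1_(block pi (y v)) (x v)) * H x) x0.
Proof.
move=> us ul ls nH Hl.
rewrite (@iter_integral_split _ _ s l (fun v => \1_(block pi (y v))))//.
- by congr (_ * _); apply: eq_bigr => v _; exact: I1_block.
- by move=> v; exact: measurable_indic_block.
- by move=> v; exact: bnd_indic.
Qed.

Lemma iter_box2 s a b y phi x0 : uniq s -> a != b -> a \in s -> b \in s ->
  kernel_ok phi ->
  iter_integral s (fun x => (\prod_(v <- s) \1_(block pi (y v)) (x v))
     * phi (x a) (x b)) x0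
  = (\prod_(v <- s | v \notin [:: a; b]) pi 0 (y v))
     * block_int (y a) (y b) phi.
Proof.
move=> us ab as_ bs kp.
have ul : uniq [:: a; b] by rewrite /= inE ab.
have ls : {subset [:: a; b] <= s} by move=> v; rewrite !inE => /orP[] /eqP ->.
have nH := nice_kernel_ok a b kp.
have Hl : depends_on [:: a; b] (fun x : V -> R => phi (x a) (x b)).
  by move=> x z xz; rewrite !xz// !inE eqxx ?orbT.
rewrite (iter_box y x0 us ul ls nH Hl).
rewrite -(iter_block2 x0 (y a) (y b) phi ab).
have -> : (fun x : V -> R => \prod_(v <- [:: a; b]) \1_(block pi (y v)) (x v)
      * phi (x a) (x b))
    = (fun x => \1_(block pi (y a)) (x a) * \1_(block pi (y b)) (x b)
      * phi (x a) (x b)).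
  by apply/funext => x; rewrite !big_cons big_nil mulr1.
exact: erefl.
Qed.

Lemma iter_box4 a b c d y phi psi x0 : uniq [:: a; b; c; d] ->
  kernel_ok phi -> kernel_ok psi ->
  iter_integral [:: a; b; c; d] (fun x =>
    (\prod_(v <- [:: a; b; c; d]) \1_(block pi (y v)) (x v))
     * (phi (x a) (x b) * psi (x c) (x d))) x0
  = block_int (y a) (y b) phi * block_int (y c) (y d) psi.
Proof.
move=> u4 kp kq.
have [ab cd] : a != b /\ c != d.
  by move: u4; rewrite /= !inE !negb_or !andbT => /and3P[/and3P[? _ _] _ ?].
have nab : forall v, v \in [:: c; d] -> v != a /\ v != b.
  move: u4; rewrite /= !inE !negb_or !andbT.
  move=> /and3P[/and3P[_ ac ad] /andP[bc bd] _] v; rewrite !inE.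
  by case/orP => /eqP ->; rewrite ![_ == a]eq_sym ![_ == b]eq_sym.
have [ca cb] := nab c (mem_head _ _).
have [da db] : d != a /\ d != b by apply: nab; rewrite !inE eqxx orbT.
pose G (t : V -> R) :=
  \1_(block pi (y a)) (t a) * \1_(block pi (y b)) (t b) * phi (t a) (t b).
pose K (t : V -> R) :=
  \1_(block pi (y c)) (t c) * \1_(block pi (y d)) (t d) * psi (t c) (t d).
have -> : (fun t : V -> R =>
    (\prod_(v <- [:: a; b; c; d]) \1_(block pi (y v)) (t v))
     * (phi (t a) (t b) * psi (t c) (t d))) = (fun t => G t * K t).
  by apply/funext => t; rewrite /G /K !big_cons big_nil; ring.
have nG : nice G by exact: nice_block2.
have nK : nice K by exact: nice_block2.
have inner z : iter_integral [:: c; d] (fun t => G t * K t) z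
    = block_int (y c) (y d) psi * G z.
  rewrite -(iter_block2 z (y c) (y d) psi cd) mulrC -iter_integralZ; last first.
    exact: nK.
  rewrite !iter_integral_cons; apply: eq_Rintegral => s _.
  rewrite !iter_integral_cons; apply: eq_Rintegral => t _.
  have Gu : G (upd (upd z c s) d t) = G z.
    rewrite /G /upd ![a == _]eq_sym ![b == _]eq_sym.
    by rewrite (negbTE ca) (negbTE cb) (negbTE da) (negbTE db).
  exact: (congr1 (fun u => u * K (upd (upd z c s) d t)) Gu).
rewrite -[[:: a; b; c; d]]/([:: a; b] ++ [:: c; d]) iter_integral_cat.
rewrite (funext inner) iter_integralZ; last exact: nG.
by rewrite mulrC (iter_block2 x0 (y a) (y b) phi ab).
Qed.

End one_set.

Lemma block_int_ge0 i j phi : kernel_ok phi -> (forall s t, 0 <= phi s t) ->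
  0 <= block_int i j phi.
Proof.
move=> kp p0; rewrite -(@iter_block2 bool true false (fun=> 0))//.
apply: iter_integral_ge0; [exact: nice_block2|by move=> v; rewrite lexx ler01|].
move=> z _; have /andP[i0 _] := indic01 (block pi i) (z true).
have /andP[j0 _] := indic01 (block pi j) (z false).
by rewrite !mulr_ge0.
Qed.

Lemma block_int_le_sum i j phi psi c : kernel_ok phi -> kernel_ok psi ->
  kernel_ok c ->
  (forall s t, `|c s t| <= (phi s t + psi s t) / 2) ->
  `|block_int i j c| <= (block_int i j phi + block_int i j psi) / 2.
Proof.
move=> kp kq kc h; rewrite -!(@iter_block2 bool true false (fun=> 0))//.
rewrite -iter_integralD; [|exact: nice_block2|exact: nice_block2].
rewrite mulrC -iter_integralZ; last first.
  by apply: niceD; exact: nice_block2.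
apply: ler_norm_iter_integral; [exact: nice_block2| |by move=> v; rewrite lexx ler01|].
  by apply: niceZ; apply: niceD; exact: nice_block2.
move=> z _; rewrite normrM.
have /andP[i0 _] := indic01 (block pi i) (z true).
have /andP[j0 _] := indic01 (block pi j) (z false).
rewrite (@ger0_norm _ (_ * _)) ?mulr_ge0//.
rewrite -mulrDr mulrCA; apply: ler_wpM2l; first exact: mulr_ge0.
by rewrite mulrC.
Qed.

Lemma sum_block_int phi : kernel_ok phi ->
  \sum_i \sum_j block_int i j phi = I1 (fun s => I1 (fun t => phi s t)).
Proof.
move=> kp.
rewrite -(@iter_integral2E R bool true false (fun=> 0) phi)//.
transitivity (iter_integral [:: true; false] (fun x => \sum_i \sum_j
   (\1_(block pi i) (x true) * \1_(block pi j) (x false)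
     * phi (x true) (x false))) (fun=> 0)).
  rewrite iter_integral_sum; last first.
    by move=> i _; apply: nice_sum => j _; exact: nice_block2.
  apply: eq_bigr => i _; rewrite iter_integral_sum; last first.
    by move=> j _; exact: nice_block2.
  by apply: eq_bigr => j _; rewrite iter_block2.
apply: eq_iter_integral; first by move=> v; rewrite lexx ler01.
move=> z cz; under eq_bigr do rewrite -mulr_suml -mulr_sumr.
by rewrite -!mulr_suml !sum_indic_block// !mul1r.
Qed.

End box_integrals.

(** * Integrals attached to two edges *)

Section edge_pairs.
Variables (R : realType) (r m : nat) (p : step_param R r m).
Hypothesis p_pos : forall i, 0 < p.2 0 i.
Hypothesis p_sum : \sum_i p.2 0 i = 1.
Hypothesis p_sym : forall k i j, p.1 k i j = p.1 k j i.
Variables (F : mgraph r) (g : 'I_r -> R -> R).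
Variable zeta : kernels R r.
Hypothesis zeta_good : good_kernels zeta.
Hypothesis zeta_sym : forall k x y, zeta k x y = zeta k y x.

Local Notation vt := (vtx F).
Local Notation edge := ('I_r * (vt * vt))%type.
Local Notation is_edge := (@listed_edge r F).
Local Notation pi := p.2.

Let p_ge0 i : 0 <= pi 0 i. Proof. exact: ltW. Qed.

Definition joins (q : edge) (a b : vt) : bool :=
  (q.2 == (a, b)) || (q.2 == (b, a)).

Lemma edge_neq q : is_edge q -> q.2.1 != q.2.2.
Proof.
case: q => k [a b] /= Eq; apply/eqP => /= ab; move: Eq; rewrite /listed_edge /= ab => h.
by have := edges_once h; rewrite h.
Qed.

Lemma on_edgeE q a b x : joins q a b ->
  on_edge zeta q x = zeta q.1 (x a) (x b).
Proof. by rewrite /on_edge => /orP[] /eqP -> //=; rewrite zeta_sym. Qed.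

Lemma edge_valE (y : {ffun vt -> 'I_m}) q a b : joins q a b ->
  edge_val p y q = p.1 q.1 (y a) (y b).
Proof. by rewrite /edge_val => /orP[] /eqP -> //=; rewrite p_sym. Qed.

(** Since the reverse of a listed edge is not listed, removing both orientations
    of a vertex pair from an edge set removes exactly the listed one. *)
Lemma same_edge s q a b : is_edge s -> is_edge q -> joins q a b ->
  ((s.2, s.1) == (a, b, q.1)) || ((s.2.2, s.2.1, s.1) == (a, b, q.1)) = (s == q).
Proof.
case: s => k [s1 s2]; case: q => l [q1 q2] /=; rewrite /listed_edge /= => Es Eq.
rewrite /joins /= => J; apply/idP/eqP; last first.
  move=> [-> -> ->]; case/orP: J => /eqP[-> ->]; first by rewrite eqxx.
  by rewrite eqxx orbT.
case/orP => /eqP[h1 h2 h3]; subst; case/orP: J => /eqP[h1 h2]; subst => //.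
  by have := edges_once Es; rewrite Eq.
by have := edges_once Es; rewrite Eq.
Qed.

Lemma tau_edgeE q a b i j : is_edge q -> joins q a b ->
  tau_edge p g a b q.1 i j =
  \sum_(y : {ffun vt -> 'I_m} |
      [forall v in [set a; b]%SET, y v == if v == a then i else j])
    (\prod_(s | is_edge s && (s != q)) g s.1 (edge_val p y s))
    * \prod_(v in (~: [set a; b])%SET) pi 0 (y v).
Proof.
move=> Eq J; rewrite /tau_edge /tau; apply: eq_big => [//|y _]; congr (_ * _).
rewrite pair_big_dep/=; apply: eq_bigl => s; rewrite !inE -negb_or.
by rewrite /listed_edge; case Es: (s.2 \in _) => //=; rewrite (same_edge Es Eq J).
Qed.

Lemma tau_pathE q q' a b d i j l : is_edge q -> is_edge q' ->
  joins q a b -> joins q' b d ->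
  tau_path p g a b d q.1 q'.1 i j l =
  \sum_(y : {ffun vt -> 'I_m} | [forall v in [set a; b; d]%SET, y v ==
      if v == a then i else if v == b then j else l])
    (\prod_(s | (is_edge s && (s != q)) && (s != q')) g s.1 (edge_val p y s))
    * \prod_(v in (~: [set a; b; d])%SET) pi 0 (y v).
Proof.
move=> Eq Eq' J J'; rewrite /tau_path /tau; apply: eq_big => [//|y _].
congr (_ * _); rewrite pair_big_dep/=; apply: eq_bigl => s.
rewrite !inE -negb_or orbACA /listed_edge.
case Es: (s.2 \in _) => //=.
by rewrite (same_edge Es Eq J) (same_edge Es Eq' J') negb_or.
Qed.

Lemma tau_pairE q q' a b i j : is_edge q -> is_edge q' ->
  joins q a b -> joins q' a b ->
  tau_pair p g a b q.1 q'.1 i j =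
  \sum_(y : {ffun vt -> 'I_m} |
      [forall v in [set a; b]%SET, y v == if v == a then i else j])
    (\prod_(s | (is_edge s && (s != q)) && (s != q')) g s.1 (edge_val p y s))
    * \prod_(v in (~: [set a; b])%SET) pi 0 (y v).
Proof.
move=> Eq Eq' J J'; rewrite /tau_pair /tau; apply: eq_big => [//|y _].
congr (_ * _); rewrite pair_big_dep/=; apply: eq_bigl => s.
rewrite !inE -negb_or orbACA /listed_edge.
case Es: (s.2 \in _) => //=.
by rewrite (same_edge Es Eq J) (same_edge Es Eq' J') negb_or.
Qed.

(** Sorting the box assignments by the blocks of the endpoints of an edge, or of
    a path below, produces the constrained sums that define [tau]. *)
Lemma sum_fix2 (G : {ffun vt -> 'I_m} -> R) (Z : 'I_m -> 'I_m -> R) a b :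
  a != b ->
  \sum_y G y * Z (y a) (y b) = \sum_i \sum_j
    (\sum_(y : {ffun vt -> 'I_m} |
      [forall v in [set a; b]%SET, y v == if v == a then i else j]) G y) * Z i j.
Proof.
move=> ab; rewrite [RHS]pair_bigA/=.
rewrite (partition_big (fun y : {ffun vt -> 'I_m} => (y a, y b)) predT)//=.

apply: eq_bigr => -[i j] _; rewrite big_distrl /=.
apply: eq_big => [y|y /eqP[-> ->]//].
apply/eqP/forall_inP => [[yi yj] v|h].
  rewrite !inE => /orP[] /eqP ->; first by rewrite eqxx yi.
  by rewrite [b == a]eq_sym (negbTE ab) yj.
have := h a; rewrite !inE eqxx => /(_ isT)/eqP ->.
have := h b; rewrite !inE eqxx orbT => /(_ isT)/eqP ->.
by rewrite [b == a]eq_sym (negbTE ab).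
Qed.

Lemma sum_fix3 (G : {ffun vt -> 'I_m} -> R) (Z : 'I_m -> 'I_m -> 'I_m -> R)
    a b d : uniq [:: a; b; d] ->
  \sum_y G y * Z (y a) (y b) (y d) = \sum_i \sum_j \sum_l
    (\sum_(y : {ffun vt -> 'I_m} | [forall v in [set a; b; d]%SET, y v ==
      if v == a then i else if v == b then j else l]) G y) * Z i j l.
Proof.
rewrite /= !inE !negb_or !andbT => /andP[/andP[ab ad] bd].
under [RHS]eq_bigr do rewrite pair_bigA/=.
rewrite pair_bigA/=.
rewrite (partition_big
  (fun y : {ffun vt -> 'I_m} => (y a, (y b, y d))) predT)//=.
apply: eq_bigr => -[i [j l]] _; rewrite big_distrl /=.
apply: eq_big => [y|y /eqP[-> -> ->]//].
apply/eqP/forall_inP => [[yi yj yl] v|h].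
  rewrite !inE -orbA => /or3P[] /eqP ->; first by rewrite eqxx yi.
    by rewrite [b == a]eq_sym (negbTE ab) eqxx yj.
  by rewrite ![d == _]eq_sym (negbTE ad) (negbTE bd) yl.
have := h a; rewrite !inE eqxx => /(_ isT)/eqP ->.
have := h b; rewrite !inE eqxx orbT => /(_ isT)/eqP ->.
have := h d; rewrite !inE eqxx orbT => /(_ isT)/eqP ->.
by rewrite ![d == _]eq_sym [b == _]eq_sym (negbTE ab) (negbTE ad) (negbTE bd).
Qed.

Definition sq_int k i j : R := block_int pi i j (fun x y => zeta k x y * zeta k x y).

Lemma kernel_ok_zeta k : kernel_ok (zeta k).
Proof. by case: zeta_good => mz [M zM]; split => //; exists M => x y; exact: zM. Qed.

Lemma kernel_ok_zetaM k k' : kernel_ok (fun x y => zeta k x y * zeta k' x y).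
Proof. by apply: kernel_okM; exact: kernel_ok_zeta. Qed.

Lemma sq_int_ge0 k i j : 0 <= sq_int k i j.
Proof.
apply: block_int_ge0; first exact: kernel_ok_zetaM.
by move=> s t; rewrite -expr2 sqr_ge0.
Qed.

Lemma weight_enum (y : {ffun vt -> 'I_m}) (l : seq vt) (L : {set vt}) :
  L =i l ->
  \prod_(v <- enum vt | v \notin l) pi 0 (y v) = \prod_(v in ~: L) pi 0 (y v).
Proof.
by move=> Ll; rewrite big_enum_cond/=; apply: eq_bigl => v; rewrite inE Ll.
Qed.

Lemma box_integral_pair (y : {ffun vt -> 'I_m}) q q' a b : a != b ->
  joins q a b -> joins q' a b ->
  box_integral p zeta y q q' = (\prod_(v in (~: [set a; b])%SET) pi 0 (y v))
    * block_int pi (y a) (y b) (fun x y => zeta q.1 x y * zeta q'.1 x y).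
Proof.
move=> ab J J'.
have H := iter_box2 p_ge0 p_sum y (fun=> 0) (enum_uniq vt) ab
  (mem_enum predT a) (mem_enum predT b) (kernel_ok_zetaM q.1 q'.1).
rewrite -(@weight_enum _ [:: a; b]); last by move=> v; rewrite !inE.
rewrite -H /box_integral; apply: (congr1 (fun f => iter_integral _ f _)).
by apply/funext => x; rewrite (on_edgeE _ J) (on_edgeE _ J').
Qed.

Lemma block_int_prod_le k k' i j :
  `|block_int pi i j (fun x y => zeta k x y * zeta k' x y)|
    <= (sq_int k i j + sq_int k' i j) / 2.
Proof.
apply: block_int_le_sum => //; try exact: kernel_ok_zetaM.
move=> s t; rewrite normrM.
have := sqr_ge0 (`|zeta k s t| - `|zeta k' s t|).
rewrite sqrrB !real_normK ?num_real// !expr2; lra.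
Qed.

(** The integral over three blocks that a path of length two leaves once the
    remaining vertices are integrated out. *)
Definition path_int (a b d : vt) k k' i j l : R :=
  iter_integral [:: a; b; d] (fun x =>
    (\prod_(v <- [:: a; b; d]) \1_(block pi
      (if v == a then i else if v == b then j else l)) (x v))
    * (zeta k (x a) (x b) * zeta k' (x b) (x d))) (fun=> 0).

Lemma box_integral_path (y : {ffun vt -> 'I_m}) q q' a b d :
  uniq [:: a; b; d] -> joins q a b -> joins q' b d ->
  box_integral p zeta y q q' = (\prod_(v in (~: [set a; b; d])%SET) pi 0 (y v))
    * path_int a b d q.1 q'.1 (y a) (y b) (y d).
Proof.
move=> u3 J J'.
pose H (x : vt -> R) := zeta q.1 (x a) (x b) * zeta q'.1 (x b) (x d).
have nH : nice H by apply: niceM; apply: nice_kernel.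
have Hl : depends_on [:: a; b; d] H.
  by move=> x z xz; rewrite /H !xz// !inE eqxx ?orbT.
have sub : {subset [:: a; b; d] <= enum vt} by move=> v _; exact: mem_enum.
have := iter_box p_ge0 p_sum y (fun=> 0) (enum_uniq vt) u3 sub nH Hl.
rewrite (@weight_enum _ [:: a; b; d] [set a; b; d]%SET); last first.
  by move=> v; rewrite !inE orbA.
have -> : (fun x : vt -> R =>
    (\prod_(v <- [:: a; b; d]) \1_(block pi (y v)) (x v)) * H x) =
  (fun x => (\prod_(v <- [:: a; b; d]) \1_(block pi
     (if v == a then y a else if v == b then y b else y d)) (x v)) * H x).
  apply/funext => x; congr (_ * _); apply: eq_big_seq => v.
  rewrite !inE; case: eqP => [->//|_]; case: eqP => [->//|_] /= /eqP ->//.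
rewrite /path_int => <-; rewrite /box_integral.
apply: (congr1 (fun f => iter_integral _ f _)).
by apply/funext => x; rewrite (on_edgeE _ J) (on_edgeE _ J').
Qed.

Lemma sq_int_sym k i j : sq_int k i j = sq_int k j i.
Proof.
pose z2 x y := zeta k x y * zeta k x y.
pose f i j (x : bool -> R) (a b : bool) :=
  \1_(block pi i) (x a) * \1_(block pi j) (x b) * z2 (x a) (x b).
have E : iter_integral [:: true; false] (fun x => f i j x true false) (fun=> 0)
    = block_int pi i j z2 by exact: iter_block2.
have E' : iter_integral [:: false; true] (fun x => f j i x false true) (fun=> 0)
    = block_int pi j i z2 by exact: iter_block2.
have nf : nice (fun x => f i j x true false).
  by apply: nice_block2; exact: kernel_ok_zetaM.
have pm : perm_eq [:: true; false] [:: false; true] by [].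
have us : uniq [:: true; false] by [].
have P := iter_integral_perm (fun=> 0) nf us pm.
have ff : (fun x => f i j x true false) = (fun x => f j i x false true).
  by apply/funext => x; rewrite /f /z2 [zeta k (x false) _]zeta_sym; ring.
rewrite ff in P; rewrite /sq_int -/z2 -E -E' -P ff.
exact: erefl.
Qed.

(** The arithmetic-geometric mean inequality with weights [u / w] and [w / u],
    where [u] and [w] are the square roots of the lengths of the end blocks:
    integrating out the free end of each square gives the factors [w * w] and
    [u * u], and these weights turn both into [u * w]. *)
Lemma path_int_le a b d k k' i j l : uniq [:: a; b; d] ->
  `|path_int a b d k k' i j l| <=
    Num.sqrt (pi 0 i * pi 0 l) * ((sq_int k i j + sq_int k' l j) / 2).
Proof.
move=> u3; have := u3; rewrite /= !inE !negb_or !andbT => /andP[/andP[ab ad] bd].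
pose y (v : vt) := if v == a then i else if v == b then j else l.
have ya : y a = i by rewrite /y eqxx.
have yb : y b = j by rewrite /y eq_sym (negbTE ab) eqxx.
have yd : y d = l by rewrite /y ![d == _]eq_sym (negbTE ad) (negbTE bd).
pose P (x : vt -> R) : R := \prod_(v <- [:: a; b; d]) \1_(block pi (y v)) (x v).
have nP : nice P.
  by apply: nice_prod => v _; exact: nice_indic_block.
have P0 x : 0 <= P x.
  by apply: prodr_ge0 => v _; case/andP: (indic01 R (block pi (y v)) (x v)).
pose u := Num.sqrt (pi 0 i); pose w := Num.sqrt (pi 0 l).
have u0 : 0 < u by rewrite sqrtr_gt0.
have w0 : 0 < w by rewrite sqrtr_gt0.
have u2 : pi 0 i = u * u by rewrite -expr2 sqr_sqrtr.
have w2 : pi 0 l = w * w by rewrite -expr2 sqr_sqrtr.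
have uwE : Num.sqrt (pi 0 i * pi 0 l) = u * w by rewrite sqrtrM.
clearbody u w.
have nsq (c e : vt) h :
    nice (fun x : vt -> R => zeta h (x c) (x e) * zeta h (x c) (x e)).
  by apply: niceM; apply: nice_kernel.
pose f1 (x : vt -> R) := P x * (zeta k (x a) (x b) * zeta k (x a) (x b)).
pose f2 (x : vt -> R) := P x * (zeta k' (x b) (x d) * zeta k' (x b) (x d)).
have n1 : nice f1 by apply: niceM.
have n2 : nice f2 by apply: niceM.
have in3 : [/\ a \in [:: a; b; d], b \in [:: a; b; d] & d \in [:: a; b; d]].
  by rewrite !inE !eqxx !orbT.
case: in3 => ina inb ind.
have I1E : iter_integral [:: a; b; d] f1 (fun=> 0) = pi 0 l * sq_int k i j.
  have := iter_box2 p_ge0 p_sum y (fun=> 0) u3 ab ina inb (kernel_ok_zetaM k k).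
  rewrite ya yb => ->; congr (_ * _).
  rewrite -big_filter /= !inE !eqxx /= orbT /= ![d == _]eq_sym.
  by rewrite (negbTE ad) (negbTE bd) /= big_seq1 yd.
have I2E : iter_integral [:: a; b; d] f2 (fun=> 0) = pi 0 i * sq_int k' l j.
  have := iter_box2 p_ge0 p_sum y (fun=> 0) u3 bd inb ind (kernel_ok_zetaM k' k').
  rewrite yb yd sq_int_sym => ->; congr (_ * _).
  rewrite -big_filter /= !inE !eqxx /= orbT /=.
  by rewrite (negbTE ab) (negbTE ad) /= big_seq1 ya.
have -> : Num.sqrt (pi 0 i * pi 0 l) * ((sq_int k i j + sq_int k' l j) / 2) =
    iter_integral [:: a; b; d]
      (fun x => (u / w / 2) * f1 x + (w / u / 2) * f2 x) (fun=> 0).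
  rewrite iter_integralD; [|exact: niceZ|exact: niceZ].
  rewrite iter_integralZ; last exact: n1.
  rewrite iter_integralZ; last exact: n2.
  rewrite I1E I2E uwE u2 w2.
  move: (sq_int k i j) (sq_int k' l j) => S1 S2.
  by field; rewrite !gt_eqF.
apply: ler_norm_iter_integral.
- by apply: niceM => //; apply: niceM; apply: nice_kernel.
- by apply: niceD; exact: niceZ.
- exact: in_cube0.
move=> x _; rewrite -/(P x) normrM (ger0_norm (P0 x)) normrM /f1 /f2.
set X := zeta k _ _; set Y := zeta k' _ _.
have -> : u / w / 2 * (P x * (X * X)) + w / u / 2 * (P x * (Y * Y)) =
   P x * (u / w / 2 * (X * X) + w / u / 2 * (Y * Y)) by ring.
apply: ler_wpM2l; first exact: P0.
have -> : u / w / 2 * (X * X) + w / u / 2 * (Y * Y) =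
    (u * `|X| - w * `|Y|) ^+ 2 / (u * w) / 2 + `|X| * `|Y|.
  have -> : X * X = `|X| * `|X| by rewrite -!expr2 real_normK ?num_real.
  have -> : Y * Y = `|Y| * `|Y| by rewrite -!expr2 real_normK ?num_real.
  by field; rewrite !gt_eqF.
by rewrite lerDr !divr_ge0// ?sqr_ge0// mulr_ge0// ltW.
Qed.

(** The integral factors into two block integrals; these vanish for an off-step
    kernel, so the bound is quadratic in the distance to such kernels. *)
Lemma box_integral_disjoint (y : {ffun vt -> 'I_m}) q q' a b c d :
  uniq [:: a; b; c; d] -> joins q a b -> joins q' c d ->
  `|box_integral p zeta y q q'| <=
    `|block_int pi (y a) (y b) (zeta q.1)| * `|block_int pi (y c) (y d) (zeta q'.1)|.
Proof.
move=> u4 J J'.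
pose H (x : vt -> R) := zeta q.1 (x a) (x b) * zeta q'.1 (x c) (x d).
have nH : nice H by apply: niceM; apply: nice_kernel.
have Hl : depends_on [:: a; b; c; d] H.
  by move=> x z xz; rewrite /H !xz// !inE eqxx ?orbT.
have sub : {subset [:: a; b; c; d] <= enum vt} by move=> v _; exact: mem_enum.
have E := iter_box p_ge0 p_sum y (fun=> 0) (enum_uniq vt) u4 sub nH Hl.
have E4 := iter_box4 pi y (fun=> 0) u4 (kernel_ok_zeta q.1) (kernel_ok_zeta q'.1).
have -> : box_integral p zeta y q q' = (\prod_(v <- enum vt | v \notin [:: a; b; c; d])
    pi 0 (y v)) * (block_int pi (y a) (y b) (zeta q.1)
      * block_int pi (y c) (y d) (zeta q'.1)).
  rewrite -E4 -/(H _) -E /box_integral; apply: (congr1 (fun f => iter_integral _ f _)).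
  by apply/funext => x; rewrite (on_edgeE _ J) (on_edgeE _ J').
rewrite normrM [X in _ * X]normrM; apply: ler_piMl; first exact: mulr_ge0.
have p1 i : pi 0 i <= 1.
  by rewrite -p_sum (bigD1 i)//= lerDl sumr_ge0.
rewrite ger0_norm; last by apply: prodr_ge0 => v _; exact: p_ge0.
by apply: prodr_ile1 => v _; rewrite p_ge0 p1.
Qed.

End edge_pairs.

(** * Summation over pairs of edges *)

Section graph_bound.
Variables (R : realType) (r m : nat) (p : step_param R r m).
Hypothesis p_pos : forall i, 0 < p.2 0 i.
Hypothesis p_sum : \sum_i p.2 0 i = 1.
Hypothesis p_sym : forall k i j, p.1 k i j = p.1 k j i.
Variables (F : mgraph r) (g : 'I_r -> R -> R).
Variable zeta : kernels R r.
Hypothesis zeta_good : good_kernels zeta.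
Hypothesis zeta_sym : forall k x y, zeta k x y = zeta k y x.

Local Notation vt := (vtx F).
Local Notation edge := ('I_r * (vt * vt))%type.
Local Notation is_edge := (@listed_edge r F).
Local Notation pi := p.2.
Local Notation sq_int := (sq_int p zeta).

Definition pair_variation (q q' : edge) : R :=
  \sum_y edge_hess p g y q q' * box_integral p zeta y q q'.

Definition hess_mass (q q' : edge) : R := \sum_y `|edge_hess p g y q q'|.

Definition col_mass (k : 'I_r) (j : 'I_m) : R := \sum_i sq_int k i j.

Definition path_coef (a b d : vt) (k k' : 'I_r) (i j l : 'I_m) : R :=
  `| derive1 (g k) (p.1 k i j) * derive1 (g k') (p.1 k' l j)
     * tau_path p g a b d k k' i j l |.

Definition path_mass (j : 'I_m) (k k' : 'I_r) : R :=
  \sum_(a : vt) \sum_(b : vt)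
    \sum_(d : vt | [&& a != b, b != d, a != d, adj k a b & adj k' b d])
      \sum_(i < m) \sum_(l < m)
        path_coef a b d k k' i j l * Num.sqrt (pi 0 i * pi 0 l).

Definition pair_coef (a b : vt) (k k' : 'I_r) : R :=
  \sum_(i < m) \sum_(j < m)
    `| derive1 (g k) (p.1 k i j) * derive1 (g k') (p.1 k' i j)
       * tau_pair p g a b k k' i j |.

Definition tot_mass (k : 'I_r) : R := \sum_(j < m) col_mass k j.

Let sq0 k i j : 0 <= sq_int k i j. Proof. exact: sq_int_ge0. Qed.

Lemma col_mass_ge0 k j : 0 <= col_mass k j.
Proof. exact: sumr_ge0. Qed.

Lemma sq_int_le_col k i j : sq_int k i j <= col_mass k j.
Proof. by rewrite /col_mass (bigD1 i)//= lerDl sumr_ge0. Qed.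

Lemma sq_int_le_tot k i j : sq_int k i j <= tot_mass k.
Proof.
rewrite (le_trans (sq_int_le_col k i j))// /tot_mass (bigD1 j)//= lerDl.
by apply: sumr_ge0 => j' _; exact: col_mass_ge0.
Qed.

Lemma tot_mass_ge0 k : 0 <= tot_mass k.
Proof. by apply: sumr_ge0 => j _; exact: col_mass_ge0. Qed.

Lemma pair_variationC q q' : pair_variation q q' = pair_variation q' q.
Proof.
case: (eqVneq q q') => [->//|qq']; apply: eq_bigr => y _; congr (_ * _).
  rewrite /edge_hess [q' == q]eq_sym (negbTE qq'); congr (_ * _); first exact: mulrC.
  by apply: eq_bigl => s; rewrite andbAC.
rewrite /box_integral; apply: (congr1 (fun f => iter_integral _ f _)).
by apply/funext => x; rewrite [X in _ * X]mulrC.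
Qed.

Lemma diag_variation (k : 'I_r) (e : vt * vt) : e \in edges F k ->
  pair_variation (k, e) (k, e) =
  \sum_i \sum_j derive1n 2 (g k) (p.1 k i j) * tau_edge p g e.1 e.2 k i j
    * sq_int k i j.
Proof.
move=> Ee; have Eq : is_edge (k, e) by [].
have ab := edge_neq Eq.
have J : joins (k, e) e.1 e.2 by rewrite /joins /=; case: (e) => ? ?; rewrite eqxx.
transitivity (\sum_(y : {ffun vt -> 'I_m})
   ((\prod_(s | is_edge s && (s != (k, e))) g s.1 (edge_val p y s))
    * \prod_(v in (~: [set e.1; e.2])%SET) pi 0 (y v))
   * (derive1n 2 (g k) (p.1 k (y e.1) (y e.2)) * sq_int k (y e.1) (y e.2))).
  apply: eq_bigr => y _; rewrite /edge_hess eqxx.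
  rewrite (box_integral_pair _ p_sum _ _ _ ab J J)//.
  by rewrite (edge_valE p_sym _ J) /sq_int /=; ring.
rewrite (sum_fix2 _ (fun i j => derive1n 2 (g k) (p.1 k i j) * sq_int k i j) ab).
apply: eq_bigr => i _; apply: eq_bigr => j _.
by rewrite -(tau_edgeE p g i j Eq J) /=; ring.
Qed.

Lemma pair_variation_le q q' a b : is_edge q -> is_edge q' -> q != q' ->
  joins q a b -> joins q' a b -> a != b ->
  `|pair_variation q q'|
    <= pair_coef a b q.1 q'.1 * ((tot_mass q.1 + tot_mass q'.1) / 2).
Proof.
move=> Eq Eq' qq' J J' ab.
pose B i j := block_int pi i j (fun x y => zeta q.1 x y * zeta q'.1 x y).
pose D i j := derive1 (g q.1) (p.1 q.1 i j) * derive1 (g q'.1) (p.1 q'.1 i j).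
have -> : pair_variation q q' =
    \sum_i \sum_j D i j * tau_pair p g a b q.1 q'.1 i j * B i j.
  transitivity (\sum_(y : {ffun vt -> 'I_m})
     ((\prod_(s | (is_edge s && (s != q)) && (s != q')) g s.1 (edge_val p y s))
      * \prod_(v in (~: [set a; b])%SET) pi 0 (y v))
     * (D (y a) (y b) * B (y a) (y b))).
    apply: eq_bigr => y _; rewrite /edge_hess (negbTE qq').
    rewrite (box_integral_pair _ p_sum _ _ _ ab J J')//.
    by rewrite (edge_valE p_sym _ J) (edge_valE p_sym _ J') /D /B; ring.
  rewrite (sum_fix2 _ (fun i j => D i j * B i j) ab).
  apply: eq_bigr => i _; apply: eq_bigr => j _.
  by rewrite -(tau_pairE p g i j Eq Eq' J J') /=; ring.
rewrite /pair_coef big_distrl (le_trans (ler_norm_sum _ _ _))//.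
apply: ler_sum => i _; rewrite big_distrl (le_trans (ler_norm_sum _ _ _))//.
apply: ler_sum => j _; rewrite normrM; apply: ler_wpM2l => //.
rewrite (le_trans (block_int_prod_le _ _ _ _ _ _))//.
rewrite ler_wpM2r ?invr_ge0//.
by apply: lerD; exact: sq_int_le_tot.
Qed.

(** The kernels enter this majorant through the masses of a single column of
    blocks, which is what lets a Schur test apply. *)
Definition path_bound (a b d : vt) (k k' : 'I_r) : R :=
  \sum_j \sum_i \sum_l path_coef a b d k k' i j l
    * Num.sqrt (pi 0 i * pi 0 l) * ((col_mass k j + col_mass k' j) / 2).

Lemma path_bound_ge0 a b d k k' : 0 <= path_bound a b d k k'.
Proof.
apply: sumr_ge0 => j _; apply: sumr_ge0 => i _; apply: sumr_ge0 => l _.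
apply: mulr_ge0; first by rewrite mulr_ge0 ?normr_ge0 ?sqrtr_ge0.
by rewrite divr_ge0// addr_ge0// col_mass_ge0.
Qed.

Lemma path_variation_le q q' a b d : is_edge q -> is_edge q' -> q != q' ->
  uniq [:: a; b; d] -> joins q a b -> joins q' b d ->
  `|pair_variation q q'| <= path_bound a b d q.1 q'.1.
Proof.
move=> Eq Eq' qq' u3 J J'.
pose T i j l := path_int p zeta a b d q.1 q'.1 i j l.
pose D i j l := derive1 (g q.1) (p.1 q.1 i j) * derive1 (g q'.1) (p.1 q'.1 l j).
have -> : pair_variation q q' = \sum_i \sum_j \sum_l
    D i j l * tau_path p g a b d q.1 q'.1 i j l * T i j l.
  transitivity (\sum_(y : {ffun vt -> 'I_m})
     ((\prod_(s | (is_edge s && (s != q)) && (s != q')) g s.1 (edge_val p y s))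
      * \prod_(v in (~: [set a; b; d])%SET) pi 0 (y v))
     * (D (y a) (y b) (y d) * T (y a) (y b) (y d))).
    apply: eq_bigr => y _; rewrite /edge_hess (negbTE qq').
    rewrite (box_integral_path _ p_sum _ _ _ u3 J J')//.
    rewrite (edge_valE p_sym _ J) (edge_valE p_sym _ J').
    by rewrite [p.1 q'.1 (y b) (y d)]p_sym /D /T; ring.
  rewrite (sum_fix3 _ (fun i j l => D i j l * T i j l) u3).
  apply: eq_bigr => i _; apply: eq_bigr => j _; apply: eq_bigr => l _.
  by rewrite -(tau_pathE p g i j l Eq Eq' J J') /=; ring.
rewrite exchange_big /=.
rewrite (le_trans (ler_norm_sum _ _ _))//; apply: ler_sum => j _.
rewrite (le_trans (ler_norm_sum _ _ _))//; apply: ler_sum => i _.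
rewrite (le_trans (ler_norm_sum _ _ _))//; apply: ler_sum => l _.
rewrite normrM -[in leRHS]mulrA; apply: ler_wpM2l => //.
apply: (le_trans (path_int_le p_pos p_sum zeta_good zeta_sym _ _ _ _ _ u3)).
apply: ler_wpM2l; first exact: sqrtr_ge0.
rewrite ler_wpM2r ?invr_ge0//.
by apply: lerD; exact: sq_int_le_col.
Qed.

Lemma disjoint_variation_le q q' a b c d (delta : R) :
  (forall k i j, `|block_int pi i j (zeta k)| <= delta) ->
  uniq [:: a; b; c; d] -> joins q a b -> joins q' c d ->
  `|pair_variation q q'| <= hess_mass q q' * delta ^+ 2.
Proof.
move=> hd u4 J J'; rewrite /hess_mass big_distrl.
rewrite (le_trans (ler_norm_sum _ _ _))//; apply: ler_sum => y _.
rewrite normrM; apply: ler_wpM2l => //.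
apply: (le_trans (box_integral_disjoint p_pos p_sum zeta_good zeta_sym y u4 J J')).
by rewrite expr2 ler_pM.
Qed.

Lemma sum_adj (k : 'I_r) (phi : vt -> vt -> R) :
  \sum_a \sum_b (adj k a b)%:R * phi a b
  = \sum_(e in edges F k) (phi e.1 e.2 + phi e.2 e.1).
Proof.
have adjE a b : (adj k a b)%:R =
    ((a, b) \in edges F k)%:R + ((b, a) \in edges F k)%:R :> R.
  rewrite /adj; case: (boolP ((a, b) \in _)) => [/edges_once/negbTE ->|_].
    by rewrite addr0.
  by rewrite add0r.
have S (psi : vt -> vt -> R) : \sum_a \sum_b ((a, b) \in edges F k)%:R * psi a b
    = \sum_(e in edges F k) psi e.1 e.2.
  rewrite pair_bigA [RHS]big_mkcond /=; apply: eq_bigr => -[a b] _ /=.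
  by case: ifP => _; rewrite ?mul1r ?mul0r.
rewrite big_split -S -(S (fun a b => phi b a)) /= [X in _ = _ + X]exchange_big.
rewrite -big_split; apply: eq_bigr => a _ /=; rewrite -big_split.
by apply: eq_bigr => b _ /=; rewrite adjE mulrDl.
Qed.

Definition path_term (k k' : 'I_r) (a b d : vt) : R :=
  if [&& a != b, b != d & a != d] then path_bound a b d k k' else 0.

Lemma path_term_ge0 k k' a b d : 0 <= path_term k k' a b d.
Proof. by rewrite /path_term; case: ifP => // _; exact: path_bound_ge0. Qed.

Definition path_terms (q q' : edge) : R :=
  ((q'.2.1 == q.2.2)%:R * path_term q.1 q'.1 q.2.1 q.2.2 q'.2.2
   + (q'.2.2 == q.2.2)%:R * path_term q.1 q'.1 q.2.1 q.2.2 q'.2.1)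
  + ((q'.2.1 == q.2.1)%:R * path_term q.1 q'.1 q.2.2 q.2.1 q'.2.2
   + (q'.2.2 == q.2.1)%:R * path_term q.1 q'.1 q.2.2 q.2.1 q'.2.1).

Lemma path_terms_ge0 q q' : 0 <= path_terms q q'.
Proof. by rewrite !addr_ge0// mulr_ge0// path_term_ge0. Qed.

(** The four ways in which two listed edges share an endpoint exhaust the
    oriented paths of length two. *)
Lemma sum_path_terms :
  \sum_(q | is_edge q) \sum_(q' | is_edge q') path_terms q q'
  = \sum_k \sum_k' \sum_(a : vt) \sum_(b : vt)
     \sum_(d : vt | [&& a != b, b != d, a != d, adj k a b & adj k' b d])
        path_bound a b d k k'.
Proof.
rewrite -(pair_big_dep predT (fun k e => e \in edges F k)
  (fun k e => \sum_(q' | is_edge q') path_terms (k, e) q')) /=.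
apply: eq_bigr => k _.
transitivity (\sum_(e in edges F k) \sum_k' \sum_(f in edges F k')
    path_terms (k, e) (k', f)).
  apply: eq_bigr => e _; rewrite -(pair_big_dep predT
    (fun k e => e \in edges F k) (fun k' f => path_terms (k, e) (k', f))) //.
rewrite exchange_big /=; apply: eq_bigr => k' _.
pose S a b := \sum_d (adj k' b d)%:R * path_term k k' a b d.
have SE a b : S a b = \sum_(f in edges F k')
    ((f.1 == b)%:R * path_term k k' a b f.2
     + (f.2 == b)%:R * path_term k k' a b f.1).
  rewrite -(sum_adj k' (fun c d => (c == b)%:R * path_term k k' a b d)).
  rewrite (bigD1 b)//= [X in _ = _ + X]big1 ?addr0.
    by apply: eq_bigr => d _; rewrite eqxx mul1r.
  by move=> c cb; apply: big1 => d _; rewrite (negbTE cb) mul0r mulr0.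
transitivity (\sum_(e in edges F k) (S e.1 e.2 + S e.2 e.1)).
  by apply: eq_bigr => e _; rewrite !SE -big_split.
rewrite -sum_adj; apply: eq_bigr => a _; apply: eq_bigr => b _.
rewrite [RHS]big_mkcond /S big_distrr; apply: eq_bigr => d _ /=.
rewrite /path_term; case: (a != b) => /=; last by rewrite !mulr0.
case: (b != d) => /=; last by rewrite !mulr0.
case: (a != d) => /=; last by rewrite !mulr0.
by case: (adj k a b); case: (adj k' b d); rewrite ?mul0r ?mulr0 ?mul1r.
Qed.

Lemma sum_path_bound :
  \sum_k \sum_k' \sum_(a : vt) \sum_(b : vt)
     \sum_(d : vt | [&& a != b, b != d, a != d, adj k a b & adj k' b d])
        path_bound a b d k k'
  = \sum_j \sum_k \sum_k' path_mass j k k' * ((col_mass k j + col_mass k' j) / 2).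
Proof.
rewrite [RHS]exchange_big; apply: eq_bigr => k _ /=.
rewrite [RHS]exchange_big; apply: eq_bigr => k' _ /=.
under [RHS]eq_bigr do rewrite /path_mass big_distrl /=.
rewrite [RHS]exchange_big; apply: eq_bigr => a _ /=.
under [RHS]eq_bigr do rewrite big_distrl /=.
rewrite [RHS]exchange_big; apply: eq_bigr => b _ /=.
under [RHS]eq_bigr do rewrite big_distrl /=.
rewrite [RHS]exchange_big; apply: eq_bigr => d _ /=.
apply: eq_bigr => j _; rewrite big_distrl; apply: eq_bigr => i _ /=.
by rewrite big_distrl.
Qed.

End graph_bound.

Lemma adjC (r : nat) (F : mgraph r) k (a b : vtx F) : adj k a b = adj k b a.
Proof. by rewrite /adj orbC. Qed.

Section graph_total.
Variables (R : realType) (r m : nat) (p : step_param R r m).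
Hypothesis p_pos : forall i, 0 < p.2 0 i.
Hypothesis p_sum : \sum_i p.2 0 i = 1.
Hypothesis p_sym : forall k i j, p.1 k i j = p.1 k j i.
Variables (F : mgraph r) (g : 'I_r -> R -> R).

Local Notation vt := (vtx F).
Local Notation edge := ('I_r * (vt * vt))%type.
Local Notation is_edge := (@listed_edge r F).
Local Notation pi := p.2.

(** Reversing a path exchanges its ends, and with them the relations and the end
    blocks. *)
Lemma tau_path_sym (a b d : vt) k k' i j l : a != b -> b != d -> a != d ->
  tau_path p g a b d k k' i j l = tau_path p g d b a k' k l j i.
Proof.
move=> ab bd ad; rewrite /tau_path /tau.
have LE : [set a; b; d]%SET = [set d; b; a]%SET :> {set vt}.
  by apply/setP => v; rewrite !inE; case: (v == a); case: (v == b);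
    case: (v == d).
rewrite LE; apply: eq_big => [y|y _].
  apply: eq_forallb => v; case: (boolP (v \in _)) => //=; rewrite !inE -orbA => /or3P[] /eqP -> /=.
  - by rewrite eqxx ![d == _]eq_sym (negbTE ad) (negbTE bd).
  - by rewrite eqxx [b == a]eq_sym (negbTE ab) (negbTE bd).
  - by rewrite eqxx (negbTE ad) (negbTE ab).
congr (_ * _); apply: eq_bigr => w _; apply: eq_bigl => -[e1 e2] /=.
case: (_ \in _) => //=; rewrite !inE !xpair_eqE !negb_or /=.
case: (e1 == a); case: (e1 == b); case: (e1 == d); case: (e2 == a);
  case: (e2 == b); case: (e2 == d); case: (w == k); by case: (w == k').
Qed.

Lemma path_massC j k k' : path_mass p F g j k k' = path_mass p F g j k' k.
Proof.
rewrite /path_mass exchange_big [RHS]exchange_big /=; apply: eq_bigr => b _.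
under eq_bigr do rewrite big_mkcond /=.
under [RHS]eq_bigr do rewrite big_mkcond /=.
rewrite [RHS]exchange_big; apply: eq_bigr => a _; apply: eq_bigr => d _ /=.
have -> : [&& d != b, b != a, d != a, adj k' d b & adj k b a] =
    [&& a != b, b != d, a != d, adj k a b & adj k' b d].
  rewrite ![d == _]eq_sym [b == a]eq_sym [adj k' d b]adjC [adj k b a]adjC.
  by case: (a != b); case: (b != d); case: (a != d); case: (adj k a b);
    case: (adj k' b d).
case: ifP => // /and5P[ab bd ad _ _].
rewrite exchange_big; apply: eq_bigr => l _; apply: eq_bigr => i _ /=.
rewrite /path_coef (tau_path_sym k k' _ _ _ ab bd ad) [pi 0 _ * pi 0 _]mulrC.
by rewrite [X in `|X * _|]mulrC.
Qed.

Variable zeta : kernels R r.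
Hypothesis zeta_good : good_kernels zeta.
Hypothesis zeta_sym : forall k x y, zeta k x y = zeta k y x.

Local Notation X := (pair_variation p g zeta).
Local Notation cm := (col_mass p zeta).
Local Notation tm := (tot_mass p zeta).

(** The Schur test: by symmetry in the two relations, both halves of the
    arithmetic mean can be charged to the same column mass. *)
Lemma sum_path_mass_sym :
  \sum_j \sum_k \sum_k' path_mass p F g j k k' * ((cm k j + cm k' j) / 2)
  = \sum_j \sum_k cm k j * \sum_k' path_mass p F g j k k'.
Proof.
apply: eq_bigr => j _.
pose S1 := \sum_k \sum_k' path_mass p F g j k k' * cm k j.
pose S2 := \sum_k \sum_k' path_mass p F g j k k' * cm k' j.
have E21 : S2 = S1.
  rewrite /S2 exchange_big; apply: eq_bigr => k _; apply: eq_bigr => k' _ /=.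
  by rewrite (path_massC j k' k).
transitivity ((S1 + S2) / 2).
  rewrite /S1 /S2 -big_split big_distrl; apply: eq_bigr => k _ /=.
  rewrite -big_split big_distrl; apply: eq_bigr => k' _ /=.
  by rewrite -mulrDr mulrA.
transitivity S1; first by rewrite E21; clearbody S1; field.
apply: eq_bigr => k _; rewrite big_distrr; apply: eq_bigr => k' _ /=.
exact: mulrC.
Qed.

(** A vertex pair carries at most one listed edge of each relation. *)
Lemma sum_joins_le (k' : 'I_r) (a b : vt) (f : vt * vt -> R) (B : R) :
  0 <= B -> a != b ->
  (forall e, e \in edges F k' -> joins (k', e) a b -> f e <= B) ->
  \sum_(e in edges F k' | joins (k', e) a b) f e <= (adj k' a b)%:R * B.
Proof.
move=> B0 ab fB.
have one (c d : vt) : (c, d) \in edges F k' ->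
    (forall e, joins (k', e) a b = (e == (c, d)) || (e == (d, c))) ->
    \sum_(e in edges F k' | joins (k', e) a b) f e <= B.
  move=> cdE J; rewrite (big_pred1 (c, d)).
    by apply: fB => //; rewrite J eqxx.
  move=> e; rewrite J; apply/andP/eqP => [[eE /orP[/eqP //|/eqP edc]]|->].
    by move: eE; rewrite edc (negbTE (edges_once cdE)).
  by rewrite eqxx.
rewrite /adj; case: (boolP ((a, b) \in _)) => [abE|abE].
  by rewrite mul1r; exact: (one a b).
case: (boolP ((b, a) \in _)) => [baE|baE].
  by rewrite mul1r; apply: (one b a) => // e; rewrite /joins orbC.
rewrite big_pred0 ?mul0r// => e; apply/negP => /andP[eE /orP[] /= /eqP ee].
  by move: abE; rewrite -ee eE.
by move: baE; rewrite -ee eE.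
Qed.

Definition pair_term (q q' : edge) : R :=
  (joins q' q.2.1 q.2.2)%:R * `|X q q'|.

(** Every unordered pair of parallel edges is counted twice, which cancels the
    factor 1/2 of the arithmetic mean. *)
Lemma sum_pair_term :
  \sum_(q | is_edge q) \sum_(q' | is_edge q' && (q' != q)) pair_term q q'
  <= \sum_(k < r) \sum_(k' < r | (k < k')%N)
      \sum_(e in edges F k | adj k' e.1 e.2)
        pair_coef p g e.1 e.2 k k' * (tm k + tm k').
Proof.
pose U (q q' : edge) := (q.1 < q'.1)%N%:R * pair_term q q'.
have joinsE (q q' : edge) : joins q' q.2.1 q.2.2 = (q'.2 == q.2) || (q'.2 == (q.2.2, q.2.1)).
  by rewrite /joins; case: (q.2).
have ptC q q' : pair_term q q' = pair_term q' q.
  rewrite /pair_term [X q q']pair_variationC; congr (_%:R * _).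
  congr nat_of_bool; rewrite !joinsE.
  case: (q) => k [a b]; case: (q') => k' [c d]; rewrite !xpair_eqE /=.
  by rewrite ![c == _]eq_sym ![d == _]eq_sym; case: (a == c); case: (b == d);
    case: (b == c); case: (a == d).
have split_lt q q' : is_edge q -> is_edge q' && (q' != q) ->
    pair_term q q' = U q q' + U q' q.
  move=> Eq /andP[Eq' qq']; rewrite /U [pair_term q' q]ptC -mulrDl.
  case: (ltngtP q.1 q'.1) => [_|_|/val_inj kk]; rewrite ?addr0 ?add0r ?mul1r//.
  rewrite mul0r /pair_term; case: (boolP (joins _ _ _)); last by rewrite mul0r.
  move: Eq Eq' qq' kk; rewrite joinsE; case: (q) => k [a b]; case: (q') => k' [c d] /=.
  rewrite /listed_edge /= => Eq Eq' qq' kk; subst k'.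
  move=> /orP[] /eqP[h1 h2]; subst; first by rewrite eqxx in qq'.
  by move: Eq'; rewrite (negbTE (edges_once Eq)).
have U0 q q' : 0 <= U q q' by rewrite !mulr_ge0.
have -> : \sum_(q | is_edge q) \sum_(q' | is_edge q' && (q' != q)) pair_term q q'
    = \sum_(q | is_edge q) \sum_(q' | is_edge q' && (q' != q)) (U q q' + U q' q).
  by apply: eq_bigr => q Eq; apply: eq_bigr => q' Eq'; exact: split_lt.
have le1 : \sum_(q | is_edge q) \sum_(q' | is_edge q' && (q' != q))
    (U q q' + U q' q) <= \sum_(q | is_edge q) \sum_(q' | is_edge q') (U q q' + U q' q).
  apply: ler_sum => q Eq; rewrite [leRHS](bigID (fun q' => q' != q))/= lerDl.
  by apply: sumr_ge0 => q' _; rewrite addr_ge0.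
apply: (le_trans le1).
have -> : \sum_(q | is_edge q) \sum_(q' | is_edge q') (U q q' + U q' q) =
    \sum_(q | is_edge q) \sum_(q' | is_edge q') 2 * U q q'.
  under eq_bigr do rewrite big_split /=.
  rewrite big_split /= [X in _ + X]exchange_big -big_split /=.
  apply: eq_bigr => q _; rewrite -big_split; apply: eq_bigr => q' _ /=.
  by ring.
rewrite -(pair_big_dep predT (fun k e => e \in edges F k)
  (fun k e => \sum_(q' | is_edge q') 2 * U (k, e) q')) /=.
apply: ler_sum => k _.
have -> : \sum_(k' < r | (k < k')%N) \sum_(e in edges F k | adj k' e.1 e.2)
        pair_coef p g e.1 e.2 k k' * (tm k + tm k') =
  \sum_(e in edges F k) \sum_(k' < r | (k < k')%N) (adj k' e.1 e.2)%:R *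
        (pair_coef p g e.1 e.2 k k' * (tm k + tm k')).
  rewrite [RHS]exchange_big; apply: eq_bigr => k' _ /=.
  rewrite big_mkcondr; apply: eq_bigr => e _.
  by case: ifP => _; rewrite ?mul1r ?mul0r.
apply: ler_sum => e Ee.
rewrite -(pair_big_dep predT (fun k e => e \in edges F k)
  (fun k' f => 2 * U (k, e) (k', f))) /=.
rewrite [leRHS]big_mkcond; apply: ler_sum => k' _.
rewrite /U /=; case: ifP => kk'; last first.
  by rewrite big1// => f _; rewrite mul0r mulr0.
have ab : e.1 != e.2 by exact: (@edge_neq _ F (k, e)).
have J : joins (k, e) e.1 e.2 by rewrite /joins /=; case: (e) => ? ?; rewrite eqxx.
have -> : \sum_(f in edges F k') 2 * (true%:R * pair_term (k, e) (k', f)) =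
   \sum_(f in edges F k' | joins (k', f) e.1 e.2) 2 * `|X (k, e) (k', f)|.
  rewrite [RHS]big_mkcondr; apply: eq_bigr => f _; rewrite /pair_term /= mul1r.
  by case: ifP => _; rewrite ?mul1r ?mul0r ?mulr0.
apply: sum_joins_le => //.
  apply: mulr_ge0; last by rewrite addr_ge0// tot_mass_ge0.
  by apply: sumr_ge0 => i _; apply: sumr_ge0 => j _; exact: normr_ge0.
move=> f Ef J'; have ne : (k, e) != (k', f).
  by apply/eqP => -[kE _]; move: kk'; rewrite kE ltnn.
have := pair_variation_le p_pos p_sum p_sym g zeta_good zeta_sym
  (Ee : is_edge (k, e)) (Ef : is_edge (k', f)) ne J J' ab.
move=> /(ler_wpM2l (ler0n R 2))/le_trans; apply; rewrite /= mulrCA.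
by rewrite [_ / 2]mulrC mulVKf.
Qed.

(** Two distinct edges are parallel, share one endpoint, or are disjoint.  The
    first two kinds give the last two terms of the bound; disjoint pairs only
    see the block averages of the kernel, hence [delta]. *)
Lemma density_variation_bound (delta : R) :
  (forall k i j, `|block_int pi i j (zeta k)| <= delta) ->
  `| \sum_(q | is_edge q) \sum_(q' | is_edge q') X q q'
     - \sum_k \sum_(e in edges F k) \sum_i \sum_j
         derive1n 2 (g k) (p.1 k i j) * tau_edge p g e.1 e.2 k i j
           * sq_int p zeta k i j |
  <= (\sum_(q | is_edge q) \sum_(q' | is_edge q') hess_mass p g q q') * delta ^+ 2
     + \sum_j \sum_k cm k j * \sum_k' path_mass p F g j k k'
     + \sum_(k < r) \sum_(k' < r | (k < k')%N)
         \sum_(e in edges F k | adj k' e.1 e.2)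
           pair_coef p g e.1 e.2 k k' * (tm k + tm k').
Proof.
move=> hd.
have hm0 (q q' : edge) : 0 <= hess_mass p g q q' by apply: sumr_ge0 => y _.
have key (q q' : edge) : is_edge q -> is_edge q' -> q' != q ->
    `|X q q'| <= hess_mass p g q q' * delta ^+ 2
       + path_terms p g zeta q q' + pair_term q q'.
  move=> Eq Eq' qq'; rewrite eq_sym in qq'.
  have H0 : 0 <= hess_mass p g q q' * delta ^+ 2 by rewrite mulr_ge0// sqr_ge0.
  have T0 := path_terms_ge0 p g zeta_good q q'.
  have [P|nP] := boolP (joins q' q.2.1 q.2.2).
    by rewrite /pair_term P mul1r lerDr addr_ge0.
  rewrite /pair_term (negbTE nP) mul0r addr0.
  have pt0 k k' (a b d : vt) : 0 <= path_term p g zeta k k' a b d.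
    exact: path_term_ge0.
  have ab := edge_neq Eq; have cd := edge_neq Eq'.
  move: nP ab cd; rewrite /joins.
  have J a b : q.2 = (a, b) -> joins q a b by rewrite /joins => ->; rewrite eqxx.
  have Jr a b : q.2 = (b, a) -> joins q a b.
    by rewrite /joins => ->; rewrite eqxx orbT.
  have J' a b : q'.2 = (a, b) -> joins q' a b by rewrite /joins => ->; rewrite eqxx.
  have Jr' a b : q'.2 = (b, a) -> joins q' a b.
    by rewrite /joins => ->; rewrite eqxx orbT.
  move: T0; rewrite /path_terms.
  case E: q.2 => [a b]; case E': q'.2 => [c d] /=; rewrite !xpair_eqE => T0 nP ab cd.
  have pth u v w : uniq [:: u; v; w] -> joins q u v -> joins q' v w ->
      `|X q q'| <= path_term p g zeta q.1 q'.1 u v w.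
    move=> u3 j1 j2; have := u3; rewrite /= !inE !negb_or !andbT => /andP[/andP[uv uw] vw].
    rewrite /path_term uv uw vw.
    exact: path_variation_le.
  (* The four ways to share one endpoint match the four terms of path_terms. *)
  have [cb|cb] := eqVneq c b.
    subst c; have u3 : uniq [:: a; b; d].
      rewrite /= !inE !negb_or ab cd !andbT /=.
      by apply: contra nP => /eqP ->; rewrite !eqxx orbT.
    have := pth _ _ _ u3 (J _ _ E) (J' _ _ E').
    have h1 := pt0 q.1 q'.1 a b d; have h2 := pt0 q.1 q'.1 a b b.
    have h3 := pt0 q.1 q'.1 b a d; have h4 := pt0 q.1 q'.1 b a b.
    rewrite mul1r; do 3! case: (_ == _); rewrite ?mul1r ?mul0r; lra.
  have [db|db] := eqVneq d b.
    subst d; have u3 : uniq [:: a; b; c].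
      rewrite /= !inE !negb_or ab [b == c]eq_sym cd !andbT /=.
      by apply: contra nP => /eqP ->; rewrite !eqxx.
    have := pth _ _ _ u3 (J _ _ E) (Jr' _ _ E').
    have h1 := pt0 q.1 q'.1 a b c; have h3 := pt0 q.1 q'.1 b a b.
    have h4 := pt0 q.1 q'.1 b a c.
    rewrite mul1r mul0r; do 2! case: (_ == _); rewrite ?mul1r ?mul0r; lra.
  have [ca|ca] := eqVneq c a.
    subst c; have u3 : uniq [:: b; a; d].
      by rewrite /= !inE !negb_or [b == a]eq_sym ab [b == d]eq_sym db cd.
    have := pth _ _ _ u3 (Jr _ _ E) (J' _ _ E').
    have h1 := pt0 q.1 q'.1 b a d; have h3 := pt0 q.1 q'.1 b a a.
    rewrite mul1r !mul0r; case: (_ == _); rewrite ?mul1r ?mul0r; lra.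
  have [da|da] := eqVneq d a.
    subst d; have u3 : uniq [:: b; a; c].
      by rewrite /= !inE !negb_or [b == a]eq_sym ab [b == c]eq_sym cb [a == c]eq_sym ca.
    have := pth _ _ _ u3 (Jr _ _ E) (Jr' _ _ E').
    by rewrite mul1r !mul0r; lra.
  have u4 : uniq [:: a; b; c; d].
    rewrite /= !inE !negb_or ab cd ![a == _]eq_sym ![b == _]eq_sym.
    by rewrite ca da cb db.
  rewrite !mul0r !addr0.
  exact: (disjoint_variation_le p_pos p_sum g zeta_good zeta_sym hd u4 (J _ _ E) (J' _ _ E')).
have -> : \sum_(q | is_edge q) \sum_(q' | is_edge q') X q q'
     - \sum_k \sum_(e in edges F k) \sum_i \sum_j
         derive1n 2 (g k) (p.1 k i j) * tau_edge p g e.1 e.2 k i j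
           * sq_int p zeta k i j
    = \sum_(q | is_edge q) \sum_(q' | is_edge q' && (q' != q)) X q q'.
  rewrite (pair_big_dep predT (fun k e => e \in edges F k)) /=.
  rewrite -sumrB; apply: eq_bigr => -[k e] /= Ee.
  rewrite (bigD1 (k, e))//= (diag_variation p_pos p_sum p_sym g zeta_good zeta_sym Ee).
  by rewrite addrC addrK.
rewrite (le_trans (ler_norm_sum _ _ _))//.
apply: (@le_trans _ _ (\sum_(q | is_edge q) \sum_(q' | is_edge q' && (q' != q))
   (hess_mass p g q q' * delta ^+ 2 + path_terms p g zeta q q' + pair_term q q'))).
  apply: ler_sum => q Eq; rewrite (le_trans (ler_norm_sum _ _ _))//.
  by apply: ler_sum => q' /andP[Eq' qq']; exact: key.
under eq_bigr do rewrite big_split /=.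
rewrite big_split /=; apply: lerD; last exact: sum_pair_term.
rewrite -sum_path_mass_sym -sum_path_bound -sum_path_terms.
rewrite big_distrl -big_split /=; apply: ler_sum => q Eq.
rewrite big_distrl -big_split /= [leRHS](bigID (fun q' => q' != q))/= lerDl.
apply: sumr_ge0 => q' _; rewrite addr_ge0//; last exact: path_terms_ge0.
by rewrite mulr_ge0// sqr_ge0.
Qed.

End graph_total.

(** * The second variation of the Lagrangian *)

(** The constituents of a quantum graph contain a [finType], a type too large
    for the universe of the index types of [exchange_big]; the outer index lives
    here in a universe of its own. *)
Lemma exchange_sum (A : nmodType) (I J : Type) (s : seq I) (t : seq J)
    (Q : pred J) (f : I -> J -> A) :
  \sum_(i <- s) \sum_(j <- t | Q j) f i j
  = \sum_(j <- t | Q j) \sum_(i <- s) f i j.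
Proof.
elim: s => [|i s IH].
  by rewrite big_nil big1// => j _; rewrite big_nil.
rewrite big_cons IH -big_split; apply: eq_bigr => j _.
by rewrite big_cons.
Qed.

Section kernel_algebra.
Variable R : realType.
Implicit Types phi psi : R -> R -> R.

Lemma kernel_okD phi psi : kernel_ok phi -> kernel_ok psi ->
  kernel_ok (fun x y => phi x y + psi x y).
Proof.
move=> [mp [M pM]] [mq [N qN]]; split; first exact: measurable_funD.
by exists (M + N) => x y; rewrite (le_trans (ler_normD _ _))// lerD.
Qed.

Lemma kernel_okZ c phi : kernel_ok phi -> kernel_ok (fun x y => c * phi x y).
Proof.
move=> [mp [M pM]]; split; first by apply: measurable_funM.
by exists (`|c| * M) => x y; rewrite normrM ler_wpM2l.
Qed.

Lemma kernel_ok_comp (f : R -> R) phi : continuous f -> kernel_ok phi ->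
  kernel_ok (fun x y => f (phi x y)).
Proof.
move=> cf [mp [M pM]]; split.
  by apply: measurableT_comp => //; exact: continuous_measurable_fun.
have [N [_ fN]] := continuous_bounded_itv M cf.
by exists N => x y; exact: fN.
Qed.

Lemma good_kernel_ok (r : nat) (zeta : kernels R r) k : good_kernels zeta ->
  kernel_ok (zeta k).
Proof. by move=> [mz [M zM]]; split => //; exists M => x y; exact: zM. Qed.

Lemma square_integralE phi : kernel_ok phi ->
  \int[@lebesgue2 R]_(z in @unit_square R) phi z.1 z.2
  = iter_integral [:: true; false] (fun x => phi (x true) (x false)) (fun=> 0).
Proof.
move=> [mp [M pM]].
have bp : bnd (fun z : R * R => phi z.1 z.2) by exists M => z.
rewrite (@iter_integral2E R bool true false (fun=> 0) phi isT).
by have [-> _] := Rintegral2E mp bp.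
Qed.

End kernel_algebra.

Section D2at_more.
Variable R : realType.

Lemma D2atB (Phi Psi : R -> R) a b : D2at Phi a -> D2at Psi b ->
  D2at (fun e => Phi e - Psi e) (a - b).
Proof.
move=> dP /(D2atZ (-1)) dQ; have := D2atD dP dQ.
rewrite mulN1r; congr (D2at _ _); apply/funext => e.
by rewrite mulN1r.
Qed.

End D2at_more.

Section lagrangian_variation.
Variables (R : realType) (r n m : nat) (p : step_param R r m).
Hypothesis p_pos : forall i, 0 < p.2 0 i.
Hypothesis p_sum : \sum_i p.2 0 i = 1.
Hypothesis p_sym : forall k i j, p.1 k i j = p.1 k j i.
Variables (F : 'I_n -> qgraph R r) (h : 'I_n -> 'I_r -> R -> R).
Variables (f0 : R -> R) (mu u : 'rV[R]_n).
Hypothesis h_analytic : forall s k, real_analytic (h s k).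
Hypothesis f0_analytic : real_analytic f0.

Let p_ge0 i : 0 <= p.2 0 i. Proof. exact: ltW. Qed.

Definition second_variation (zeta : kernels R r) : R :=
  \sum_k \sum_i \sum_j derive1n 2 f0 (p.1 k i j) * sq_int p zeta k i j
  - \sum_s mu 0 s * \sum_(c <- F s) c.1 *
      \sum_(q | @listed_edge r c.2 q) \sum_(q' | @listed_edge r c.2 q')
        pair_variation p (h s) zeta q q'.

Lemma D2at_disc zeta : good_kernels zeta ->
  D2at (fun e => disc_functional f0
          (fun k x y => step_fun p k x y + e * zeta k x y))
    (\sum_k \sum_i \sum_j derive1n 2 f0 (p.1 k i j) * sq_int p zeta k i j).
Proof.
move=> gz; apply: D2at_sum => k _.
have gW := good_step_fun p.
have kW := good_kernel_ok k gW; have kz := good_kernel_ok k gz.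
have fa1 := real_analytic_derive1 f0_analytic.
have fa2 := real_analytic_derive1 fa1.
pose W (x : bool -> R) := step_fun p k (x true) (x false).
pose Y (x : bool -> R) := zeta k (x true) (x false).
have nW : nice W := nice_kernel_ok true false kW.
have nY : nice Y := nice_kernel_ok true false kz.
have bW : bnd W by case: nW.
have bY : bnd Y by case: nY.
have narg e : nice (fun x => W x + e * Y x) by apply: niceD => //; exact: niceZ.
pose f e x := f0 (W x + e * Y x).
pose f1 e x := derive1 f0 (W x + e * Y x) * Y x.
pose f2 e x := derive1 (derive1 f0) (W x + e * Y x) * Y x * Y x.
have nf e : nice (f e).
  exact: nice_comp (real_analytic_continuous f0_analytic) (narg e).
have nf1 e : nice (f1 e).
  by apply: niceM => //; exact: nice_comp (real_analytic_continuous fa1) (narg e).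
have nf2 e : nice (f2 e).
  apply: niceM => //; apply: niceM => //.
  exact: nice_comp (real_analytic_continuous fa2) (narg e).
have u1 : udiff f f1 := udiff_comp f0_analytic bW bY.
have u2 : udiff f1 f2 := udiff_comp_snd f0_analytic bW bY.
have := D2at_iter [:: true; false] (@in_cube0 R bool) nf nf1 nf2 u1 u2.
have -> : (fun e => iter_integral [:: true; false] (f e) (fun=> 0)) =
    (fun e => \int[@lebesgue2 R]_(z in @unit_square R)
      f0 (step_fun p k z.1 z.2 + e * zeta k z.1 z.2)).
  apply/funext => e.
  rewrite (@square_integralE R (fun x y => f0 (step_fun p k x y + e * zeta k x y)))//.
  apply: kernel_ok_comp; first exact: real_analytic_continuous.
  by apply: kernel_okD => //; exact: kernel_okZ.
have kz2 : kernel_ok (fun x y => zeta k x y * zeta k x y) by exact: kernel_okM.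
have nb i j : nice (fun x : bool -> R => \1_(block p.2 i) (x true)
    * \1_(block p.2 j) (x false) * (zeta k (x true) (x false) * zeta k (x true) (x false))).
  exact: (@nice_block2 R m p.2 bool true false i j _ kz2).
congr D2at.
transitivity (iter_integral [:: true; false] (fun x : bool -> R =>
  \sum_i \sum_j derive1n 2 f0 (p.1 k i j) *
   (\1_(block p.2 i) (x true) * \1_(block p.2 j) (x false)
    * (zeta k (x true) (x false) * zeta k (x true) (x false)))) (fun=> 0)).
  apply: eq_iter_integral; first exact: in_cube0.
  move=> x cx.
  have [i bi] := block_cover p_ge0 p_sum (cx true).
  have [j bj] := block_cover p_ge0 p_sum (cx false).
  rewrite (bigD1 i)//= (bigD1 j)//= !indic_blockT// !big1 ?addr0.
  - rewrite /f2 mul0r addr0 /W /Y (step_fun_block _ p_ge0 bi bj).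
    by rewrite !mul1r mulrA.
  - move=> i' i'i; apply: big1 => j' _; rewrite [X in X * _ * _]indic_blockF.
      by rewrite !mul0r mulr0.
    by move=> bi'; move: i'i; rewrite (block_inj p_ge0 bi' bi) eqxx.
  - move=> j' j'j; rewrite [X in _ * X * _]indic_blockF ?mulr0 ?mul0r ?mulr0//.
    by move=> bj'; move: j'j; rewrite (block_inj p_ge0 bj' bj) eqxx.
rewrite iter_integral_sum; last first.
  by move=> i _; apply: nice_sum => j _; apply: niceZ; exact: nb.
apply: eq_bigr => i _; rewrite iter_integral_sum; last first.
  by move=> j _; apply: niceZ; exact: nb.
apply: eq_bigr => j _; rewrite iter_integralZ; last exact: nb.
apply: (congr1 (fun t => _ * t)).
exact: (@iter_block2 R m p.2 bool true false (fun=> 0) i j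
  (fun x y => zeta k x y * zeta k x y) isT).
Qed.

Lemma D2_boundedE zeta : good_kernels zeta ->
  D2_bounded f0 F h mu u (step_fun p) zeta = second_variation zeta.
Proof.
move=> gz; apply: D2atE; apply: D2atB; first exact: D2at_disc.
apply: D2at_sum => s _; apply: D2atZ.
rewrite -[X in D2at _ X]subr0; apply: D2atB; last exact: D2at_cst.
apply: D2at_sum => c _; apply: D2atZ.
exact: D2at_density.
Qed.

Definition edge_part (zeta : kernels R r) : R :=
  \sum_k \sum_i \sum_j c_coef f0 F h mu p i j k * sq_int p zeta k i j.

Definition kernel_mass (zeta : kernels R r) : R := \sum_k tot_mass p zeta k.

Definition hess_total : R := \sum_s `|mu 0 s| * \sum_(c <- F s) `|c.1| *
  \sum_(q | @listed_edge r c.2 q) \sum_(q' | @listed_edge r c.2 q')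
    hess_mass p (h s) q q'.

Definition graph_edge_part (zeta : kernels R r) s (G : mgraph r) : R :=
  \sum_k \sum_(e in edges G k) \sum_i \sum_j
     derive1n 2 (h s k) (p.1 k i j) * tau_edge p (h s) e.1 e.2 k i j
       * sq_int p zeta k i j.

Lemma edge_partE zeta : edge_part zeta =
  \sum_k \sum_i \sum_j derive1n 2 f0 (p.1 k i j) * sq_int p zeta k i j
  - \sum_s mu 0 s * \sum_(c <- F s) c.1 * graph_edge_part zeta s c.2.
Proof.
have E s c : graph_edge_part zeta s c = \sum_k \sum_i \sum_j
    derive1n 2 (h s k) (p.1 k i j)
      * (\sum_(e in edges c k) tau_edge p (h s) e.1 e.2 k i j) * sq_int p zeta k i j.
  apply: eq_bigr => k _; rewrite exchange_big; apply: eq_bigr => i _ /=.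
  rewrite exchange_big; apply: eq_bigr => j _ /=.
  by rewrite big_distrr big_distrl.
have -> : \sum_s mu 0 s * \sum_(c <- F s) c.1 * graph_edge_part zeta s c.2 =
    \sum_k \sum_i \sum_j (\sum_s mu 0 s * derive1n 2 (h s k) (p.1 k i j)
      * \sum_(c <- F s) c.1 * \sum_(e in edges c.2 k)
           tau_edge p (h s) e.1 e.2 k i j) * sq_int p zeta k i j.
  under [RHS]eq_bigr => k _ do under eq_bigr => i _ do under eq_bigr => j _ do
    rewrite big_distrl /=.
  under [RHS]eq_bigr => k _ do under eq_bigr => i _ do rewrite exchange_big /=.
  under [RHS]eq_bigr => k _ do rewrite exchange_big /=.
  rewrite [RHS]exchange_big; apply: eq_bigr => s _ /=.
  transitivity (mu 0 s * \sum_(c <- F s) \sum_k \sum_i \sum_j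
     c.1 * (derive1n 2 (h s k) (p.1 k i j)
      * (\sum_(e in edges c.2 k) tau_edge p (h s) e.1 e.2 k i j)
      * sq_int p zeta k i j)).
    congr (_ * _); apply: eq_bigr => c _; rewrite E.
    rewrite big_distrr; apply: eq_bigr => k _ /=.
    rewrite big_distrr; apply: eq_bigr => i _ /=.
    by rewrite big_distrr.
  rewrite [X in _ * X]exchange_sum big_distrr /=; apply: eq_bigr => k _.
  rewrite [X in _ * X]exchange_sum big_distrr /=; apply: eq_bigr => i _.
  rewrite [X in _ * X]exchange_sum big_distrr /=; apply: eq_bigr => j _.
  rewrite big_distrr [in RHS]big_distrr big_distrl; apply: eq_bigr => c _ /=.
  by ring.
rewrite /edge_part -sumrB; apply: eq_bigr => k _.
rewrite -sumrB; apply: eq_bigr => i _; rewrite -sumrB; apply: eq_bigr => j _.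
by rewrite /c_coef mulrBl.
Qed.

Section with_zeta.
Variable zeta : kernels R r.
Hypothesis zeta_good : good_kernels zeta.
Hypothesis zeta_sym : forall k x y, zeta k x y = zeta k y x.

Local Notation N := (kernel_mass zeta).

(** For fixed [j] and [k] the coefficient of [col_mass k j] is exactly the
    expression maximised in [Gamma_sv]. *)
Lemma path_part_le :
  \sum_s `|mu 0 s| * \sum_(c <- F s) `|c.1| *
    (\sum_j \sum_k col_mass p zeta k j * \sum_k' path_mass p c.2 (h s) j k k')
  <= Gamma_sv F h mu p * N.
Proof.
have -> : \sum_s `|mu 0 s| * \sum_(c <- F s) `|c.1| *
    (\sum_j \sum_k col_mass p zeta k j * \sum_k' path_mass p c.2 (h s) j k k')
  = \sum_j \sum_k (\sum_s `|mu 0 s| * \sum_k' \sum_(c <- F s) `|c.1| *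
      path_mass p c.2 (h s) j k k') * col_mass p zeta k j.
  under [RHS]eq_bigr => j _ do under eq_bigr => k _ do rewrite big_distrl /=.
  under [RHS]eq_bigr => j _ do rewrite exchange_big /=.
  rewrite [RHS]exchange_big; apply: eq_bigr => s _ /=.
  under [RHS]eq_bigr => j _ do under eq_bigr => k _ do rewrite -mulrA.
  under [RHS]eq_bigr => j _ do rewrite -big_distrr /=.
  rewrite -big_distrr /=; congr (_ * _).
  under [RHS]eq_bigr => j _ do under eq_bigr => k _ do
    rewrite -exchange_sum big_distrl /=.
  under [RHS]eq_bigr => j _ do rewrite -exchange_sum /=.
  rewrite -[RHS]exchange_sum; apply: eq_bigr => c _ /=.
  rewrite big_distrr; apply: eq_bigr => j _ /=.
  rewrite big_distrr; apply: eq_bigr => k _ /=.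
  by rewrite -big_distrr /= mulrCA mulrC.
have -> : N = \sum_j \sum_k col_mass p zeta k j.
  by rewrite /kernel_mass exchange_big.
rewrite big_distrr; apply: ler_sum => j _ /=.
rewrite big_distrr; apply: ler_sum => k _ /=.
apply: ler_wpM2r; first exact: col_mass_ge0.
rewrite /Gamma_sv (le_trans _ (@le_bigmax _ _ _ 0 _ j))//.
exact: (@le_bigmax _ _ _ 0 (fun k => _) k).
Qed.

Lemma pair_part_le :
  \sum_s `|mu 0 s| * \sum_(c <- F s) `|c.1| *
    (\sum_(k < r) \sum_(k' < r | (k < k')%N)
       \sum_(e in edges c.2 k | adj k' e.1 e.2)
         pair_coef p (h s) e.1 e.2 k k' * (tot_mass p zeta k + tot_mass p zeta k'))
  <= Gamma_sp F h mu p * N.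
Proof.
have tm_le (k k' : 'I_r) : (k < k')%N ->
    tot_mass p zeta k + tot_mass p zeta k' <= N.
  move=> kk'; rewrite /kernel_mass (bigD1 k)//= (bigD1 k')/=.
    rewrite addrA lerDl sumr_ge0// => l _; exact: tot_mass_ge0.
  by apply: contraTneq kk' => ->; rewrite ltnn.
rewrite /Gamma_sp big_distrl; apply: ler_sum => s _ /=.
rewrite -mulrA; apply: ler_wpM2l => //.
have -> : \sum_(k < r) \sum_(k' < r | (k < k')%N) \sum_(c <- F s) `|c.1| *
      \sum_(e in edges c.2 k | adj k' e.1 e.2) \sum_(i < m) \sum_(j < m)
        `| derive1 (h s k) (p.1 k i j) * derive1 (h s k') (p.1 k' i j)
           * tau_pair p (h s) e.1 e.2 k k' i j |
  = \sum_(c <- F s) `|c.1| * \sum_(k < r) \sum_(k' < r | (k < k')%N)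
      \sum_(e in edges c.2 k | adj k' e.1 e.2) pair_coef p (h s) e.1 e.2 k k'.
  under [LHS]eq_bigr do rewrite -exchange_sum.
  rewrite -exchange_sum; apply: eq_bigr => c _; rewrite big_distrr.
  by apply: eq_bigr => k _; rewrite big_distrr.
rewrite big_distrl; apply: ler_sum => c _ /=.
rewrite -mulrA; apply: ler_wpM2l => //.
rewrite big_distrl; apply: ler_sum => k _ /=.
rewrite big_distrl; apply: ler_sum => k' kk' /=.
rewrite big_distrl; apply: ler_sum => e _ /=.
apply: ler_wpM2l; last exact: tm_le.
by apply: sumr_ge0 => i _; apply: sumr_ge0 => j _; exact: normr_ge0.
Qed.

(** Single edges contribute exactly [edge_part]; the couplings between distinct
    edges of all the constituents together cost at most [Gamma] times the mass,
    up to the disjoint pairs. *)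
Lemma second_variation_ge (delta : R) :
  (forall k i j, `|block_int p.2 i j (zeta k)| <= delta) ->
  edge_part zeta - Gamma F h mu p * N - hess_total * delta ^+ 2
    <= second_variation zeta.
Proof.
move=> hd; rewrite edge_partE /second_variation.
pose Q s (G : mgraph r) := \sum_(q | @listed_edge r G q) \sum_(q' | @listed_edge r G q')
        pair_variation p (h s) zeta q q'.
pose B s (G : mgraph r) := (\sum_(q | @listed_edge r G q) \sum_(q' | @listed_edge r G q')
       hess_mass p (h s) q q') * delta ^+ 2
     + \sum_j \sum_k col_mass p zeta k j * \sum_k' path_mass p G (h s) j k k'
     + \sum_(k < r) \sum_(k' < r | (k < k')%N)
         \sum_(e in edges G k | adj k' e.1 e.2)
           pair_coef p (h s) e.1 e.2 k k' * (tot_mass p zeta k + tot_mass p zeta k').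
have QB s (G : mgraph r) : `|Q s G - graph_edge_part zeta s G| <= B s G.
  exact: density_variation_bound.
have le1 : \sum_s mu 0 s * \sum_(c <- F s) c.1 * Q s c.2
   - \sum_s mu 0 s * \sum_(c <- F s) c.1 * graph_edge_part zeta s c.2
   <= \sum_s `|mu 0 s| * \sum_(c <- F s) `|c.1| * B s c.2.
  rewrite -sumrB (le_trans (ler_norm _))// (le_trans (ler_norm_sum _ _ _))//.
  apply: ler_sum => s _; rewrite -mulrBr normrM; apply: ler_wpM2l => //.
  rewrite -sumrB (le_trans (ler_norm_sum _ _ _))//.
  apply: ler_sum => c _; rewrite -mulrBr normrM; apply: ler_wpM2l => //.
have le2 : \sum_s `|mu 0 s| * \sum_(c <- F s) `|c.1| * B s c.2
   <= hess_total * delta ^+ 2 + Gamma F h mu p * N.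
  have -> : \sum_s `|mu 0 s| * \sum_(c <- F s) `|c.1| * B s c.2 =
    hess_total * delta ^+ 2
    + (\sum_s `|mu 0 s| * \sum_(c <- F s) `|c.1| *
        (\sum_j \sum_k col_mass p zeta k j * \sum_k' path_mass p c.2 (h s) j k k')
      + \sum_s `|mu 0 s| * \sum_(c <- F s) `|c.1| *
        (\sum_(k < r) \sum_(k' < r | (k < k')%N)
          \sum_(e in edges c.2 k | adj k' e.1 e.2)
           pair_coef p (h s) e.1 e.2 k k' * (tot_mass p zeta k + tot_mass p zeta k'))).
    rewrite big_distrl -!big_split; apply: eq_bigr => s _ /=.
    rewrite -[X in X + _]mulrA -!mulrDr; congr (_ * _).
    rewrite big_distrl -!big_split; apply: eq_bigr => c _ /=.
    by rewrite /B -mulrA -!mulrDr addrA.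
  rewrite lerD2l /Gamma mulrDl; apply: lerD; first exact: path_part_le.
  exact: pair_part_le.
move: le1 le2; rewrite /Q; lra.
Qed.

End with_zeta.
End lagrangian_variation.

(** * Coercivity and continuity on bounded kernels *)

Lemma finite_pos_lower (R : realFieldType) (T : finType) (f : T -> R) :
  (forall t, 0 < f t) -> exists2 c, 0 < c & forall t, c <= f t.
Proof.
move=> f0; exists (\big[Num.min/1]_t f t).
  by apply: lt_bigmin => // t _; exact: f0.
by move=> t; exact: bigmin_le.
Qed.

Section estimates.
Variables (R : realType) (r n m : nat) (p : step_param R r m).
Hypothesis p_pos : forall i, 0 < p.2 0 i.
Hypothesis p_sum : \sum_i p.2 0 i = 1.
Hypothesis p_sym : forall k i j, p.1 k i j = p.1 k j i.
Variables (F : 'I_n -> qgraph R r) (h : 'I_n -> 'I_r -> R -> R).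
Variables (f0 : R -> R) (mu : 'rV[R]_n).

Let p_ge0 i : 0 <= p.2 0 i. Proof. exact: ltW. Qed.

Local Notation D2 := (second_variation p F h f0 mu).
Local Notation N := (kernel_mass p).

Lemma kernel_mass_ge0 zeta : good_kernels zeta -> 0 <= N zeta.
Proof. by move=> gz; apply: sumr_ge0 => k _; exact: tot_mass_ge0. Qed.

(** The finitely many gaps between [c_coef] and [Gamma] have a positive lower
    bound, which serves as [c0]. *)
Lemma second_variation_lower :
  (forall i j k, Gamma F h mu p < c_coef f0 F h mu p i j k) ->
  exists c0 C : R, [/\ 0 < c0, 0 <= C & forall zeta delta,
    good_kernels zeta -> (forall k x y, zeta k x y = zeta k y x) ->
    (forall k i j, `|block_int p.2 i j (zeta k)| <= delta) ->
    c0 * N zeta - C * delta ^+ 2 <= D2 zeta].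
Proof.
move=> cG.
have gap (t : 'I_m * 'I_m * 'I_r) :
    0 < c_coef f0 F h mu p t.1.1 t.1.2 t.2 - Gamma F h mu p.
  by rewrite subr_gt0.
have [c0 c00 cle] := finite_pos_lower gap.
exists c0, (hess_total p F h mu); split => //.
  apply: sumr_ge0 => s _; apply: mulr_ge0 => //; apply: sumr_ge0 => c _.
  apply: mulr_ge0 => //; apply: sumr_ge0 => q _; apply: sumr_ge0 => q' _.
  exact: sumr_ge0.
move=> zeta delta gz sz hd.
have := second_variation_ge p_pos p_sum p_sym F h f0 mu gz sz hd.
suff : (Gamma F h mu p + c0) * N zeta <= edge_part p F h f0 mu zeta by lra.
rewrite /kernel_mass /edge_part big_distrr; apply: ler_sum => k _ /=.
rewrite /tot_mass /col_mass exchange_big big_distrr; apply: ler_sum => i _ /=.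
rewrite big_distrr; apply: ler_sum => j _ /=.
apply: ler_wpM2r; first exact: sq_int_ge0.
by have := cle (i, j, k); rewrite /=; lra.
Qed.

Lemma iter_edge (V : eqType) (s : seq V) (a b : V) (phi : R -> R -> R) :
  uniq s -> a \in s -> b \in s -> a != b -> kernel_ok phi ->
  iter_integral s (fun x => phi (x a) (x b)) (fun=> 0)
  = \sum_i \sum_j block_int p.2 i j phi.
Proof.
move=> us as_ bs ab kp.
have ul : uniq [:: a; b] by rewrite /= inE ab.
have ls : {subset [:: a; b] <= s} by move=> v; rewrite !inE => /orP[] /eqP ->.
have nH := nice_kernel_ok a b kp.
have Hl : depends_on [:: a; b] (fun x : V -> R => phi (x a) (x b)).
  by move=> x z xz; rewrite !xz// !inE eqxx ?orbT.
have mc (v : V) : measurable_fun [set: R] (fun=> 1 : R) by exact: measurable_cst.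
have bc (v : V) : bnd (fun=> 1 : R) (T := R) by exact: bnd_cst.
have E := @iter_integral_split V R s [:: a; b] (fun _ _ => 1) _ (fun=> 0)
  us ul ls mc bc nH Hl.
have one (t : seq V) : (fun x : V -> R => (\prod_(v <- t) 1) * phi (x a) (x b))
    = (fun x => phi (x a) (x b)).
  by apply/funext => x; rewrite big1// mul1r.
rewrite !one in E; rewrite E big1 ?mul1r.
  rewrite (@iter_integral2E R V a b (fun=> 0) phi ab).
  by rewrite (sum_block_int p_ge0 p_sum kp).
by move=> v _; exact: I1_cst.
Qed.

(** The modulus of continuity of a quadratic form, with the product of the two
    norms replaced by an arithmetic mean of weight [t]. *)
Definition lip_err (t : R) (zeta xi : kernels R r) : R :=
  t * (N zeta + N xi) + N (fun k x y => zeta k x y - xi k x y) / t.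

Lemma good_kernelsB zeta xi : good_kernels zeta -> good_kernels xi ->
  good_kernels (fun k x y => zeta k x y - xi k x y : R) (r := r).
Proof.
move=> [mz [M zM]] [mx [M' xM]]; split.
  by move=> k; apply: measurable_funB.
by exists (M + M') => k x y; rewrite (le_trans (ler_normB _ _))// lerD.
Qed.

Lemma variation_term_lip (V : eqType) (s : seq V) (a b c d : V) k k'
    (P : (V -> R) -> R) zeta xi t :
  0 < t -> uniq s -> a \in s -> b \in s -> c \in s -> d \in s ->
  a != b -> c != d -> nice P -> (forall x, 0 <= P x <= 1) ->
  good_kernels zeta -> good_kernels xi ->
  `| iter_integral s (fun x => P x * (zeta k (x a) (x b) * zeta k' (x c) (x d)))
       (fun=> 0)
     - iter_integral s (fun x => P x * (xi k (x a) (x b) * xi k' (x c) (x d)))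
       (fun=> 0) |
  <= lip_err t zeta xi.
Proof.
move=> t0 us as_ bs cs ds ab cd nP P01 gz gx.
have gd := good_kernelsB gz gx.
set dl := (fun k x y => zeta k x y - xi k x y) in gd.
have nk (z : kernels R r) l u v : good_kernels z ->
  nice (fun x : V -> R => z l (x u) (x v)) by exact: nice_kernel.
have mass (z : kernels R r) l u v : good_kernels z -> u \in s -> v \in s -> u != v ->
    iter_integral s (fun x => z l (x u) (x v) * z l (x u) (x v)) (fun=> 0) <= N z.
  move=> gzz us' vs uv; have kz := good_kernel_ok l gzz.
  have -> := iter_edge us us' vs uv (kernel_okM kz kz).
  rewrite exchange_big /kernel_mass (bigD1 l)//= lerDl.
  by apply: sumr_ge0 => l' _; exact: tot_mass_ge0.
have nsq (z : kernels R r) l u v : good_kernels z ->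
    nice (fun x : V -> R => z l (x u) (x v) * z l (x u) (x v)).
  by move=> gzz; apply: niceM; exact: nk.
have nf (z : kernels R r) : good_kernels z ->
    nice (fun x => P x * (z k (x a) (x b) * z k' (x c) (x d))).
  by move=> gzz; apply: niceM => //; apply: niceM; exact: nk.
pose G (x : V -> R) := (t / 2) * (zeta k (x a) (x b) * zeta k (x a) (x b))
  + ((t / 2) * (xi k' (x c) (x d) * xi k' (x c) (x d))
  + ((t^-1 / 2) * (dl k (x a) (x b) * dl k (x a) (x b))
  + (t^-1 / 2) * (dl k' (x c) (x d) * dl k' (x c) (x d)))).
have nG1 := niceZ (t / 2) (nsq zeta k a b gz).
have nG2 := niceZ (t / 2) (nsq xi k' c d gx).
have nG3 := niceZ (t^-1 / 2) (nsq dl k a b gd).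
have nG4 := niceZ (t^-1 / 2) (nsq dl k' c d gd).
have nG34 := niceD nG3 nG4.
have nG234 := niceD nG2 nG34.
have nG : nice G by exact: niceD nG1 nG234.
have GE : iter_integral s G (fun=> 0) <= lip_err t zeta xi.
  rewrite (iter_integralD s (fun=> 0) nG1 nG234).
  rewrite (iter_integralD s (fun=> 0) nG2 nG34).
  rewrite (iter_integralD s (fun=> 0) nG3 nG4).
  rewrite (iter_integralZ s (t / 2) (fun=> 0) (nsq zeta k a b gz)).
  rewrite (iter_integralZ s (t / 2) (fun=> 0) (nsq xi k' c d gx)).
  rewrite (iter_integralZ s (t^-1 / 2) (fun=> 0) (nsq dl k a b gd)).
  rewrite (iter_integralZ s (t^-1 / 2) (fun=> 0) (nsq dl k' c d gd)).
  have m1 := mass zeta k a b gz as_ bs ab.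
  have m2 := mass xi k' c d gx cs ds cd.
  have m3 := mass dl k a b gd as_ bs ab.
  have m4 := mass dl k' c d gd cs ds cd.
  have z0 := kernel_mass_ge0 gz; have x0 := kernel_mass_ge0 gx.
  have ti : 0 < t^-1 by rewrite invr_gt0.
  have th : 0 <= t / 2 by rewrite divr_ge0// ltW.
  have tih : 0 <= t^-1 / 2 by rewrite divr_ge0// ltW.
  apply: (le_trans (lerD (ler_wpM2l th m1) (lerD (ler_wpM2l th m2)
    (lerD (ler_wpM2l tih m3) (ler_wpM2l tih m4))))).
  rewrite /lip_err -/dl.
  move: (N zeta) (N xi) (N dl) z0 x0 => n1 n2 n3 n10 n20.
  rewrite -subr_ge0 (_ : _ - _ = t / 2 * n1 + t / 2 * n2).
    by rewrite addr_ge0// mulr_ge0.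
  by field; rewrite gt_eqF.
rewrite -(iter_integralB s (fun=> 0) (nf _ gz) (nf _ gx)); apply: le_trans GE.
apply: ler_norm_iter_integral => //.
- by apply: niceD; [exact: nf|apply: niceN; exact: nf].
- exact: in_cube0.
move=> x _; rewrite -mulrBr normrM; have /andP[Px0 Px1] := P01 x.
rewrite (ger0_norm Px0); apply: (@le_trans _ _
  `|zeta k (x a) (x b) * zeta k' (x c) (x d) - xi k (x a) (x b) * xi k' (x c) (x d)|).
  exact: ler_piMl.
rewrite /G /dl.
move: (zeta k (x a) (x b)) (zeta k' (x c) (x d)) (xi k (x a) (x b))
  (xi k' (x c) (x d)) => z z' w w'.
have amgm (A B : R) : `|A * B| <= t / 2 * (A * A) + t^-1 / 2 * (B * B).
  have -> : t / 2 * (A * A) + t^-1 / 2 * (B * B) =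
     (t * `|A| - `|B|) ^+ 2 / t / 2 + `|A * B|.
    rewrite normrM -[A * A]expr2 -[B * B]expr2.
    rewrite -[A ^+ 2]real_normK ?num_real// -[B ^+ 2]real_normK ?num_real//.
    by field; rewrite gt_eqF.
  by rewrite lerDr !divr_ge0// ?sqr_ge0// ltW.
have -> : z * z' - w * w' = z * (z' - w') + w' * (z - w) by ring.
rewrite (le_trans (ler_normD _ _))//.
have := amgm z (z' - w'); have := amgm w' (z - w); lra.
Qed.

Lemma second_variation_lip : exists2 K : R, 0 <= K &
  forall zeta xi t, 0 < t -> good_kernels zeta -> good_kernels xi ->
  `|D2 zeta - D2 xi| <= K * lip_err t zeta xi.
Proof.
exists ((\sum_k \sum_i \sum_j `|derive1n 2 f0 (p.1 k i j)|) + hess_total p F h mu).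
  apply: addr_ge0.
    by apply: sumr_ge0 => k _; apply: sumr_ge0 => i _; exact: sumr_ge0.
  apply: sumr_ge0 => s _; apply: mulr_ge0 => //; apply: sumr_ge0 => c _.
  apply: mulr_ge0 => //; apply: sumr_ge0 => q _; apply: sumr_ge0 => q' _.
  exact: sumr_ge0.
move=> zeta xi t t0 gz gx; rewrite mulrDl /second_variation.
have E4 (a b a' b' : R) : a - b - (a' - b') = (a - a') - (b - b') by ring.
rewrite E4.
rewrite (le_trans (ler_normB _ _))//; apply: lerD.
  rewrite -sumrB (le_trans (ler_norm_sum _ _ _))// big_distrl.
  apply: ler_sum => k _ /=.
  rewrite -sumrB (le_trans (ler_norm_sum _ _ _))// big_distrl.
  apply: ler_sum => i _ /=.
  rewrite -sumrB (le_trans (ler_norm_sum _ _ _))// big_distrl.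
  apply: ler_sum => j _ /=.
  rewrite -mulrBr normrM; apply: ler_wpM2l => //.
  pose P (x : bool -> R) : R := \1_(block p.2 i) (x true) * \1_(block p.2 j) (x false).
  have nP : nice P by apply: niceM; exact: nice_indic_block.
  have P01 x : 0 <= P x <= 1.
    have /andP[a0 a1] := indic01 R (block p.2 i) (x true).
    have /andP[b0 b1] := indic01 R (block p.2 j) (x false).
    by rewrite /P mulr_ge0//= mulr_ile1.
  have us : uniq [:: true; false] by [].
  have ts : true \in [:: true; false] by [].
  have fs : false \in [:: true; false] by [].
  have tf : true != false by [].
  have := variation_term_lip k k t0 us ts fs ts fs tf tf nP P01 gz gx.
  have E (z : kernels R r) : sq_int p z k i j = iter_integral [:: true; false]
      (fun x => P x * (z k (x true) (x false) * z k (x true) (x false))) (fun=> 0).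
    exact: (esym (@iter_block2 R m p.2 bool true false (fun=> 0) i j
      (fun x y => z k x y * z k x y) tf)).
  by rewrite (E zeta) (E xi).
rewrite -sumrB (le_trans (ler_norm_sum _ _ _))// /hess_total big_distrl.
apply: ler_sum => s _ /=.
rewrite -mulrBr normrM -mulrA; apply: ler_wpM2l => //.
rewrite -sumrB (le_trans (ler_norm_sum _ _ _))// big_distrl.
apply: ler_sum => c _ /=.
rewrite -mulrBr normrM -mulrA; apply: ler_wpM2l => //.
rewrite -sumrB (le_trans (ler_norm_sum _ _ _))// big_distrl.
apply: ler_sum => q Eq /=.
rewrite -sumrB (le_trans (ler_norm_sum _ _ _))// big_distrl.
apply: ler_sum => q' Eq' /=.
rewrite /pair_variation -sumrB (le_trans (ler_norm_sum _ _ _))// big_distrl.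
apply: ler_sum => y _ /=.
rewrite -mulrBr normrM; apply: ler_wpM2l => //.
have B01 x : 0 <= block_ind p y x <= 1.
  rewrite /block_ind; apply/andP; split.
    apply: prodr_ge0 => v _.
    by case/andP: (indic01 R (block p.2 (y v)) (x v)).
  by apply: prodr_ile1 => v _; exact: indic01.
exact: (variation_term_lip q.1 q'.1 t0 (enum_uniq _) (mem_enum predT _)
  (mem_enum predT _) (mem_enum predT _) (mem_enum predT _)
  (edge_neq Eq) (edge_neq Eq') (nice_block_ind p y) B01 gz gx).
Qed.

End estimates.

(** * Square-integrable functions on the unit square *)

Section square_L2.
Variable R : realType.
Local Notation RR := (measurableTypeR R).
Local Notation mu2 := (@lebesgue2 R).
Local Notation sq := (@unit_square R).
Implicit Types f g : RR * RR -> R.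

Definition L2_square f : Prop :=
  measurable_fun sq f /\ mu2.-integrable sq (fun z => ((f z) ^+ 2)%:E).

Definition normsq f : R := \int[mu2]_(z in sq) (f z) ^+ 2.

Lemma integrable_cst_square (c : R) : mu2.-integrable sq (fun=> c%:E).
Proof. by apply: (@bnd_integrable2 R (fun=> c)) => //; exact: bnd_cst. Qed.

Lemma integrableDZ f g (a b : R) :
  mu2.-integrable sq (EFin \o f) -> mu2.-integrable sq (EFin \o g) ->
  mu2.-integrable sq (EFin \o (fun z => a * f z + b * g z)).
Proof.
move=> f1 g1.
have msq := @measurable_unit_square R.
have := integrableD msq (integrableZl msq a f1) (integrableZl msq b g1).
by apply: eq_integrable.
Qed.

Lemma le_integrable_fin f g : measurable_fun sq f ->
  (forall z, `|f z| <= g z) -> mu2.-integrable sq (EFin \o g) ->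
  mu2.-integrable sq (EFin \o f).
Proof.
move=> mf fg; apply: le_integrable; first exact: measurable_unit_square.
  exact/measurable_EFinP.
move=> z _ /=; rewrite lee_fin (le_trans (fg z))//; exact: ler_norm.
Qed.

Lemma L2_square_integrable f : L2_square f -> mu2.-integrable sq (EFin \o f).
Proof.
move=> [mf if2].
apply: (@le_integrable_fin _ (fun z => 1 * 1 + 1 * (f z) ^+ 2)) => //.
  move=> z; rewrite !mul1r -[(f z) ^+ 2]real_normK ?num_real//.
  have := sqr_ge0 (`|f z| - 1); have := normr_ge0 (f z); rewrite sqrrB !expr2; lra.
by apply: integrableDZ => //; exact: integrable_cst_square.
Qed.

Lemma L2_squareB f g : L2_square f -> L2_square g ->
  L2_square (fun z => f z - g z).
Proof.
move=> [mf f2] [mg g2]; have mfg : measurable_fun sq (fun z => f z - g z).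
  exact: measurable_funB.
split => //; apply: (@le_integrable_fin _ (fun z => 2 * (f z) ^+ 2 + 2 * (g z) ^+ 2)).
- exact: measurable_funX.
- move=> z; rewrite ger0_norm ?sqr_ge0//.
  have := sqr_ge0 (f z + g z); rewrite sqrrB sqrrD; lra.
- exact: integrableDZ.
Qed.

Lemma bnd_L2_square f : measurable_fun sq f -> bnd f -> L2_square f.
Proof.
move=> mf bf; split => //; apply: (@bnd_integrable2 R (fun z => (f z) ^+ 2)).
  exact: measurable_funX.
by have := bndM bf bf.
Qed.

Lemma normsq_ge0 f : 0 <= normsq f.
Proof. by apply: Rintegral_ge0 => z _; exact: sqr_ge0. Qed.

Lemma normsq_le f g k (a b : R) : L2_square f -> L2_square g -> L2_square k ->
  (forall z, (f z) ^+ 2 <= a * (g z) ^+ 2 + b * (k z) ^+ 2) ->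
  normsq f <= a * normsq g + b * normsq k.
Proof.
move=> [_ f2] [_ g2] [_ k2] le.
have msq := @measurable_unit_square R.
rewrite /normsq -!RintegralZl// -RintegralD//; first last.
- by have := integrableZl msq b k2; apply: eq_integrable.
- by have := integrableZl msq a g2; apply: eq_integrable.
apply: le_Rintegral => //; exact: integrableDZ.
Qed.

Lemma Rintegral_sub_le f (B : set (RR * RR)) (t : R) : measurable B -> B `<=` sq ->
  L2_square f -> 0 < t ->
  `| \int[mu2]_(z in B) f z | <= (t + normsq f / t) / 2.
Proof.
move=> mB Bsq f2 t0; have msq := @measurable_unit_square R.
have i1 := L2_square_integrable f2; case: (f2) => mf if2.
have iB : mu2.-integrable B (EFin \o f) by exact: integrableS i1.
rewrite (le_trans (le_normr_Rintegral mB iB))//.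
have iB2 : mu2.-integrable B (EFin \o (fun z => t / 2 * 1 + t^-1 / 2 * (f z) ^+ 2)).
  apply: integrableS msq _ _ _ => //; apply: integrableDZ => //.
  exact: integrable_cst_square.
have isq : mu2.-integrable sq (EFin \o (fun z => t / 2 * 1 + t^-1 / 2 * (f z) ^+ 2)).
  by apply: integrableDZ => //; exact: integrable_cst_square.
apply: (@le_trans _ _ (\int[mu2]_(z in B) (t / 2 * 1 + t^-1 / 2 * (f z) ^+ 2))).
  apply: le_Rintegral => //.
    by have := integrable_norm iB; apply: eq_integrable.
  move=> z _; have -> : t / 2 * 1 + t^-1 / 2 * f z ^+ 2 =
      (t - `|f z|) ^+ 2 / t / 2 + `|f z|.
    rewrite -[f z ^+ 2]real_normK ?num_real//; field; rewrite gt_eqF//.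
  by rewrite lerDr !divr_ge0// ?sqr_ge0// ltW.
have h0 z : 0 <= t / 2 * 1 + t^-1 / 2 * f z ^+ 2.
  by rewrite addr_ge0// mulr_ge0 ?sqr_ge0// divr_ge0// ?invr_ge0 ltW.
apply: (@le_trans _ _ (\int[mu2]_(z in sq) (t / 2 * 1 + t^-1 / 2 * (f z) ^+ 2))).
  rewrite /Rintegral fine_le//; [exact: integrable_fin_num|exact: integrable_fin_num|].
  apply: ge0_subset_integral => //; first by case/integrableP: isq.
  by move=> z _; rewrite lee_fin.
have i3 : mu2.-integrable sq (EFin \o (fun z => t^-1 / 2 * (f z) ^+ 2)).
  by have := integrableZl msq (t^-1 / 2) if2; apply: eq_integrable.
have E1 : \int[mu2]_(z in sq) (t / 2 * 1 + t^-1 / 2 * (f z) ^+ 2)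
    = \int[mu2]_(z in sq) (t / 2 * 1) + \int[mu2]_(z in sq) (t^-1 / 2 * (f z) ^+ 2).
  exact: (RintegralD msq (integrable_cst_square (t / 2 * 1)) i3).
have E2 : \int[mu2]_(z in sq) (t^-1 / 2 * (f z) ^+ 2) = t^-1 / 2 * normsq f.
  exact: (RintegralZl _ msq if2).
have E3 : \int[mu2]_(z in sq) (t / 2 * 1) = t / 2 * 1 * fine (mu2 sq).
  exact: (Rintegral_cst _ msq).
rewrite E1 E2 E3 lebesgue2_unit_square /= !mulr1 le_eqVlt; apply/orP; left; apply/eqP.
by field; rewrite gt_eqF.
Qed.

Lemma truncation_cvg f : L2_square f ->
  normsq (fun z => f z * \1_(`[- n%:R, n%:R]) (f z) - f z) @[n --> \oo] --> 0.
Proof.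
move=> [mf if2]; have msq := @measurable_unit_square R.
pose d n z := f z * \1_(`[- n%:R, n%:R]) (f z) - f z.
have dE n z : d n z = 0 \/ d n z = - f z.
  rewrite /d indicE; case: (_ \in _); rewrite ?mulr1 ?mulr0.
    by left; rewrite subrr.
  by right; rewrite sub0r.
have md n : measurable_fun sq (d n).
  apply: measurable_funB => //; apply: measurable_funM => //.
  by apply: (@measurableT_comp _ _ _ _ _ _ (\1_(`[- n%:R, n%:R]) : R -> R)).
have md2 n : measurable_fun sq (fun z => ((d n z) ^+ 2)%:E).
  by apply/measurable_EFinP; exact: measurable_funX.
have cv z : sq z -> (fun n => ((d n z) ^+ 2)%:E) @ \oo --> (0%:E : \bar R).
  move=> _; apply: cvg_near_cst.
  have := @nbhs_infty_ger R `|f z|; apply: filterS => n nf.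
  by rewrite /d indicE mem_set/= ?in_itv/= -?ler_norml// mulr1 subrr expr0n.
have bd n z : sq z -> (`|((d n z) ^+ 2)%:E| <= ((f z) ^+ 2)%:E)%E.
  move=> _; rewrite /= lee_fin ger0_norm ?sqr_ge0//.
  by have [->|->] := dE n z; rewrite ?sqrrN// expr0n/= sqr_ge0.
have fin z : sq z -> ((f z) ^+ 2)%:E \is a fin_num by [].
have := @dominated_cvg _ _ _ mu2 sq msq _ _ _ md2 cv fin if2 bd.
rewrite integral0 => /fine_cvgP[_]; apply: cvg_trans; apply: near_eq_cvg.
by near=> n.
Unshelve. all: by end_near. Qed.

End square_L2.

(** * Bounded kernels approximating a square-integrable one *)

Section extension.
Variables (R : realType) (r : nat).
Local Notation RR := (measurableTypeR R).
Local Notation mu2 := (@lebesgue2 R).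
Local Notation sq := (@unit_square R).

Definition square_fun (zeta : kernels R r) (k : 'I_r) (z : RR * RR) : R :=
  zeta k z.1 z.2.

(** Only the values on the unit square matter for a kernel; extending them by a
    constant gives a kernel that is measurable and bounded everywhere. *)
Definition square_ext (zeta : kernels R r) : kernels R r :=
  fun k x y => (square_fun zeta k \_ sq) (x, y).

Lemma unit_squareE (x y : R) : 0 <= x <= 1 -> 0 <= y <= 1 -> sq (x, y).
Proof. by move=> x01 y01; split; rewrite /= in_itv. Qed.

Lemma square_extE zeta k z : sq z -> square_ext zeta k z.1 z.2 = zeta k z.1 z.2.
Proof.
by case: z => x y sz; rewrite /square_ext patchE mem_set.
Qed.

Lemma good_square_ext zeta : measurable_kernels zeta -> bounded_kernels zeta ->
  good_kernels (square_ext zeta).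
Proof.
move=> mz [M zM]; have msq := @measurable_unit_square R; split.
  move=> k; have := iffLR (measurable_restrictT (square_fun zeta k) msq) (mz k).
  have E : square_fun zeta k \_ sq = (fun z => square_ext zeta k z.1 z.2).
    by apply/funext => -[x y].
  by rewrite E.
exists (`|M| + `|point : R|) => k x y; rewrite /square_ext patchE.
case: ifPn => [|_]; last by rewrite lerDr.
rewrite inE => -[/= x01 y01]; rewrite (le_trans (zM k x y _ _))//.
by rewrite (le_trans (ler_norm M))// lerDl.
Qed.

Lemma square_ext_sym zeta : sym_kernels zeta ->
  forall k x y, square_ext zeta k x y = square_ext zeta k y x.
Proof.
move=> sz k x y; rewrite /square_ext !patchE /square_fun /=.
have E : ((x, y) \in sq) = ((y, x) \in sq).
  by apply/idP/idP; rewrite !inE => -[/= ? ?]; split.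
rewrite E; case: ifPn => //; rewrite inE => -[/= y01 x01].
exact: sz.
Qed.

Lemma eq_lagrangian n f0 (F : 'I_n -> qgraph R r) h mu u (W W' : kernels R r) :
  (forall k x y, 0 <= x <= 1 -> 0 <= y <= 1 -> W k x y = W' k x y) ->
  lagrangian f0 F h mu u W = lagrangian f0 F h mu u W'.
Proof.
move=> WW'; congr (_ - _).
  apply: eq_bigr => k _; apply: eq_Rintegral => -[x y].
  by rewrite inE => -[/=]; rewrite !in_itv/= => x01 y01; rewrite WW'.
apply: eq_bigr => s _; congr (_ * (_ - _)); apply: eq_bigr => c _; congr (_ * _).
rewrite !densityE; apply: eq_iter_integral; first exact: in_cube0.
by move=> x cx; apply: eq_bigr => q _; rewrite /on_edge WW'.
Qed.

Lemma D2_bounded_ext n f0 (F : 'I_n -> qgraph R r) h mu u (W zeta : kernels R r) :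
  D2_bounded f0 F h mu u W zeta = D2_bounded f0 F h mu u W (square_ext zeta).
Proof.
rewrite /D2_bounded; congr (derive1n 2 _ 0); apply/funext => e.
apply: eq_lagrangian => k x y x01 y01; congr (_ + _ * _).
by rewrite -(square_extE _ _ (unit_squareE x01 y01)).
Qed.

Section step.
Variables (m : nat) (p : step_param R r m).
Hypothesis p_pos : forall i, 0 < p.2 0 i.
Hypothesis p_sum : \sum_i p.2 0 i = 1.

Let p_ge0 i : 0 <= p.2 0 i. Proof. exact: ltW. Qed.

Lemma kernel_mass_ext zeta : measurable_kernels zeta -> bounded_kernels zeta ->
  kernel_mass p (square_ext zeta) = L2_normsq zeta.
Proof.
move=> mz bz; have gz := good_square_ext mz bz.
apply: eq_bigr => k _; have kz := good_kernel_ok k gz.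
have kz2 := kernel_okM kz kz.
have us : uniq [:: true; false] by [].
have ts : true \in [:: true; false] by [].
have fs : false \in [:: true; false] by [].
have tf : true != false by [].
have := iter_edge p_pos p_sum us ts fs tf kz2.
rewrite exchange_big /tot_mass /col_mass => <-.
rewrite -(square_integralE kz2); apply: eq_Rintegral => z; rewrite inE => sz.
by rewrite square_extE// expr2.
Qed.

Lemma block_sub_square i j : block p.2 i `*` block p.2 j `<=` sq.
Proof.
move=> -[x y] [/= /(block_sub01 p_ge0 p_sum) x01 /(block_sub01 p_ge0 p_sum) y01].
exact: unit_squareE.
Qed.

Lemma measurable_block2 i j :
  @measurable _ (RR * RR)%type (block p.2 i `*` block p.2 j).
Proof. by apply: measurableX; exact: measurable_block. Qed.

Lemma block_intE i j phi : kernel_ok phi -> block_int p.2 i j phi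
  = \int[mu2]_(z in block p.2 i `*` block p.2 j) phi z.1 z.2.
Proof.
move=> kp; have [mp [M pM]] := kp.
pose G (z : RR * RR) := \1_(block p.2 i) z.1 * \1_(block p.2 j) z.2 * phi z.1 z.2.
have mG : measurable_fun setT G.
  apply: measurable_funM; last exact: mp.
  apply: measurable_funM.
    apply: (@measurableT_comp _ _ _ _ _ _ (\1_(block p.2 i) : RR -> R)).
      exact: measurable_indic_block.
    exact: measurable_fst.
  apply: (@measurableT_comp _ _ _ _ _ _ (\1_(block p.2 j) : RR -> R)).
    exact: measurable_indic_block.
  exact: measurable_snd.
have bG : bnd G.
  apply: bndM; last by exists M => z; exact: pM.
  apply: bndM.
    by have [B hB] := bnd_indic R (block p.2 i); exists B => z; exact: hB.
  by have [B hB] := bnd_indic R (block p.2 j); exists B => z; exact: hB.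
have [E _] := Rintegral2E mG bG.
transitivity (\int[mu2]_(z in sq) G z); first exact: (esym E).
have -> : \int[mu2]_(z in block p.2 i `*` block p.2 j) phi z.1 z.2 =
   \int[mu2]_(z in sq `&` (block p.2 i `*` block p.2 j)) phi z.1 z.2.
  by rewrite setIidr//; exact: block_sub_square.
rewrite [RHS]Rintegral_mkcondr; apply: eq_Rintegral => -[x y] _.
rewrite patchE /G /= !indicE in_setX /=.
by case: (_ \in _); case: (_ \in _); rewrite ?mul1r ?mul0r ?mulr0 ?mul0r.
Qed.

(** The block integrals of [eta] vanish, so those of a nearby kernel are at most
    the distance to [eta]. *)
Lemma block_int_near zeta eta (e : R) k i j : 0 < e -> off_step p.2 eta ->
  measurable_kernels zeta -> bounded_kernels zeta ->
  L2_normsq (fun k x y => zeta k x y - eta k x y) <= e ^+ 2 ->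
  `|block_int p.2 i j (square_ext zeta k)| <= e.
Proof.
move=> e0 [[me ie] _ eta0] mz bz ze.
have gz := good_square_ext mz bz.
have msq := @measurable_unit_square R.
have mB := measurable_block2 i j; have Bsq := @block_sub_square i j.
have L2e : L2_square (square_fun eta k) by split; [exact: me|exact: ie].
have L2z : L2_square (square_fun (square_ext zeta) k).
  apply: bnd_L2_square; first exact: measurable_funTS (gz.1 k).
  by have [M zM] := gz.2; exists M => z; exact: zM.
have L2d := L2_squareB L2z L2e.
have iz : mu2.-integrable (block p.2 i `*` block p.2 j)
    (EFin \o square_fun (square_ext zeta) k).
  by apply: integrableS (L2_square_integrable L2z).
have iee : mu2.-integrable (block p.2 i `*` block p.2 j) (EFin \o square_fun eta k).
  by apply: integrableS (L2_square_integrable L2e).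
have E : block_int p.2 i j (square_ext zeta k) =
    \int[mu2]_(z in block p.2 i `*` block p.2 j)
      (square_fun (square_ext zeta) k z - square_fun eta k z).
  rewrite (RintegralB mB iz iee) (block_intE i j (good_kernel_ok k gz)).
  by rewrite [X in _ - X]eta0 subr0.
rewrite E (le_trans (Rintegral_sub_le mB Bsq L2d e0))//.
have le : normsq (fun z => square_fun (square_ext zeta) k z - square_fun eta k z)
    <= e ^+ 2.
  apply: le_trans ze; rewrite /L2_normsq (bigD1 k)//=.
  apply: (@le_trans _ _ (\int[mu2]_(z in sq) (zeta k z.1 z.2 - eta k z.1 z.2) ^+ 2)).
    rewrite le_eqVlt; apply/orP; left; apply/eqP; apply: eq_Rintegral => z.
    by rewrite inE => sz; rewrite /square_fun square_extE.
  by rewrite lerDl sumr_ge0// => l _; exact: normsq_ge0.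
have : normsq (fun z => square_fun (square_ext zeta) k z - square_fun eta k z) / e <= e.
  by rewrite ler_pdivrMr// -expr2.
lra.
Qed.

End step.

Lemma L2_square_of_kernels eta k : L2_kernels eta -> L2_square (square_fun eta k).
Proof. by move=> [me ie]; split; [exact: me|exact: ie]. Qed.

Lemma L2_square_of_bounded zeta k : measurable_kernels zeta ->
  bounded_kernels zeta -> L2_square (square_fun (square_ext zeta) k).
Proof.
move=> mz bz; have gz := good_square_ext mz bz.
apply: bnd_L2_square; first exact: measurable_funTS (gz.1 k).
by have [M zM] := gz.2; exists M => z; exact: zM.
Qed.

Lemma L2_normsq_ge0 (eta : kernels R r) : 0 <= L2_normsq eta.
Proof. by apply: sumr_ge0 => k _; exact: normsq_ge0. Qed.

Lemma L2_normsq_ext_sub (zeta eta : kernels R r) :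
  L2_normsq (fun k x y => zeta k x y - eta k x y)
  = \sum_k normsq (fun z => square_fun (square_ext zeta) k z - square_fun eta k z).
Proof.
apply: eq_bigr => k _; apply: eq_Rintegral => z; rewrite inE => sz.
by rewrite /square_fun square_extE.
Qed.

Lemma L2_normsq_ext (zeta : kernels R r) :
  L2_normsq zeta = \sum_k normsq (square_fun (square_ext zeta) k).
Proof.
apply: eq_bigr => k _; apply: eq_Rintegral => z; rewrite inE => sz.
by rewrite /square_fun square_extE.
Qed.

(** Truncating the values of [eta] keeps symmetry and gives bounded kernels that
    converge to [eta] in L^2 by dominated convergence. *)
Lemma L2_bounded_nbhs_proper (eta : kernels R r) : L2_kernels eta -> sym_kernels eta ->
  ProperFilter (L2_bounded_nbhs eta).
Proof.
move=> L2e se; apply: filter_from_proper.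
  apply: filter_from_filter; first by exists 1; exact: ltr01.
  move=> e e' e0 e'0; exists (Num.min e e'); first by rewrite /= lt_min e0.
  by move=> zeta [mz sz bz]; rewrite lt_min => /andP[h1 h2]; split.
move=> e e0.
have cv k : normsq (fun z => square_fun eta k z
    * \1_(`[- n%:R, n%:R]) (square_fun eta k z) - square_fun eta k z)
      @[n --> \oo] --> 0.
  by apply: truncation_cvg; exact: L2_square_of_kernels.
have e2 : 0 < e ^+ 2 / r.+1%:R by rewrite divr_gt0// exprn_gt0.
have : \forall n \near \oo, forall k, normsq (fun z => square_fun eta k z
    * \1_(`[- n%:R, n%:R]) (square_fun eta k z) - square_fun eta k z)
      < e ^+ 2 / r.+1%:R.
  apply: filter_forall => k.
  have /cvgrPdist_lt/(_ _ e2) := cv k; apply: filterS => n /=.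
  by rewrite sub0r normrN ger0_norm ?normsq_ge0.
case/filter_ex => n hn.
exists (fun k x y => eta k x y * \1_(`[- n%:R, n%:R]) (eta k x y)); split.
- move=> k; have [me _] := L2_square_of_kernels k L2e.
  apply: measurable_funM => //.
  by apply: (@measurableT_comp _ _ _ _ _ _ (\1_(`[- n%:R, n%:R]) : R -> R)).
- by move=> k x y x01 y01; rewrite se.
- exists n%:R => k x y _ _; rewrite indicE.
  case: (boolP (_ \in _)) => /=; last by rewrite mulr0 normr0.
  rewrite inE /= in_itv /= mulr1 ler_norml => /andP[-> ->].
  by [].
- rewrite -(@ger0_norm _ e) ?ltW// -sqrtr_sqr ltr_sqrt ?exprn_gt0//.
  have [r0|r0] := posnP r.
    rewrite /L2_normsq big1 ?exprn_gt0// => k _.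
    suff : (0 < r)%N by rewrite r0.
    exact: leq_ltn_trans (leq0n k) (ltn_ord k).
  apply: (@le_lt_trans _ _ (\sum_(k < r) e ^+ 2 / r.+1%:R)).
    by apply: ler_sum => k _; exact: ltW (hn k).
  rewrite sumr_const card_ord -[_ *+ r]mulr_natr -mulrA -ltr_pdivlMl ?exprn_gt0//.
  rewrite mulVf ?gt_eqF ?exprn_gt0// mulrC ltr_pdivrMr// mul1r ltr_nat.
  exact: ltnSn.
Qed.

End extension.

(** * Passage to the limit *)

Section off_step_limit.
Variables (R : realType) (r n m : nat) (p : step_param R r m).
Hypothesis p_pos : forall i, 0 < p.2 0 i.
Hypothesis p_sum : \sum_i p.2 0 i = 1.
Hypothesis p_sym : forall k i j, p.1 k i j = p.1 k j i.
Variables (F : 'I_n -> qgraph R r) (h : 'I_n -> 'I_r -> R -> R).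
Variables (f0 : R -> R) (mu u : 'rV[R]_n).
Hypothesis h_analytic : forall s k, real_analytic (h s k).
Hypothesis f0_analytic : real_analytic f0.

Local Notation D2 := (D2_bounded f0 F h mu u (step_fun p)).
Local Notation dist2 z y := (L2_normsq (fun k s t => z k s t - y k s t)).
Implicit Types eta zeta xi : kernels R r.

Let D2E zeta : measurable_kernels zeta -> bounded_kernels zeta ->
  D2 zeta = second_variation p F h f0 mu (square_ext zeta).
Proof.
move=> mz bz; rewrite D2_bounded_ext.
have gz := good_square_ext mz bz.
exact: D2_boundedE.
Qed.

Lemma normsq_young eta zeta (t : R) : 0 < t -> L2_kernels eta ->
  measurable_kernels zeta -> bounded_kernels zeta ->
  L2_normsq eta <= (1 + t) * L2_normsq zeta + (1 + t^-1) * dist2 zeta eta.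
Proof.
move=> t0 L2e mz bz; rewrite L2_normsq_ext_sub (L2_normsq_ext zeta).
rewrite !big_distrr -big_split; apply: ler_sum => k _ /=.
have L2z := L2_square_of_bounded k mz bz.
have L2k := L2_square_of_kernels k L2e.
apply: (normsq_le L2k L2z (L2_squareB L2z L2k)) => z.
move: (square_fun eta k z) (square_fun (square_ext zeta) k z) => x y.
rewrite -subr_ge0.
have -> : (1 + t) * y ^+ 2 + (1 + t^-1) * (y - x) ^+ 2 - x ^+ 2
  = (t * y + (y - x)) ^+ 2 / t by field; rewrite gt_eqF.
by rewrite divr_ge0 ?sqr_ge0// ltW.
Qed.

Lemma normsq_le2 eta zeta : L2_kernels eta ->
  measurable_kernels zeta -> bounded_kernels zeta ->
  L2_normsq zeta <= 2 * L2_normsq eta + 2 * dist2 zeta eta.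
Proof.
move=> L2e mz bz; rewrite L2_normsq_ext_sub (L2_normsq_ext zeta).
rewrite !big_distrr -big_split; apply: ler_sum => k _ /=.
have L2z := L2_square_of_bounded k mz bz.
have L2k := L2_square_of_kernels k L2e.
apply: (normsq_le L2z L2k (L2_squareB L2z L2k)) => z.
move: (square_fun eta k z) (square_fun (square_ext zeta) k z) => x y.
have := sqr_ge0 (y - 2 * x); rewrite !sqrrB exprMn; lra.
Qed.

Lemma kernel_mass_sub_le eta zeta xi : L2_kernels eta ->
  measurable_kernels zeta -> bounded_kernels zeta ->
  measurable_kernels xi -> bounded_kernels xi ->
  kernel_mass p (fun k x y => square_ext zeta k x y - square_ext xi k x y)
    <= 2 * dist2 zeta eta + 2 * dist2 xi eta.
Proof.
move=> L2e mz bz mx bx.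
have gz := good_square_ext mz bz; have gx := good_square_ext mx bx.
have gd := good_kernelsB gz gx.
set dl := (fun k x y => square_ext zeta k x y - square_ext xi k x y) in gd *.
have md : measurable_kernels dl.
  by move=> k; apply: measurable_funTS; exact: (gd.1 k).
have bd : bounded_kernels dl.
  by have [M dM] := gd.2; exists M => k x y _ _; exact: dM.
have -> : kernel_mass p dl = L2_normsq dl.
  rewrite -(kernel_mass_ext p_pos p_sum md bd); apply: eq_bigr => k _.
  apply: eq_bigr => j _; apply: eq_bigr => i _.
  have kd := good_kernel_ok k gd.
  have ke := good_kernel_ok k (good_square_ext md bd).
  rewrite /sq_int (block_intE p_pos p_sum i j (kernel_okM kd kd)).
  rewrite (block_intE p_pos p_sum i j (kernel_okM ke ke)).
  apply: eq_Rintegral => z; rewrite inE => /(block_sub_square p_pos p_sum) sz.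
  by rewrite square_extE.
have -> : L2_normsq dl = \sum_k normsq (fun z =>
    square_fun (square_ext zeta) k z - square_fun (square_ext xi) k z) by [].
rewrite (L2_normsq_ext_sub zeta eta) (L2_normsq_ext_sub xi eta).
rewrite !big_distrr -big_split; apply: ler_sum => k _ /=.
have L2z := L2_square_of_bounded k mz bz.
have L2x := L2_square_of_bounded k mx bx.
have L2k := L2_square_of_kernels k L2e.
apply: (normsq_le (L2_squareB L2z L2x) (L2_squareB L2z L2k) (L2_squareB L2x L2k)) => z.
move: (square_fun eta k z) (square_fun (square_ext zeta) k z)
  (square_fun (square_ext xi) k z) => x y w.
have := sqr_ge0 (y + w - 2 * x); rewrite !sqrrB sqrrD exprMn; lra.
Qed.

Lemma near_bound eta (e : R) : 0 < e ->
  \forall zeta \near L2_bounded_nbhs eta,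
    [/\ measurable_kernels zeta, sym_kernels zeta, bounded_kernels zeta
      & dist2 zeta eta <= e ^+ 2].
Proof.
move=> e0; exists e => // zeta [mz sz bz].
rewrite -[ltRHS](ger0_norm (ltW e0)) -sqrtr_sqr ltr_sqrt ?exprn_gt0// => /ltW le.
by split.
Qed.

(** The continuity estimate makes the image of the filter of bounded
    approximations a Cauchy filter. *)
Lemma D2_bounded_cvg eta : L2_kernels eta -> sym_kernels eta ->
  cvg (D2 @ L2_bounded_nbhs eta).
Proof.
move=> L2e se; have PF := L2_bounded_nbhs_proper L2e se.
have [K K0 lipK] := second_variation_lip p_pos p_sum F h f0 mu.
apply: cauchy_cvg; apply: cauchy_exP => e e0.
have Ne := L2_normsq_ge0 eta.
pose B := K * (4 * L2_normsq eta + 8) + 1.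
have B0 : 0 < B by rewrite ltr_wpDl// mulr_ge0// addr_ge0// mulr_ge0.
pose d := Num.min 1 (e / B / 2).
have d0 : 0 < d by rewrite lt_min ltr01 !divr_gt0.
have d1 : d <= 1 by rewrite ge_min lexx.
have dB : B * d < e.
  have : d <= e / B / 2 by rewrite ge_min lexx orbT.
  move/(ler_wpM2l (ltW B0))/le_lt_trans; apply.
  have -> : B * (e / B / 2) = e / 2 by field; rewrite gt_eqF.
  lra.
have nb := near_bound eta d0.
have [xi [mx sx bx dx]] := filter_ex nb.
exists (D2 xi); apply: filterS nb => zeta [mz sz bz dz].
rewrite /ball /=; apply: le_lt_trans dB.
rewrite (D2E mz bz) (D2E mx bx) distrC.
have gz := good_square_ext mz bz; have gx := good_square_ext mx bx.
apply: (le_trans (lipK _ _ d d0 gz gx)); rewrite /lip_err.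
rewrite (kernel_mass_ext p_pos p_sum mz bz) (kernel_mass_ext p_pos p_sum mx bx).
have s1 := normsq_le2 L2e mz bz; have s2 := normsq_le2 L2e mx bx.
have s3 := kernel_mass_sub_le L2e mz bz mx bx.
have d2 : d ^+ 2 <= 1 by rewrite exprn_ile1// ltW.
have s4 : kernel_mass p (fun k x y => square_ext zeta k x y - square_ext xi k x y) / d
    <= 4 * d.
  by rewrite ler_pdivrMr// -mulrA -expr2; lra.
have s5 : d * (L2_normsq zeta + L2_normsq xi) <= d * (4 * L2_normsq eta + 4).
  by apply: ler_wpM2l; [exact: ltW|lra].
apply: (@le_trans _ _ (K * (d * (4 * L2_normsq eta + 4) + 4 * d))).
  by apply: ler_wpM2l => //; exact: lerD.
have -> : K * (d * (4 * L2_normsq eta + 4) + 4 * d) = B * d - d by rewrite /B; ring.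
by rewrite lerBlDr lerDl ltW.
Qed.

(** A bounded kernel at distance [d] from [eta] has block integrals at most [d],
    so the coercivity estimate loses only O(d), and this bound is inherited by
    the limit. *)
Lemma D2_lagrangian_ge :
  (forall i j k, Gamma F h mu p < c_coef f0 F h mu p i j k) ->
  exists c0 : R, 0 < c0 /\ forall eta : kernels R r, off_step p.2 eta ->
    c0 * L2_normsq eta <= D2_lagrangian f0 F h mu u (step_fun p) eta.
Proof.
move=> cG.
have [c0 [C [c00 C0 low]]] :=
  @second_variation_lower R r n m p p_pos p_sum p_sym F h f0 mu cG.
exists c0; split => // eta off; have [L2e se _] := off.
have PF := L2_bounded_nbhs_proper L2e se.
have cv := D2_bounded_cvg L2e se.
have Ne := L2_normsq_ge0 eta.
apply/ler_addgt0Pr => e e0; rewrite -lerBlDr.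
pose B := c0 * L2_normsq eta + c0 + C + 1.
have B0 : 0 < B by rewrite ltr_wpDl// !addr_ge0// ?mulr_ge0// ltW.
pose d := Num.min 1 (e / B).
have d0 : 0 < d by rewrite lt_min ltr01 divr_gt0.
have d1 : d <= 1 by rewrite ge_min lexx.
have dB : B * d <= e.
  have : d <= e / B by rewrite ge_min lexx orbT.
  move/(ler_wpM2l (ltW B0))/le_trans; apply.
  by rewrite mulrCA divff ?mulr1// gt_eqF.
apply: limr_ge; first exact: cv.
apply: filterS (near_bound eta d0) => zeta [mz sz bz dz].
rewrite (D2E mz bz).
have gz := good_square_ext mz bz.
have hd k i j : `|block_int p.2 i j (square_ext zeta k)| <= d.
  exact: (block_int_near p_pos p_sum k i j d0 off mz bz dz).
apply: le_trans (low _ d gz (square_ext_sym sz) hd).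
rewrite (kernel_mass_ext p_pos p_sum mz bz).
(* With weight d in Young's inequality the two error terms are both O(d). *)
have y1 : (1 - d) * L2_normsq eta - d <= L2_normsq zeta.
  have := normsq_young d0 L2e mz bz.
  have nz := L2_normsq_ge0 (fun k s t => zeta k s t - eta k s t).
  have d10 : 0 < 1 + d by rewrite ltr_pwDl// ltW.
  have h1 : (1 + d^-1) * dist2 zeta eta <= (1 + d) * d.
    have -> : (1 + d) * d = (1 + d^-1) * d ^+ 2 by field; rewrite gt_eqF.
    by apply: ler_wpM2l => //; rewrite addr_ge0// invr_ge0 ltW.
  move=> h2; rewrite -(ler_pM2l d10).
  have h3 : 0 <= d ^+ 2 * L2_normsq eta by rewrite mulr_ge0// sqr_ge0.
  have -> : (1 + d) * ((1 - d) * L2_normsq eta - d)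
    = L2_normsq eta - d ^+ 2 * L2_normsq eta - (1 + d) * d by ring.
  lra.
have d2 : d ^+ 2 <= d by rewrite expr2 ler_piMl// ltW.
have := ler_wpM2l (ltW c00) y1; have := ler_wpM2l C0 d2.
move: dB; rewrite /B; lra.
Qed.

End off_step_limit.

Theorem theorem5p14 (R : realType) (r n : nat) (r_ge1 : (1 <= r)%N)
  (F : 'I_n -> qgraph R r)
  (h : 'I_n -> 'I_r -> R -> R) (h_analytic : forall i k, real_analytic (h i k))
  (f0 : R -> R) (f0_analytic : real_analytic f0)
  (u : 'rV[R]_n) (u_reg : Reg F h u)
  (m1 : nat) (m1_def : is_m1 F u h m1)
  (V : step_param R r m1) (V_level : level_set F u h V)
  (V_pos : forall i, 0 < V.2 0 i)
  (mu : 'rV[R]_n) (V_crit : critical_point f0 F h mu u V)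
  (V_hess : forall d, tangent_space F h V d -> d != 0 ->
              0 < lagrangian_hessian f0 F h mu u V d)
  (c_gt_Gamma : forall (i j : 'I_m1) (k : 'I_r),
     Gamma F h mu V < c_coef f0 F h mu V i j k) :
  exists c0 : R, 0 < c0 /\
    forall eta : kernels R r, off_step V.2 eta ->
      c0 * L2_normsq eta <= D2_lagrangian f0 F h mu u (step_fun V) eta.
Proof.
have [[V_sym [_ V_sum]] _] := V_level.
apply: D2_lagrangian_ge => //.
by move=> k i j; rewrite -{1}(V_sym k) mxE.
Qed.
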